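(* Let $\mu\in\mathbb{R}$ and let $\gamma:[0,L]\to\mathbb{R}^3$ be an arclength parametrized Frenet curve with curvature $\kappa$, torsion $\tau$, modified torsion $\lambda=\tau/\kappa$ and Frenet frame $T,N,B$. Let $$b_1=s_1T+s_2N+s_3B-\gamma\times b_0,$$ where $$s_1:=2\kappa\lambda(1+\lambda^2),\qquad s_2:=\tfrac1\kappa\left(2\kappa\lambda(1+\lambda^2)\right)',\qquad s_3:=\kappa(1+\lambda^2)(1-\lambda^2),$$ and $b_0$ is the force vector of $\gamma$. If $\gamma$ defines an elastic strip (with Lagrange multiplier $\mu$), then the torque vector $b_1$ is constant along $\gamma$. Furthermore, if $b_1$ is constant but $\gamma$ does not define an elastic strip (with Lagrange multiplier $\mu$), then $|\gamma|$ is constant.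
   Context: All curves and variations are smooth ($C^\infty$). A Frenet curve is a regular curve $\gamma:[0,L]\to\mathbb{R}^3$ with nowhere vanishing curvature. Write $v=|\gamma'|$, $\kappa=|\gamma'\times\gamma''|/|\gamma'|^3$, $\tau=\det(\gamma',\gamma'',\gamma''')/|\gamma'\times\gamma''|^2$, and $\lambda=\tau/\kappa$ (the modified torsion). The Frenet frame $(T,N,B)$ satisfies $\gamma'=vT$, $T'=v\kappa N$, $N'=-v\kappa T+v\lambda\kappa B$, $B'=-v\lambda\kappa N$. For $\mu\in\mathbb{R}$ the modified Sadowsky functional is $$S_\mu(\gamma)=\int_0^L\left(\kappa^2(1+\lambda^2)^2-\mu\right)v\,dt.$$ The curve $\gamma$ defines an elastic strip with Lagrange multiplier $\mu$ if $\gamma$ is a critical point of $S_\mu$, i.e. $\frac{d}{dt}\big|_{t=0}S_\mu(\gamma_t)=0$ for every proper variation of $\gamma$, a proper variation being a smooth family of Frenet curves $\gamma_t$ with $\gamma_0=\gamma$ and $\gamma_t=\gamma$ near both end points. For an arclength parametrized $\gamma$ the force vector is $b_0=a_1T+a_2N+a_3B$ with $a_1=\frac12(\kappa^2(1+\lambda^2)^2+\mu)$, $a_2=\kappa'(1+\lambda^2)^2+2\kappa(1+\lambda^2)\lambda\lambda'$, $a_3=-\left(\kappa^2(1+\lambda^2)^2\lambda+\left(\frac{\kappa'}{\kappa}(1+\lambda^2)2\lambda\right)'+\left((1+\lambda^2)2\lambda\right)''\right)$, where $'$ is the arclength derivative. *)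

(* Defs.v *)
(* Stdlib reals with Coquelicot. *)
From Stdlib Require Import Reals.
From Coquelicot Require Import Coquelicot.
Open Scope R_scope.

(** * Vectors of R^3 *)

Definition vec : Type := (R * R * R)%type.

Definition cx (u : vec) : R := fst (fst u).
Definition cy (u : vec) : R := snd (fst u).
Definition cz (u : vec) : R := snd u.

Definition vadd (u w : vec) : vec := (cx u + cx w, cy u + cy w, cz u + cz w).
Definition vsub (u w : vec) : vec := (cx u - cx w, cy u - cy w, cz u - cz w).
Definition vscal (a : R) (u : vec) : vec := (a * cx u, a * cy u, a * cz u).
Definition dot (u w : vec) : R := cx u * cx w + cy u * cy w + cz u * cz w.
Definition vnorm (u : vec) : R := sqrt (dot u u).
Definition cross (u w : vec) : vec :=
  (cy u * cz w - cz u * cy w,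
   cz u * cx w - cx u * cz w,
   cx u * cy w - cy u * cx w).
Definition det3 (u w z : vec) : R := dot (cross u w) z.

(** * Smoothness

    A curve on [[0, L]] is given by a function on [R] of which only the values
    on [[0, L]] matter; it is smooth if it is infinitely differentiable in a
    neighbourhood of every point of [[0, L]], so that the two-sided derivatives
    below are the right ones at the end points too. *)

Definition smooth_at (f : R -> R) (s : R) : Prop :=
  locally s (fun u => forall n : nat, ex_derive_n f n u).

Definition smooth_at_2d (f : R -> R -> R) (t s : R) : Prop :=
  locally_2d (fun u w => forall n : nat, ex_diff_n f n u w) t s.

Definition smooth_curve (L : R) (g : R -> vec) : Prop :=
  forall s, 0 <= s <= L ->
    smooth_at (fun u => cx (g u)) s /\
    smooth_at (fun u => cy (g u)) s /\
    smooth_at (fun u => cz (g u)) s.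

(* Joint smoothness of [(t, s) |-> G t s] on (-eps, eps) x [0, L]. *)
Definition smooth_family (L eps : R) (G : R -> R -> vec) : Prop :=
  forall t s, - eps < t < eps -> 0 <= s <= L ->
    smooth_at_2d (fun u w => cx (G u w)) t s /\
    smooth_at_2d (fun u w => cy (G u w)) t s /\
    smooth_at_2d (fun u w => cz (G u w)) t s.

(** * Frenet curves *)

Definition vderive (g : R -> vec) (s : R) : vec :=
  (Derive (fun u => cx (g u)) s,
   Derive (fun u => cy (g u)) s,
   Derive (fun u => cz (g u)) s).

Definition speed (g : R -> vec) (s : R) : R := vnorm (vderive g s).

Definition curvature (g : R -> vec) (s : R) : R :=
  vnorm (cross (vderive g s) (vderive (vderive g) s)) / vnorm (vderive g s) ^ 3.

Definition torsion (g : R -> vec) (s : R) : R :=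
  det3 (vderive g s) (vderive (vderive g) s) (vderive (vderive (vderive g)) s)
  / vnorm (cross (vderive g s) (vderive (vderive g) s)) ^ 2.

Definition mtorsion (g : R -> vec) (s : R) : R := torsion g s / curvature g s.

Definition frenet_curve (L : R) (g : R -> vec) : Prop :=
  smooth_curve L g /\
  (forall s, 0 <= s <= L -> speed g s <> 0) /\
  (forall s, 0 <= s <= L -> curvature g s <> 0).

Definition arclength (L : R) (g : R -> vec) : Prop :=
  forall s, 0 <= s <= L -> speed g s = 1.

Definition frameT (g : R -> vec) (s : R) : vec :=
  vscal (/ speed g s) (vderive g s).
Definition frameN (g : R -> vec) (s : R) : vec :=
  vscal (/ (speed g s * curvature g s)) (vderive (frameT g) s).
Definition frameB (g : R -> vec) (s : R) : vec :=
  cross (frameT g s) (frameN g s).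

(* The vector with components [c1], [c2], [c3] in the Frenet frame. *)
Definition in_frame (g : R -> vec) (c1 c2 c3 : R -> R) (s : R) : vec :=
  vadd (vadd (vscal (c1 s) (frameT g s)) (vscal (c2 s) (frameN g s)))
       (vscal (c3 s) (frameB g s)).

(** * Elastic strips *)

Definition sadowsky (mu L : R) (g : R -> vec) : R :=
  RInt (fun s => (curvature g s ^ 2 * (1 + mtorsion g s ^ 2) ^ 2 - mu)
                 * speed g s) 0 L.

(* The neighbourhoods of the end points on which the variation is trivial do
   not depend on [t]. *)
Definition proper_variation (L : R) (g : R -> vec) (eps : R)
    (G : R -> R -> vec) : Prop :=
  0 < eps /\
  smooth_family L eps G /\
  (forall t, - eps < t < eps -> frenet_curve L (G t)) /\
  (forall s, 0 <= s <= L -> G 0 s = g s) /\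
  (exists eta, 0 < eta /\
    forall t s, - eps < t < eps -> 0 <= s <= L ->
      s < eta \/ L - eta < s -> G t s = g s).

Definition elastic_strip (mu L : R) (g : R -> vec) : Prop :=
  frenet_curve L g /\
  forall (eps : R) (G : R -> R -> vec), proper_variation L g eps G ->
    is_derive (fun t => sadowsky mu L (G t)) 0 0.

(** * Force and torque vectors of an arclength parametrized curve

    Since the parameter is arclength, [Derive] is the arclength derivative. *)

Section ForceTorque.

Variables (mu : R) (g : R -> vec).

Local Notation kappa := (curvature g).
Local Notation lambda := (mtorsion g).

Definition force1 (s : R) : R :=
  / 2 * (kappa s ^ 2 * (1 + lambda s ^ 2) ^ 2 + mu).

Definition force2 (s : R) : R :=
  Derive kappa s * (1 + lambda s ^ 2) ^ 2
  + 2 * kappa s * (1 + lambda s ^ 2) * lambda s * Derive lambda s.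

Definition force3 (s : R) : R :=
  - (kappa s ^ 2 * (1 + lambda s ^ 2) ^ 2 * lambda s
     + Derive (fun u => Derive kappa u / kappa u
                        * (1 + lambda u ^ 2) * (2 * lambda u)) s
     + Derive_n (fun u => (1 + lambda u ^ 2) * (2 * lambda u)) 2 s).

Definition force_vector : R -> vec := in_frame g force1 force2 force3.

Definition torque1 (s : R) : R := 2 * kappa s * lambda s * (1 + lambda s ^ 2).

Definition torque2 (s : R) : R :=
  1 / kappa s * Derive (fun u => 2 * kappa u * lambda u * (1 + lambda u ^ 2)) s.

Definition torque3 (s : R) : R :=
  kappa s * (1 + lambda s ^ 2) * (1 - lambda s ^ 2).

Definition torque_vector (s : R) : vec :=
  vsub (in_frame g torque1 torque2 torque3 s) (cross (g s) (force_vector s)).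

End ForceTorque.

Definition constant_on {A : Type} (L : R) (f : R -> A) : Prop :=
  exists c : A, forall s, 0 <= s <= L -> f s = c.

(* Main.v *)
(* The derivative of the part [s1 T + s2 N + s3 B] of the torque vector is [T x b0],
   so [b1' = - g x b0'], and the first variation of the Sadowsky functional in the
   direction [V] is [2 int <b0', V>]; hence a curve is an elastic strip exactly when
   [b0] is constant, and then [b1] is constant too.

   Conversely let [b1] be constant, i.e. [g x b0' = 0].  Since [b0'] is orthogonal to
   [T], so is [g] wherever [b0' <> 0].  On a maximal interval around such a point on
   which [g] is orthogonal to [T] the curve is spherical, and [g x b0' = 0] is a
   regular polynomial differential equation for it, so that [b0'] is analytic there.
   If an end point [p] of the interval is interior to [0, L], then near [p] there are
   points where [g] is not orthogonal to [T], around which [b0'] vanishes; so all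
   derivatives of [b0'] vanish at [p], and [b0' = 0] on the interval by analyticity, a
   contradiction.  Hence [g] is orthogonal to [T] everywhere and [|g|] is constant. *)

Require Import Defs.
From Stdlib Require Import Reals Lra Lia Factorial List Classical.
From Coquelicot Require Import Coquelicot.
Open Scope R_scope.

(** * Smooth functions of one variable *)

(** The obstacle to the converse is that smoothness alone does not prevent a spherical arc with
    [b0' <> 0] from being joined to an arc with constant [b0]. On a spherical arc
    [g = - N / k + h B] with [h = <g, B>], whence [h' = l] and [k' = l k^3 h]. All derivatives of
    [k] are thus eliminated. Let [e2], [e3] be the components of [b0'] along [N] and [B]; the
    tangential part of [g x b0' = 0] is [e3 = - k h e2], an equation whose highest derivative is
    [l'''], with coefficient [2 + 6 l^2] up to sign, never zero. Uniqueness for this system does not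
    conclude: beyond the end point the curve need not be spherical and need not solve it. What is
    known at the end point is only that the Taylor series of [e2] vanishes. Hence the Taylor
    estimates, uniform on the open arc, which carry flatness of [e2] inwards from the end point;
    [e3] follows by [e3 = - k h e2].

    The Frenet equations are proved at interior points, since [arclength] constrains nothing outside
    [[0, L]]; end points are reached by continuity. *)

Lemma ex_derive_n_coind (C : (R -> R) -> Prop) (U : R -> Prop) :
  open U ->
  (forall f, C f -> exists f', C f' /\ forall x, U x -> is_derive f x (f' x)) ->
  forall f, C f -> forall n x, U x -> ex_derive_n f n x.
Proof.
intros HU HC f Hf.
(* Each iterated derivative agrees on the open set [U] with a member of [C], which is itself
   differentiable there. *)
assert (H : forall n, exists h, C h /\ forall x, U x -> Derive_n f n x = h x).
{ induction n as [|n [h [Ch Hh]]].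
  - exists f; split; auto.
  - destruct (HC h Ch) as [h' [Ch' Hh']].
    exists h'; split; auto; intros x Ux; simpl.
    rewrite (Derive_ext_loc _ h).
    + now apply is_derive_unique, Hh'.
    + apply (filter_imp U); auto. }
intros [|n] x Ux; simpl; auto.
destruct (H n) as [h [Ch Hh]].
destruct (HC h Ch) as [h' [_ Hh']].
apply (ex_derive_ext_loc h).
- apply (filter_imp U); [intros y Uy; symmetry; auto | auto].
- exists (h' x); auto.
Qed.

Lemma Derive_n_Derive (f : R -> R) (n : nat) (x : R) :
  Derive_n (Derive f) n x = Derive_n f (S n) x.
Proof.
revert x; induction n as [|n IH]; intros x; auto.
simpl; apply Derive_ext; intros t; apply IH.
Qed.

Lemma ex_derive_n_Derive (f : R -> R) (n : nat) (x : R) :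
  ex_derive_n f (S n) x -> ex_derive_n (Derive f) n x.
Proof.
destruct n as [|n]; intros H; [exact I|].
simpl in *; revert H; apply ex_derive_ext; intros t.
symmetry; apply Derive_n_Derive.
Qed.

(* The closure of the smooth functions on [U] under the algebraic operations is
   stable under differentiation, whence all its members are smooth. *)
Inductive smooth_gen (U : R -> Prop) : (R -> R) -> Prop :=
| gen_base f : (forall x, U x -> forall n, ex_derive_n f n x) -> smooth_gen U f
| gen_plus f h : smooth_gen U f -> smooth_gen U h ->
    smooth_gen U (fun x => f x + h x)
| gen_mult f h : smooth_gen U f -> smooth_gen U h ->
    smooth_gen U (fun x => f x * h x)
| gen_inv f : (forall x, U x -> f x <> 0) -> smooth_gen U f ->
    smooth_gen U (fun x => / f x)
| gen_sqrt f : (forall x, U x -> 0 < f x) -> smooth_gen U f ->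
    smooth_gen U (fun x => sqrt (f x)).

Lemma ex_derive_n_const (c : R) (n : nat) (x : R) : ex_derive_n (fun _ => c) n x.
Proof.
destruct n as [|n]; [exact I|]; simpl.
destruct n as [|n].
- apply ex_derive_const.
- apply (ex_derive_ext (fun _ => 0)).
  + intros t; symmetry; apply Derive_n_const.
  + apply ex_derive_const.
Qed.

Lemma smooth_gen_ex_derive_n (U : R -> Prop) : open U ->
  forall f, smooth_gen U f -> forall n x, U x -> ex_derive_n f n x.
Proof.
intros HU; apply ex_derive_n_coind; auto.
intros f Hf; induction Hf as [f H|f h _ [f' [Cf Hf]] _ [h' [Ch Hh]]
  |f h Gf [f' [Cf Hf]] Gh [h' [Ch Hh]]|f Hn Gf [f' [Cf Hf]]|f Hn Gf [f' [Cf Hf]]].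
- exists (Derive f); split.
  + apply gen_base; intros x Ux n; apply ex_derive_n_Derive; auto.
  + intros x Ux; apply Derive_correct, (H x Ux 1%nat).
- exists (fun x => f' x + h' x); split; [now apply gen_plus|].
  intros x Ux; apply (@is_derive_plus R_AbsRing); auto.
- exists (fun x => f' x * h x + f x * h' x); split.
  + apply gen_plus; now apply gen_mult.
  + intros x Ux; apply (is_derive_mult f h); auto; intros; apply Rmult_comm.
- exists (fun x => (-1) * f' x * (/ f x * / f x)); split.
  + repeat apply gen_mult; auto using gen_inv.
    apply gen_base; intros; apply ex_derive_n_const.
  + intros x Ux.
    replace (_ * _) with (- f' x / f x ^ 2) by (field; auto).
    apply is_derive_inv; auto.
- exists (fun x => f' x * (/ 2 * / sqrt (f x))); split.
  + repeat apply gen_mult; auto.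
    * apply gen_base; intros; apply ex_derive_n_const.
    * apply gen_inv; [|now apply gen_sqrt].
      intros x Ux H; apply sqrt_eq_0 in H; specialize (Hn x Ux); lra.
  + intros x Ux.
    assert (0 < sqrt (f x)) by (apply sqrt_lt_R0; auto).
    replace (_ * _) with (f' x / (2 * sqrt (f x))) by (field; lra).
    apply is_derive_sqrt; auto.
Qed.

Lemma smooth_at_gen (U : R -> Prop) (f : R -> R) (s : R) :
  open U -> U s -> smooth_gen U f -> smooth_at f s.
Proof.
intros HU Us Hf; unfold smooth_at; apply (filter_imp U); auto.
intros u Uu n; now apply (smooth_gen_ex_derive_n U).
Qed.

(** Supplies the open sets needed by [smooth_gen]: smoothness at a point and nonvanishing near it
    both have the form [locally x P]. *)
Lemma open_locally (P : R -> Prop) : open (fun x : R => locally x P).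
Proof. intros x Hx; now apply locally_locally. Qed.

Lemma gen_smooth_at (P : R -> Prop) (f : R -> R) :
  (forall u, P u -> forall n, ex_derive_n f n u) ->
  smooth_gen (fun x => locally x P) f.
Proof.
intros H; apply gen_base; intros x Hx.
apply (H x), locally_singleton, Hx.
Qed.

Lemma smooth_at_derive (f : R -> R) (s : R) :
  smooth_at f s -> is_derive f s (Derive f s).
Proof.
intros H; apply Derive_correct; apply locally_singleton in H; exact (H 1%nat).
Qed.

Lemma smooth_at_ex_derive (f : R -> R) (s : R) : smooth_at f s -> ex_derive f s.
Proof. intros H; eexists; now apply smooth_at_derive. Qed.

Lemma smooth_at_continuous (f : R -> R) (s : R) :
  smooth_at f s -> continuous f s.
Proof.
intros H; apply (ex_derive_continuous f); now apply smooth_at_ex_derive.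
Qed.

Lemma smooth_at_Derive (f : R -> R) (s : R) :
  smooth_at f s -> smooth_at (Derive f) s.
Proof.
unfold smooth_at; apply filter_imp; intros u Hu n; apply ex_derive_n_Derive, Hu.
Qed.

Lemma smooth_at_Derive_n (f : R -> R) (n : nat) (s : R) :
  smooth_at f s -> smooth_at (Derive_n f n) s.
Proof.
intros H; induction n as [|n IH]; auto; now apply smooth_at_Derive in IH.
Qed.

Lemma smooth_at_locally (f : R -> R) (s : R) :
  smooth_at f s -> locally s (smooth_at f).
Proof. intros H; now apply locally_locally in H. Qed.

Lemma smooth_at_ext_loc (f h : R -> R) (s : R) :
  locally s (fun u => f u = h u) -> smooth_at f s -> smooth_at h s.
Proof.
unfold smooth_at; intros E H; apply locally_locally in E.
generalize (filter_and _ _ E H); apply filter_imp.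
intros u [Eu Hu] n; now apply (ex_derive_n_ext_loc f).
Qed.

Lemma smooth_at_ext (f h : R -> R) (s : R) :
  (forall u, f u = h u) -> smooth_at f s -> smooth_at h s.
Proof. intros E; apply smooth_at_ext_loc; now apply filter_forall. Qed.

Lemma smooth_at_const (c s : R) : smooth_at (fun _ => c) s.
Proof. unfold smooth_at; apply filter_forall; intros; apply ex_derive_n_const. Qed.

Lemma smooth_at_plus (f h : R -> R) (s : R) :
  smooth_at f s -> smooth_at h s -> smooth_at (fun x => f x + h x) s.
Proof.
unfold smooth_at; intros Hf Hh; generalize (filter_and _ _ Hf Hh); intros H.
apply (smooth_at_gen _ _ _ (open_locally _) H).
apply gen_plus; apply gen_smooth_at; now intros u [? ?].
Qed.

Lemma smooth_at_mult (f h : R -> R) (s : R) :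
  smooth_at f s -> smooth_at h s -> smooth_at (fun x => f x * h x) s.
Proof.
unfold smooth_at; intros Hf Hh; generalize (filter_and _ _ Hf Hh); intros H.
apply (smooth_at_gen _ _ _ (open_locally _) H).
apply gen_mult; apply gen_smooth_at; now intros u [? ?].
Qed.

Lemma smooth_at_inv (f : R -> R) (s : R) :
  f s <> 0 -> smooth_at f s -> smooth_at (fun x => / f x) s.
Proof.
intros H0 Hf.
assert (H1 : locally s (fun x => f x <> 0)).
{ apply (smooth_at_continuous f s Hf (fun y => y <> 0)), open_neq, H0. }
unfold smooth_at in Hf; generalize (filter_and _ _ H1 Hf); intros H.
apply (smooth_at_gen _ _ _ (open_locally _) H).
apply gen_inv.
- intros x Hx; apply locally_singleton in Hx; apply Hx.
- apply gen_smooth_at; now intros u [? ?].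
Qed.

Lemma smooth_at_sqrt (f : R -> R) (s : R) :
  0 < f s -> smooth_at f s -> smooth_at (fun x => sqrt (f x)) s.
Proof.
intros H0 Hf.
assert (H1 : locally s (fun x => 0 < f x)).
{ apply (smooth_at_continuous f s Hf (fun y => 0 < y)), open_gt, H0. }
unfold smooth_at in Hf; generalize (filter_and _ _ H1 Hf); intros H.
apply (smooth_at_gen _ _ _ (open_locally _) H).
apply gen_sqrt.
- intros x Hx; apply locally_singleton in Hx; apply Hx.
- apply gen_smooth_at; now intros u [? ?].
Qed.

Lemma smooth_at_opp (f : R -> R) (s : R) :
  smooth_at f s -> smooth_at (fun x => - f x) s.
Proof.
intros H; apply (smooth_at_ext (fun x => (-1) * f x)); [intros; ring|].
apply smooth_at_mult; auto using smooth_at_const.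
Qed.

Lemma smooth_at_minus (f h : R -> R) (s : R) :
  smooth_at f s -> smooth_at h s -> smooth_at (fun x => f x - h x) s.
Proof. intros; apply smooth_at_plus; auto using smooth_at_opp. Qed.

Lemma smooth_at_div (f h : R -> R) (s : R) :
  h s <> 0 -> smooth_at f s -> smooth_at h s -> smooth_at (fun x => f x / h x) s.
Proof. intros; apply smooth_at_mult; auto using smooth_at_inv. Qed.

Lemma smooth_at_pow (f : R -> R) (n : nat) (s : R) :
  smooth_at f s -> smooth_at (fun x => f x ^ n) s.
Proof.
intros H; induction n as [|n IH]; simpl; auto using smooth_at_const, smooth_at_mult.
Qed.

#[local] Hint Resolve smooth_at_const smooth_at_plus smooth_at_mult smooth_at_opp
  smooth_at_minus smooth_at_pow smooth_at_Derive smooth_at_Derive_n : sm.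

(** * Vector-valued functions *)

Definition vsmooth_at (f : R -> vec) (s : R) : Prop :=
  smooth_at (fun u => cx (f u)) s /\
  smooth_at (fun u => cy (f u)) s /\
  smooth_at (fun u => cz (f u)) s.

Definition is_vderive (f : R -> vec) (s : R) (v : vec) : Prop :=
  is_derive (fun u => cx (f u)) s (cx v) /\
  is_derive (fun u => cy (f u)) s (cy v) /\
  is_derive (fun u => cz (f u)) s (cz v).

Lemma vec_ext (u w : vec) : cx u = cx w -> cy u = cy w -> cz u = cz w -> u = w.
Proof.
destruct u as [[? ?] ?], w as [[? ?] ?]; unfold cx, cy, cz; simpl; now intros -> -> ->.
Qed.

Lemma vsmooth_at_vderive (f : R -> vec) (s : R) :
  vsmooth_at f s -> vsmooth_at (vderive f) s.
Proof. intros (?&?&?); repeat split; now apply smooth_at_Derive. Qed.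

Lemma vsmooth_at_derive (f : R -> vec) (s : R) :
  vsmooth_at f s -> is_vderive f s (vderive f s).
Proof. intros (?&?&?); repeat split; now apply smooth_at_derive. Qed.

Lemma vsmooth_at_vadd (f h : R -> vec) (s : R) :
  vsmooth_at f s -> vsmooth_at h s -> vsmooth_at (fun u => vadd (f u) (h u)) s.
Proof. intros (?&?&?) (?&?&?); repeat split; unfold cx, cy, cz; simpl; auto with sm. Qed.

Lemma vsmooth_at_vsub (f h : R -> vec) (s : R) :
  vsmooth_at f s -> vsmooth_at h s -> vsmooth_at (fun u => vsub (f u) (h u)) s.
Proof. intros (?&?&?) (?&?&?); repeat split; unfold cx, cy, cz; simpl; auto with sm. Qed.

Lemma vsmooth_at_vscal (a : R -> R) (f : R -> vec) (s : R) :
  smooth_at a s -> vsmooth_at f s -> vsmooth_at (fun u => vscal (a u) (f u)) s.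
Proof. intros ? (?&?&?); repeat split; unfold cx, cy, cz; simpl; auto with sm. Qed.

Lemma vsmooth_at_cross (f h : R -> vec) (s : R) :
  vsmooth_at f s -> vsmooth_at h s -> vsmooth_at (fun u => cross (f u) (h u)) s.
Proof.
intros (?&?&?) (?&?&?); repeat split; unfold cross, cx, cy, cz; simpl; auto with sm.
Qed.

Lemma smooth_at_dot (f h : R -> vec) (s : R) :
  vsmooth_at f s -> vsmooth_at h s -> smooth_at (fun u => dot (f u) (h u)) s.
Proof. intros (?&?&?) (?&?&?); unfold dot; auto 7 with sm. Qed.

Lemma dot_self_ge_0 (u : vec) : 0 <= dot u u.
Proof. unfold dot; nra. Qed.

Lemma vnorm_neq_0 (u : vec) : vnorm u <> 0 <-> 0 < dot u u.
Proof.
unfold vnorm; split; intros H.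
- destruct (dot_self_ge_0 u) as [|E]; auto.
  exfalso; apply H; rewrite <- E; apply sqrt_0.
- apply Rgt_not_eq, sqrt_lt_R0, H.
Qed.

Lemma smooth_at_vnorm (f : R -> vec) (s : R) :
  vnorm (f s) <> 0 -> vsmooth_at f s -> smooth_at (fun u => vnorm (f u)) s.
Proof.
intros H Hf; apply smooth_at_sqrt; [now apply vnorm_neq_0|now apply smooth_at_dot].
Qed.

Lemma is_vderive_unique (f : R -> vec) (s : R) (v : vec) :
  is_vderive f s v -> vderive f s = v.
Proof. intros (?&?&?); apply vec_ext; now apply is_derive_unique. Qed.

Lemma is_vderive_ext_loc (f h : R -> vec) (s : R) (v : vec) :
  locally s (fun u => f u = h u) -> is_vderive f s v -> is_vderive h s v.
Proof.
intros [d Hd] (?&?&?); repeat split; (eapply is_derive_ext_loc; [|eassumption]);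
  exists d; intros y Hy; cbv beta; now rewrite (Hd y Hy).
Qed.

Lemma is_derive_Rplus (f h : R -> R) (s a b : R) :
  is_derive f s a -> is_derive h s b -> is_derive (fun x => f x + h x) s (a + b).
Proof. exact (is_derive_plus f h s a b). Qed.

Lemma is_derive_Rminus (f h : R -> R) (s a b : R) :
  is_derive f s a -> is_derive h s b -> is_derive (fun x => f x - h x) s (a - b).
Proof. exact (is_derive_minus f h s a b). Qed.

Lemma is_derive_Ropp (f : R -> R) (s a : R) :
  is_derive f s a -> is_derive (fun x => - f x) s (- a).
Proof. exact (is_derive_opp f s a). Qed.

Lemma is_derive_Rmult (f h : R -> R) (s a b : R) :
  is_derive f s a -> is_derive h s b ->
  is_derive (fun x => f x * h x) s (a * h s + f s * b).
Proof. intros; apply (is_derive_mult f h); auto; intros; apply Rmult_comm. Qed.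

Lemma is_derive_Rinv (f : R -> R) (s a : R) :
  f s <> 0 -> is_derive f s a -> is_derive (fun x => / f x) s (- a / f s ^ 2).
Proof. intros; now apply is_derive_inv. Qed.

Lemma is_derive_Rdiv (f h : R -> R) (s a b : R) :
  h s <> 0 -> is_derive f s a -> is_derive h s b ->
  is_derive (fun x => f x / h x) s (a * / h s + f s * (- b / h s ^ 2)).
Proof.
intros; apply (is_derive_Rmult f (fun x => / h x)); auto; now apply is_derive_Rinv.
Qed.

Lemma is_derive_Rpow (f : R -> R) (n : nat) (s a : R) :
  is_derive f s a -> is_derive (fun x => f x ^ n) s (INR n * a * f s ^ pred n).
Proof. apply is_derive_pow. Qed.

Lemma is_derive_Rconst (c s : R) : is_derive (fun _ => c) s 0.
Proof. exact (is_derive_const c s). Qed.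

Lemma is_derive_eq (f : R -> R) (s a b : R) :
  is_derive f s a -> a = b -> is_derive f s b.
Proof. now intros H <-. Qed.

(** Reads the derivative off the shape of the function, so that its value may be a unification
    variable in the goal. The expected closed form is compared afterwards, through [is_derive_eq] or
    a rewrite. *)
Ltac der :=
  match goal with
  | H : is_derive ?f ?s _ |- is_derive ?f ?s _ => exact H
  | |- is_derive (fun x => ?c) _ _ => exact (is_derive_Rconst c _)
  | |- is_derive (fun x => @?f x + @?h x) ?s _ =>
      apply (is_derive_Rplus f h); [der|der]
  | |- is_derive (fun x => @?f x - @?h x) ?s _ =>
      apply (is_derive_Rminus f h); [der|der]
  | |- is_derive (fun x => @?f x / @?h x) ?s _ =>
      apply (is_derive_Rdiv f h); [try assumption|der|der]
  | |- is_derive (fun x => @?f x * @?h x) ?s _ =>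
      apply (is_derive_Rmult f h); [der|der]
  | |- is_derive (fun x => / @?f x) ?s _ =>
      apply (is_derive_Rinv f); [try assumption|der]
  | |- is_derive (fun x => - @?f x) ?s _ => apply (is_derive_Ropp f); der
  | |- is_derive (fun x => (@?f x) ^ ?n) ?s _ => apply (is_derive_Rpow f n); der
  end.

Lemma is_derive_dot (f h : R -> vec) (s : R) (v w : vec) :
  is_vderive f s v -> is_vderive h s w ->
  is_derive (fun u => dot (f u) (h u)) s (dot v (h s) + dot (f s) w).
Proof.
intros (F1&F2&F3) (H1&H2&H3); unfold dot.
eapply is_derive_eq; [der|ring].
Qed.

Lemma is_vderive_cross (f h : R -> vec) (s : R) (v w : vec) :
  is_vderive f s v -> is_vderive h s w ->
  is_vderive (fun u => cross (f u) (h u)) s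
    (vadd (cross v (h s)) (cross (f s) w)).
Proof.
intros (F1&F2&F3) (H1&H2&H3).
split; [|split].
- apply (is_derive_eq (fun u => cy (f u) * cz (h u) - cz (f u) * cy (h u)) s
    (cy v * cz (h s) + cy (f s) * cz w - (cz v * cy (h s) + cz (f s) * cy w)));
    [der|unfold cross, vadd, cx, cy, cz; simpl; ring].
- apply (is_derive_eq (fun u => cz (f u) * cx (h u) - cx (f u) * cz (h u)) s
    (cz v * cx (h s) + cz (f s) * cx w - (cx v * cz (h s) + cx (f s) * cz w)));
    [der|unfold cross, vadd, cx, cy, cz; simpl; ring].
- apply (is_derive_eq (fun u => cx (f u) * cy (h u) - cy (f u) * cx (h u)) s
    (cx v * cy (h s) + cx (f s) * cy w - (cy v * cx (h s) + cy (f s) * cx w)));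
    [der|unfold cross, vadd, cx, cy, cz; simpl; ring].
Qed.

Lemma is_vderive_vadd (f h : R -> vec) (s : R) (v w : vec) :
  is_vderive f s v -> is_vderive h s w ->
  is_vderive (fun u => vadd (f u) (h u)) s (vadd v w).
Proof.
intros (F1&F2&F3) (H1&H2&H3).
exact (conj (is_derive_Rplus _ _ _ _ _ F1 H1)
  (conj (is_derive_Rplus _ _ _ _ _ F2 H2) (is_derive_Rplus _ _ _ _ _ F3 H3))).
Qed.

Lemma is_vderive_vsub (f h : R -> vec) (s : R) (v w : vec) :
  is_vderive f s v -> is_vderive h s w ->
  is_vderive (fun u => vsub (f u) (h u)) s (vsub v w).
Proof.
intros (F1&F2&F3) (H1&H2&H3).
exact (conj (is_derive_Rminus _ _ _ _ _ F1 H1)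
  (conj (is_derive_Rminus _ _ _ _ _ F2 H2) (is_derive_Rminus _ _ _ _ _ F3 H3))).
Qed.

Lemma is_vderive_vscal (a : R -> R) (f : R -> vec) (s a' : R) (v : vec) :
  is_derive a s a' -> is_vderive f s v ->
  is_vderive (fun u => vscal (a u) (f u)) s (vadd (vscal a' (f s)) (vscal (a s) v)).
Proof.
intros A (F1&F2&F3).
exact (conj (is_derive_Rmult _ _ _ _ _ A F1)
  (conj (is_derive_Rmult _ _ _ _ _ A F2) (is_derive_Rmult _ _ _ _ _ A F3))).
Qed.

(** * Frenet curves *)

Ltac vcomp := unfold det3, dot, cross, vadd, vsub, vscal, cx, cy, cz; simpl.

Lemma frame_expand (T N v : vec) :
  dot T T = 1 -> dot N N = 1 -> dot T N = 0 ->
  v = vadd (vadd (vscal (dot v T) T) (vscal (dot v N) N))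
           (vscal (dot v (cross T N)) (cross T N)).
Proof.
intros HT HN HTN; set (B := cross T N).
(* A polynomial identity valid for arbitrary [T] and [N]. Orthonormality enters only later, by
   rewriting [E], [E1] and [E2], so that [ring] never has to use hypotheses. *)
assert (H : vscal (dot B B) v = vadd (vadd (vscal (dot v T) (cross N B))
  (vscal (dot v N) (cross B T))) (vscal (dot v B) B)).
{ unfold B; destruct T as [[? ?] ?], N as [[? ?] ?], v as [[? ?] ?].
  apply vec_ext; vcomp; ring. }
assert (E : dot B B = dot T T * dot N N - dot T N ^ 2).
{ unfold B; destruct T as [[? ?] ?], N as [[? ?] ?]; vcomp; ring. }
assert (E1 : cross N B = vsub (vscal (dot N N) T) (vscal (dot T N) N)).
{ unfold B; destruct T as [[? ?] ?], N as [[? ?] ?]; apply vec_ext; vcomp; ring. }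
assert (E2 : cross B T = vsub (vscal (dot T T) N) (vscal (dot T N) T)).
{ unfold B; destruct T as [[? ?] ?], N as [[? ?] ?]; apply vec_ext; vcomp; ring. }
rewrite E, E1, E2, HT, HN, HTN in H; clearbody B.
transitivity (vscal (1 * 1 - 0 ^ 2) v).
- destruct v as [[? ?] ?]; apply vec_ext; vcomp; ring.
- rewrite H; destruct T as [[? ?] ?], N as [[? ?] ?], v as [[? ?] ?], B as [[? ?] ?].
  apply vec_ext; vcomp; ring.
Qed.

Ltac smt :=
  match goal with
  | H : smooth_at ?f ?s |- smooth_at ?f ?s => exact H
  | |- smooth_at (fun x => ?c) ?s => exact (smooth_at_const c s)
  | |- smooth_at (fun x => @?f x + @?h x) ?s => apply (smooth_at_plus f h); smt
  | |- smooth_at (fun x => @?f x - @?h x) ?s => apply (smooth_at_minus f h); smt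
  | |- smooth_at (fun x => @?f x / @?h x) ?s => apply (smooth_at_div f h); [auto|smt|smt]
  | |- smooth_at (fun x => @?f x * @?h x) ?s => apply (smooth_at_mult f h); smt
  | |- smooth_at (fun x => / @?f x) ?s => apply (smooth_at_inv f); [auto|smt]
  | |- smooth_at (fun x => - @?f x) ?s => apply (smooth_at_opp f); smt
  | |- smooth_at (fun x => (@?f x) ^ ?n) ?s => apply (smooth_at_pow f n); smt
  | |- smooth_at (fun x => Derive ?f x) ?s => apply (smooth_at_Derive f); smt
  | |- smooth_at (Derive ?f) ?s => apply (smooth_at_Derive f); smt
  | |- smooth_at (fun x => Derive_n ?f ?n x) ?s => apply (smooth_at_Derive_n f n); smt
  | |- _ => auto
  end.

Lemma locally_between (a b s : R) : a < s < b -> locally s (fun u => a < u < b).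
Proof.
intros H; apply (locally_open (fun u => a < u < b)); auto.
apply (open_and (fun u => a < u) (fun u => u < b)); [apply open_gt|apply open_lt].
Qed.

Lemma is_derive_constant_between (f : R -> R) (a b c d s : R) : a < s < b ->
  (forall u, a < u < b -> f u = c) -> is_derive f s d -> d = 0.
Proof.
intros Hs Hf Hd; apply is_derive_unique in Hd; rewrite <- Hd.
rewrite (Derive_ext_loc f (fun _ => c)); [apply Derive_const|].
generalize (locally_between a b s Hs); apply filter_imp; auto.
Qed.

Section Frenet.

Variables (mu L : R) (g : R -> vec).
Hypothesis hf : frenet_curve L g.

Local Notation k := (curvature g).
Local Notation l := (mtorsion g).

Lemma frenet_smooth (s : R) : 0 <= s <= L -> vsmooth_at g s.
Proof. intros Hs; now apply hf. Qed.

Lemma cross_derivatives_neq_0 (s : R) : 0 <= s <= L ->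
  vnorm (cross (vderive g s) (vderive (vderive g) s)) <> 0.
Proof.
intros Hs H; apply (proj2 (proj2 hf) s Hs); unfold curvature; rewrite H.
unfold Rdiv; ring.
Qed.

Lemma speed_smooth (s : R) : 0 <= s <= L -> smooth_at (speed g) s.
Proof.
intros Hs; apply smooth_at_vnorm; [now apply (proj1 (proj2 hf))|].
now apply vsmooth_at_vderive, frenet_smooth.
Qed.

Lemma curvature_smooth (s : R) : 0 <= s <= L -> smooth_at k s.
Proof.
intros Hs; pose proof (frenet_smooth s Hs) as H0.
pose proof (vsmooth_at_vderive _ _ H0) as H1.
pose proof (vsmooth_at_vderive _ _ H1) as H2.
apply smooth_at_div.
- apply pow_nonzero; now apply (proj1 (proj2 hf)).
- apply smooth_at_vnorm; [now apply cross_derivatives_neq_0|].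
  now apply vsmooth_at_cross.
- apply smooth_at_pow, (speed_smooth s Hs).
Qed.

Lemma mtorsion_smooth (s : R) : 0 <= s <= L -> smooth_at l s.
Proof.
intros Hs; pose proof (frenet_smooth s Hs) as H0.
pose proof (vsmooth_at_vderive _ _ H0) as H1.
pose proof (vsmooth_at_vderive _ _ H1) as H2.
pose proof (vsmooth_at_vderive _ _ H2) as H3.
apply smooth_at_div; [now apply (proj2 (proj2 hf))| |now apply curvature_smooth].
apply smooth_at_div.
- apply pow_nonzero; now apply cross_derivatives_neq_0.
- apply smooth_at_dot; auto; now apply vsmooth_at_cross.
- apply smooth_at_pow, smooth_at_vnorm; [now apply cross_derivatives_neq_0|].
  now apply vsmooth_at_cross.
Qed.

Lemma frameT_smooth (s : R) : 0 <= s <= L -> vsmooth_at (frameT g) s.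
Proof.
intros Hs; apply (vsmooth_at_vscal (fun u => / speed g u)).
- apply smooth_at_inv; [now apply (proj1 (proj2 hf))|now apply speed_smooth].
- now apply vsmooth_at_vderive, frenet_smooth.
Qed.

Lemma frameN_smooth (s : R) : 0 <= s <= L -> vsmooth_at (frameN g) s.
Proof.
intros Hs; apply (vsmooth_at_vscal (fun u => / (speed g u * k u))).
- apply smooth_at_inv.
  + apply Rmult_integral_contrapositive; split; now apply hf.
  + apply smooth_at_mult; [now apply speed_smooth|now apply curvature_smooth].
- now apply vsmooth_at_vderive, frameT_smooth.
Qed.

Lemma frameB_smooth (s : R) : 0 <= s <= L -> vsmooth_at (frameB g) s.
Proof.
intros Hs; apply vsmooth_at_cross; [now apply frameT_smooth|now apply frameN_smooth].
Qed.

Lemma in_frame_smooth (c1 c2 c3 : R -> R) (s : R) : 0 <= s <= L ->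
  smooth_at c1 s -> smooth_at c2 s -> smooth_at c3 s ->
  vsmooth_at (in_frame g c1 c2 c3) s.
Proof.
intros Hs H1 H2 H3.
pose proof (frameT_smooth s Hs); pose proof (frameN_smooth s Hs).
pose proof (frameB_smooth s Hs).
apply (vsmooth_at_vadd (fun u => vadd (vscal (c1 u) (frameT g u)) (vscal (c2 u) (frameN g u)))
  (fun u => vscal (c3 u) (frameB g u))); [apply vsmooth_at_vadd|]; now apply vsmooth_at_vscal.
Qed.

Lemma curvature_neq_0 (s : R) : 0 <= s <= L -> k s <> 0.
Proof. apply hf. Qed.

Lemma force_smooth (s : R) : 0 <= s <= L ->
  smooth_at (force1 mu g) s /\ smooth_at (force2 g) s /\ smooth_at (force3 g) s.
Proof.
intros Hs; pose proof (curvature_smooth s Hs) as Hk.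
pose proof (mtorsion_smooth s Hs) as Hl; pose proof (curvature_neq_0 s Hs) as Hk0.
split; [|split]; unfold force1, force2, force3; smt.
Qed.

Lemma torque_smooth (s : R) : 0 <= s <= L ->
  smooth_at (torque1 g) s /\ smooth_at (torque2 g) s /\ smooth_at (torque3 g) s.
Proof.
intros Hs; pose proof (curvature_smooth s Hs) as Hk.
pose proof (mtorsion_smooth s Hs) as Hl; pose proof (curvature_neq_0 s Hs) as Hk0.
split; [|split]; unfold torque1, torque2, torque3; smt.
Qed.

Lemma force_vector_smooth (s : R) : 0 <= s <= L -> vsmooth_at (force_vector mu g) s.
Proof.
intros Hs; destruct (force_smooth s Hs) as (?&?&?); now apply in_frame_smooth.
Qed.

Lemma torque_vector_smooth (s : R) : 0 <= s <= L -> vsmooth_at (torque_vector mu g) s.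
Proof.
intros Hs; destruct (torque_smooth s Hs) as (?&?&?).
apply vsmooth_at_vsub; [now apply in_frame_smooth|].
apply vsmooth_at_cross; [now apply frenet_smooth|now apply force_vector_smooth].
Qed.

Hypothesis harc : arclength L g.

Lemma frameT_arclength (s : R) : 0 <= s <= L -> frameT g s = vderive g s.
Proof.
intros Hs; unfold frameT; rewrite (harc s Hs), Rinv_1.
apply vec_ext; vcomp; ring.
Qed.

Lemma dot_TT (s : R) : 0 <= s <= L -> dot (frameT g s) (frameT g s) = 1.
Proof.
intros Hs; rewrite (frameT_arclength s Hs); pose proof (harc s Hs) as H.
unfold speed, vnorm in H.
rewrite <- (sqrt_sqrt (dot _ _)), H; [ring|apply dot_self_ge_0].
Qed.

Lemma in_closed (s : R) : 0 < s < L -> 0 <= s <= L.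
Proof. lra. Qed.

Lemma curvature_pos (s : R) : 0 < s < L -> 0 < k s.
Proof.
intros Hs; apply in_closed in Hs.
destruct (Rtotal_order 0 (k s)) as [|[H|H]]; auto.
- now destruct (curvature_neq_0 s Hs).
- exfalso; revert H; apply Rle_not_lt, Rmult_le_pos; [apply sqrt_pos|].
  apply Rlt_le, Rinv_0_lt_compat, pow_lt; fold (speed g s); rewrite (harc s Hs); lra.
Qed.

(** Restricted to interior points because the two-sided derivative at an end point also depends on
    the speed outside [[0, L]]. *)
Lemma frameT_vderive (s : R) : 0 < s < L ->
  vderive (frameT g) s = vderive (vderive g) s.
Proof.
intros Hs; apply is_vderive_unique.
apply is_vderive_ext_loc with (vderive g).
- generalize (locally_between 0 L s Hs); apply filter_imp; intros u Hu.
  now rewrite frameT_arclength by now apply in_closed.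
- now apply vsmooth_at_derive, vsmooth_at_vderive, frenet_smooth, in_closed.
Qed.

Lemma vsmooth_frames (s : R) : 0 < s < L ->
  is_vderive (frameT g) s (vderive (frameT g) s) /\
  is_vderive (frameN g) s (vderive (frameN g) s) /\
  is_vderive (frameB g) s (vderive (frameB g) s).
Proof.
intros Hs; apply in_closed in Hs; split; [|split]; apply vsmooth_at_derive.
- now apply frameT_smooth.
- now apply frameN_smooth.
- now apply frameB_smooth.
Qed.

Lemma dot_sym (u w : vec) : dot u w = dot w u.
Proof. unfold dot; ring. Qed.

Lemma dot_TT' (s : R) : 0 < s < L -> dot (frameT g s) (vderive (frameT g) s) = 0.
Proof.
intros Hs; destruct (vsmooth_frames s Hs) as [H _].
pose proof (is_derive_dot _ _ _ _ _ H H) as D.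
apply (is_derive_constant_between _ 0 L 1) in D; auto.
- rewrite (dot_sym _ (frameT g s)) in D; lra.
- intros u Hu; now apply dot_TT, in_closed.
Qed.

Lemma curvature_eq_norm (s : R) : 0 < s < L ->
  k s = vnorm (cross (frameT g s) (vderive (frameT g) s)).
Proof.
intros Hs; unfold curvature; rewrite frameT_vderive by auto.
rewrite frameT_arclength by now apply in_closed.
fold (speed g s); rewrite (harc s) by (now apply in_closed).
field.
Qed.

Lemma curvature_sqr (s : R) : 0 < s < L ->
  k s ^ 2 = dot (vderive (frameT g) s) (vderive (frameT g) s).
Proof.
intros Hs; rewrite (curvature_eq_norm s Hs); unfold vnorm.
rewrite pow2_sqrt by apply dot_self_ge_0.
pose proof (dot_TT' s Hs) as H0; pose proof (dot_TT s (in_closed s Hs)) as H1.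
set (u := frameT g s) in *; set (w := vderive (frameT g) s) in *; clearbody u w.
transitivity (dot u u * dot w w - dot u w ^ 2).
- destruct u as [[? ?] ?], w as [[? ?] ?]; vcomp; ring.
- rewrite H0, H1; ring.
Qed.

Lemma frameN_eq (s : R) : 0 < s < L ->
  frameN g s = vscal (/ k s) (vderive (frameT g) s).
Proof.
intros Hs; unfold frameN; rewrite (harc s) by now apply in_closed.
now rewrite Rmult_1_l.
Qed.

Lemma frenet_T (s : R) : 0 < s < L -> vderive (frameT g) s = vscal (k s) (frameN g s).
Proof.
intros Hs; rewrite (frameN_eq s Hs).
assert (k s <> 0) by now apply curvature_neq_0, in_closed.
apply vec_ext; vcomp; field; auto.
Qed.

Lemma dot_NN (s : R) : 0 < s < L -> dot (frameN g s) (frameN g s) = 1.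
Proof.
intros Hs; rewrite (frameN_eq s Hs); pose proof (curvature_sqr s Hs) as H.
assert (k s <> 0) by now apply curvature_neq_0, in_closed.
set (w := vderive (frameT g) s) in *.
transitivity (/ k s ^ 2 * dot w w); [|rewrite <- H; field; auto].
vcomp; field; auto.
Qed.

Lemma dot_TN (s : R) : 0 < s < L -> dot (frameT g s) (frameN g s) = 0.
Proof.
intros Hs; rewrite (frameN_eq s Hs); pose proof (dot_TT' s Hs) as H.
set (w := vderive (frameT g) s) in *.
transitivity (/ k s * dot (frameT g s) w); [|rewrite H; ring].
vcomp; ring.
Qed.

Lemma dot_N'N (s : R) : 0 < s < L -> dot (vderive (frameN g) s) (frameN g s) = 0.
Proof.
intros Hs; destruct (vsmooth_frames s Hs) as [_ [H _]].
pose proof (is_derive_dot _ _ _ _ _ H H) as D.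
apply (is_derive_constant_between _ 0 L 1) in D; auto.
- rewrite (dot_sym (frameN g s)) in D; lra.
- intros u Hu; now apply dot_NN.
Qed.

Lemma dot_N'T (s : R) : 0 < s < L -> dot (vderive (frameN g) s) (frameT g s) = - k s.
Proof.
intros Hs; destruct (vsmooth_frames s Hs) as [H1 [H2 _]].
pose proof (is_derive_dot _ _ _ _ _ H1 H2) as D.
apply (is_derive_constant_between _ 0 L 0) in D; auto using dot_TN.
rewrite (frenet_T s Hs), (dot_sym (frameT g s)) in D.
enough (dot (vscal (k s) (frameN g s)) (frameN g s) = k s) by lra.
transitivity (k s * dot (frameN g s) (frameN g s)); [vcomp; ring|].
rewrite dot_NN by auto; ring.
Qed.

(** Inserting [g'' = k N] and [g''' = k' N + k N'] in the determinant leaves [k^2 <N', B>], and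
    [|g' x g''|^2 = k^2]; so the torsion is [<N', B>]. *)
Lemma dot_N'B (s : R) : 0 < s < L ->
  dot (vderive (frameN g) s) (frameB g s) = l s * k s.
Proof.
intros Hs; destruct (vsmooth_frames s Hs) as [H1 [H2 _]].
assert (Hk0 : k s <> 0) by now apply curvature_neq_0, in_closed.
unfold mtorsion, torsion.
rewrite <- (frameT_vderive s Hs), <- (frameT_arclength s (in_closed s Hs)).
rewrite <- (curvature_eq_norm s Hs).
assert (E : vderive (vderive (vderive g)) s =
  vadd (vscal (Derive k s) (frameN g s)) (vscal (k s) (vderive (frameN g) s))).
{ apply is_vderive_unique, is_vderive_ext_loc with (fun u => vscal (k u) (frameN g u)).
  - generalize (locally_between 0 L s Hs); apply filter_imp; intros u Hu.
    now rewrite <- frameT_vderive, frenet_T.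
  - apply is_vderive_vscal; auto.
    now apply smooth_at_derive, curvature_smooth, in_closed. }
rewrite E, (frenet_T s Hs); unfold frameB.
generalize (frameT g s) (frameN g s) (vderive (frameN g) s); intros T N N'.
vcomp; field; auto.
Qed.

Lemma frenet_N (s : R) : 0 < s < L ->
  vderive (frameN g) s =
  vadd (vscal (- k s) (frameT g s)) (vscal (l s * k s) (frameB g s)).
Proof.
intros Hs; rewrite (frame_expand (frameT g s) (frameN g s) (vderive (frameN g) s));
  auto using dot_TT, dot_NN, dot_TN, in_closed.
fold (frameB g s); rewrite dot_N'T, dot_N'N, dot_N'B by auto.
apply vec_ext; vcomp; ring.
Qed.

Lemma frenet_B (s : R) : 0 < s < L ->
  vderive (frameB g) s = vscal (- (l s * k s)) (frameN g s).
Proof.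
intros Hs; destruct (vsmooth_frames s Hs) as [H1 [H2 _]].
rewrite (is_vderive_unique (frameB g) s _ (is_vderive_cross _ _ _ _ _ H1 H2)).
rewrite (frenet_T s Hs), (frenet_N s Hs); unfold frameB.
pose proof (dot_TT s (in_closed s Hs)) as H; pose proof (dot_TN s Hs) as H0.
set (T := frameT g s) in *; set (N := frameN g s) in *; clearbody T N.
transitivity (vscal (l s * k s) (vsub (vscal (dot T N) T) (vscal (dot T T) N))).
- destruct T as [[? ?] ?], N as [[? ?] ?]; apply vec_ext; vcomp; ring.
- rewrite H, H0; apply vec_ext; vcomp; ring.
Qed.

(** The pointwise counterpart of [in_frame], convertible with it at each point: dot and cross
    products become formulas in numerical coordinates. *)
Definition frame_vec (s x y z : R) : vec :=
  vadd (vadd (vscal x (frameT g s)) (vscal y (frameN g s))) (vscal z (frameB g s)).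

Lemma is_vderive_in_frame (c1 c2 c3 : R -> R) (s d1 d2 d3 : R) : 0 < s < L ->
  is_derive c1 s d1 -> is_derive c2 s d2 -> is_derive c3 s d3 ->
  is_vderive (in_frame g c1 c2 c3) s
    (frame_vec s (d1 - k s * c2 s) (k s * c1 s + d2 - l s * k s * c3 s)
       (l s * k s * c2 s + d3)).
Proof.
intros Hs D1 D2 D3; destruct (vsmooth_frames s Hs) as [H1 [H2 H3]].
pose proof (is_vderive_vadd _ _ _ _ _ (is_vderive_vadd _ _ _ _ _
  (is_vderive_vscal _ _ _ _ _ D1 H1) (is_vderive_vscal _ _ _ _ _ D2 H2))
  (is_vderive_vscal _ _ _ _ _ D3 H3)) as H.
rewrite (frenet_T s Hs), (frenet_N s Hs), (frenet_B s Hs) in H.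
match type of H with is_vderive _ _ ?v =>
  replace (frame_vec _ _ _ _) with v; [exact H|] end.
apply vec_ext; unfold frame_vec; vcomp; ring.
Qed.

Lemma dot_frame_vec (s x y z x' y' z' : R) : 0 < s < L ->
  dot (frame_vec s x y z) (frame_vec s x' y' z') = x * x' + y * y' + z * z'.
Proof.
intros Hs; pose proof (dot_TT s (in_closed s Hs)) as H; pose proof (dot_TN s Hs) as H0.
pose proof (dot_NN s Hs) as H1; unfold frame_vec, frameB.
set (T := frameT g s) in *; set (N := frameN g s) in *; clearbody T N.
transitivity (x * x' * dot T T + y * y' * dot N N + (x * y' + y * x') * dot T N
  + z * z' * (dot T T * dot N N - dot T N ^ 2)).
- destruct T as [[? ?] ?], N as [[? ?] ?]; vcomp; ring.
- rewrite H, H0, H1; ring.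
Qed.

Lemma cross_frame_vec (s x y z x' y' z' : R) : 0 < s < L ->
  cross (frame_vec s x y z) (frame_vec s x' y' z') =
  frame_vec s (y * z' - z * y') (z * x' - x * z') (x * y' - y * x').
Proof.
intros Hs; pose proof (dot_TT s (in_closed s Hs)) as H; pose proof (dot_TN s Hs) as H0.
pose proof (dot_NN s Hs) as H1; unfold frame_vec, frameB.
set (T := frameT g s) in *; set (N := frameN g s) in *; clearbody T N.
transitivity (vadd (vadd
  (vscal (y * z' - z * y') (vsub (vscal (dot N N) T) (vscal (dot T N) N)))
  (vscal (z * x' - x * z') (vsub (vscal (dot T T) N) (vscal (dot T N) T))))
  (vscal (x * y' - y * x') (cross T N))).
- destruct T as [[? ?] ?], N as [[? ?] ?]; apply vec_ext; vcomp; ring.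
- rewrite H, H0, H1; apply vec_ext; vcomp; ring.
Qed.

Lemma frame_vec_expand (s : R) (v : vec) : 0 < s < L ->
  v = frame_vec s (dot v (frameT g s)) (dot v (frameN g s)) (dot v (frameB g s)).
Proof.
intros Hs; apply frame_expand; auto using dot_TT, dot_NN, dot_TN, in_closed.
Qed.

Lemma is_vderive_curve (s : R) : 0 < s < L -> is_vderive g s (frameT g s).
Proof.
intros Hs; rewrite (frameT_arclength s (in_closed s Hs)).
now apply vsmooth_at_derive, frenet_smooth, in_closed.
Qed.

End Frenet.

(** * Derivatives of the force and torque vectors *)

Section Force.

Variables (mu L : R) (g : R -> vec).
Hypothesis hf : frenet_curve L g.
Hypothesis harc : arclength L g.

Local Notation k := (curvature g).
Local Notation l := (mtorsion g).

Lemma curvature_data (s : R) : 0 < s < L ->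
  k s <> 0 /\ is_derive k s (Derive k s) /\ is_derive l s (Derive l s) /\
  is_derive (Derive k) s (Derive (Derive k) s) /\
  is_derive (Derive l) s (Derive (Derive l) s).
Proof.
intros Hs; apply in_closed in Hs.
pose proof (curvature_smooth L g hf s Hs); pose proof (mtorsion_smooth L g hf s Hs).
repeat split; try apply smooth_at_derive; auto using smooth_at_Derive.
now apply (curvature_neq_0 L g hf).
Qed.

(** Expresses that [b0'] has no tangential component, the infinitesimal trace of the invariance of
    the functional under reparametrization. *)
Lemma is_derive_force1 (s : R) : 0 < s < L ->
  is_derive (force1 mu g) s (k s * force2 g s).
Proof.
intros Hs; destruct (curvature_data s Hs) as (Hk0&Hk&Hl&_).
eapply is_derive_eq; [unfold force1; der|unfold force2; simpl; field].
Qed.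

(** With [dforce3], the normal and binormal components of [b0'], obtained from the Frenet
    equations. *)
Definition dforce2 (s : R) : R :=
  k s * force1 mu g s + Derive (force2 g) s - l s * k s * force3 g s.

Definition dforce3 (s : R) : R := l s * k s * force2 g s + Derive (force3 g) s.

Lemma is_vderive_force (s : R) : 0 < s < L ->
  is_vderive (force_vector mu g) s (frame_vec g s 0 (dforce2 s) (dforce3 s)).
Proof.
intros Hs; destruct (force_smooth mu L g hf s (in_closed L s Hs)) as (_&H2&H3).
pose proof (is_vderive_in_frame L g hf harc _ _ _ s _ _ _ Hs
  (is_derive_force1 s Hs) (smooth_at_derive _ _ H2) (smooth_at_derive _ _ H3)) as H.
unfold dforce2, dforce3; now rewrite Rminus_diag in H.
Qed.

Lemma is_derive_torque1 (s : R) : 0 < s < L ->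
  is_derive (torque1 g) s (k s * torque2 g s).
Proof.
intros Hs; destruct (torque_smooth L g hf s (in_closed L s Hs)) as (H1&_&_).
destruct (curvature_data s Hs) as (Hk0&_).
eapply is_derive_eq; [apply (smooth_at_derive _ _ H1)|].
unfold torque1, torque2; field; auto.
Qed.

Lemma is_derive_torque3 (s : R) : 0 < s < L ->
  is_derive (torque3 g) s (force2 g s - l s * k s * torque2 g s).
Proof.
intros Hs; destruct (curvature_data s Hs) as (Hk0&Hk&Hl&_).
eapply is_derive_eq; [unfold torque3; der|].
unfold force2, torque2.
erewrite (is_derive_unique (fun u => 2 * k u * l u * (1 + l u ^ 2))) by der.
simpl; field; auto.
Qed.

(** Expanding the product gives [s2 = (k'/k) (1 + l^2) 2 l + ((1 + l^2) 2 l)'], whose derivative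
    consists of exactly the two derivative terms of [force3]. *)
Lemma Derive_torque2 (s : R) : 0 < s < L ->
  Derive (torque2 g) s =
  - force3 g s - k s ^ 2 * (1 + l s ^ 2) ^ 2 * l s.
Proof.
intros Hs.
pose proof (curvature_smooth L g hf s (in_closed L s Hs)) as Sk.
pose proof (mtorsion_smooth L g hf s (in_closed L s Hs)) as Sl.
pose proof (curvature_neq_0 L g hf s (in_closed L s Hs)) as Hk0.
rewrite (Derive_ext_loc _ (fun u => Derive k u / k u * (1 + l u ^ 2) * (2 * l u)
  + Derive (fun u => (1 + l u ^ 2) * (2 * l u)) u)).
- rewrite Derive_plus.
  + unfold force3.
    change (Derive_n (fun u => (1 + l u ^ 2) * (2 * l u)) 2 s) with
      (Derive (Derive (fun u => (1 + l u ^ 2) * (2 * l u))) s).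
    ring.
  + apply smooth_at_ex_derive; smt.
  + apply smooth_at_ex_derive; smt.
- generalize (locally_between 0 L s Hs); apply filter_imp; intros u Hu.
  destruct (curvature_data u Hu) as (Hku&Hk&Hl&_); unfold torque2.
  erewrite (is_derive_unique (fun u => 2 * k u * l u * (1 + l u ^ 2))) by der.
  erewrite (is_derive_unique (fun u => (1 + l u ^ 2) * (2 * l u))) by der.
  simpl; field; auto.
Qed.

Lemma is_vderive_torque (s : R) : 0 < s < L ->
  is_vderive (torque_vector mu g) s
    (vscal (-1) (cross (g s) (frame_vec g s 0 (dforce2 s) (dforce3 s)))).
Proof.
intros Hs; destruct (torque_smooth L g hf s (in_closed L s Hs)) as (_&H2&_).
pose proof (is_vderive_in_frame L g hf harc _ _ _ s _ _ _ Hs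
  (is_derive_torque1 s Hs) (smooth_at_derive _ _ H2) (is_derive_torque3 s Hs)) as H.
pose proof (is_vderive_vsub _ _ _ _ _ H (is_vderive_cross _ _ _ _ _
  (is_vderive_curve L g hf harc s Hs) (is_vderive_force s Hs))) as K.
match type of K with is_vderive _ _ ?v =>
  replace (vscal (-1) _) with v; [exact K|] end.
replace (frameT g s) with (frame_vec g s 1 0 0)
  by (apply vec_ext; unfold frame_vec; vcomp; ring).
change (force_vector mu g s) with
  (frame_vec g s (force1 mu g s) (force2 g s) (force3 g s)).
rewrite (cross_frame_vec L g hf harc) by auto.
rewrite (Derive_torque2 s Hs).
(* The normal component of [T x b0]. The terms without derivatives cancel: [2 k^2 l (1 + l^2) - k^2
   l (1 + l^2) (1 - l^2) = k^2 l (1 + l^2)^2]. *)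
replace (k s * torque1 g s +
    (- force3 g s - k s ^ 2 * (1 + l s ^ 2) ^ 2 * l s) -
    l s * k s * torque3 g s) with (- force3 g s)
  by (unfold torque1, torque3; ring).
generalize (cross (g s) (frame_vec g s 0 (dforce2 s) (dforce3 s))); intros w.
unfold frame_vec; generalize (frameT g s) (frameN g s) (frameB g s); intros T N B.
apply vec_ext; vcomp; ring.
Qed.

End Force.

(** * Smooth functions of two variables *)

Lemma locally_2d_imp (P Q : R -> R -> Prop) (t s : R) :
  (forall u v, P u v -> Q u v) -> locally_2d P t s -> locally_2d Q t s.
Proof. intros H; apply locally_2d_impl, locally_2d_forall, H. Qed.

Lemma locally_2d_locally_2d (P : R -> R -> Prop) (t s : R) :
  locally_2d P t s -> locally_2d (fun u v => locally_2d P u v) t s.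
Proof. apply locally_2d_impl_strong, locally_2d_forall; auto. Qed.

Definition dT (F : R -> R -> R) (t s : R) : R := Derive (fun z => F z s) t.
Definition dS (F : R -> R -> R) (t s : R) : R := Derive (fun z => F t z) s.

Lemma smooth_at_2d_locally (F : R -> R -> R) (t s : R) :
  smooth_at_2d F t s -> locally_2d (smooth_at_2d F) t s.
Proof. apply locally_2d_locally_2d. Qed.

Lemma smooth_at_2d_dT (F : R -> R -> R) (t s : R) :
  smooth_at_2d F t s -> smooth_at_2d (dT F) t s.
Proof. apply locally_2d_imp; intros u v H n; apply (H (S n)). Qed.

Lemma smooth_at_2d_dS (F : R -> R -> R) (t s : R) :
  smooth_at_2d F t s -> smooth_at_2d (dS F) t s.
Proof. apply locally_2d_imp; intros u v H n; apply (H (S n)). Qed.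

Lemma smooth_at_2d_continuity (F : R -> R -> R) (t s : R) :
  smooth_at_2d F t s -> continuity_2d_pt F t s.
Proof. intros H; apply locally_2d_singleton in H; apply (H 0%nat). Qed.

Lemma smooth_at_2d_is_derive_t (F : R -> R -> R) (t s : R) :
  smooth_at_2d F t s -> is_derive (fun z => F z s) t (dT F t s).
Proof.
intros H; apply locally_2d_singleton in H; apply Derive_correct, (H 1%nat).
Qed.

Lemma smooth_at_2d_is_derive_s (F : R -> R -> R) (t s : R) :
  smooth_at_2d F t s -> is_derive (fun z => F t z) s (dS F t s).
Proof.
intros H; apply locally_2d_singleton in H; apply Derive_correct, (H 1%nat).
Qed.

Lemma smooth_at_2d_Schwarz (F : R -> R -> R) (t s : R) :
  smooth_at_2d F t s -> dT (dS F) t s = dS (dT F) t s.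
Proof.
intros H; apply (Schwarz F).
- generalize (smooth_at_2d_locally F t s H); apply locally_2d_imp; intros u v K.
  repeat split; eexists.
  + now apply smooth_at_2d_is_derive_t.
  + now apply smooth_at_2d_is_derive_s.
  + now apply (smooth_at_2d_is_derive_t (dS F)), smooth_at_2d_dS.
  + now apply (smooth_at_2d_is_derive_s (dT F)), smooth_at_2d_dT.
- now apply (smooth_at_2d_continuity (dT (dS F))), smooth_at_2d_dT, smooth_at_2d_dS.
- now apply (smooth_at_2d_continuity (dS (dT F))), smooth_at_2d_dS, smooth_at_2d_dT.
Qed.

(** Just the regularity that differentiation under the integral sign asks for. Being weaker than
    joint smoothness, it is easily shown stable under quotients and square roots, which the
    curvature and the torsion require. *)
Definition C1t (F : R -> R -> R) (t s : R) : Prop :=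
  exists F' : R -> R -> R, locally_2d (fun u v => is_derive (fun z => F z v) u (F' u v) /\
    continuity_2d_pt F u v /\ continuity_2d_pt F' u v) t s.

Lemma smooth_at_2d_C1t (F : R -> R -> R) (t s : R) : smooth_at_2d F t s -> C1t F t s.
Proof.
intros H; exists (dT F).
generalize (smooth_at_2d_locally F t s H); apply locally_2d_imp; intros u v K.
split; [|split].
- now apply smooth_at_2d_is_derive_t.
- now apply smooth_at_2d_continuity.
- now apply smooth_at_2d_continuity, smooth_at_2d_dT.
Qed.

Lemma C1t_const (c t s : R) : C1t (fun _ _ => c) t s.
Proof.
exists (fun _ _ => 0); apply locally_2d_forall; intros u v.
split; [|split]; try apply continuity_2d_pt_const; apply is_derive_Rconst.
Qed.

Lemma C1t_plus (F H : R -> R -> R) (t s : R) :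
  C1t F t s -> C1t H t s -> C1t (fun u v => F u v + H u v) t s.
Proof.
intros [F' HF] [H' HH]; exists (fun u v => F' u v + H' u v).
generalize (locally_2d_and _ _ _ _ HF HH); apply locally_2d_imp.
intros u v [(?&?&?) (?&?&?)]; split; [|split]; try now apply continuity_2d_pt_plus.
der.
Qed.

Lemma C1t_mult (F H : R -> R -> R) (t s : R) :
  C1t F t s -> C1t H t s -> C1t (fun u v => F u v * H u v) t s.
Proof.
intros [F' HF] [H' HH]; exists (fun u v => F' u v * H u v + F u v * H' u v).
generalize (locally_2d_and _ _ _ _ HF HH); apply locally_2d_imp.
intros u v [(?&?&?) (?&?&?)]; split; [|split].
- der.
- now apply continuity_2d_pt_mult.
- now apply continuity_2d_pt_plus; apply continuity_2d_pt_mult.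
Qed.

Lemma C1t_minus (F H : R -> R -> R) (t s : R) :
  C1t F t s -> C1t H t s -> C1t (fun u v => F u v - H u v) t s.
Proof.
intros [F' HF] [H' HH]; exists (fun u v => F' u v - H' u v).
generalize (locally_2d_and _ _ _ _ HF HH); apply locally_2d_imp.
intros u v [(?&?&?) (?&?&?)]; split; [|split]; try now apply continuity_2d_pt_minus.
der.
Qed.

Lemma C1t_inv (F : R -> R -> R) (t s : R) :
  F t s <> 0 -> C1t F t s -> C1t (fun u v => / F u v) t s.
Proof.
intros H0 [F' HF]; exists (fun u v => (-1) * F' u v * (/ F u v * / F u v)).
pose proof (locally_2d_singleton _ _ _ HF) as (_&Hc&_).
generalize (locally_2d_and _ _ _ _ HF (continuity_2d_pt_neq_0 _ _ _ Hc H0)).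
apply locally_2d_imp; intros u v [(?&?&?) ?].
assert (continuity_2d_pt (fun u v => / F u v) u v) by now apply continuity_2d_pt_inv.
split; [|split; auto].
- eapply is_derive_eq; [der|field; auto].
- repeat apply continuity_2d_pt_mult; auto; apply continuity_2d_pt_const.
Qed.

Lemma continuity_2d_pt_pos (F : R -> R -> R) (t s : R) :
  continuity_2d_pt F t s -> 0 < F t s -> locally_2d (fun u v => 0 < F u v) t s.
Proof.
intros Hc H; generalize (Hc (mkposreal _ H)); apply locally_2d_imp; simpl.
intros u v K; apply Rabs_def2 in K; lra.
Qed.

Lemma C1t_sqrt (F : R -> R -> R) (t s : R) :
  0 < F t s -> C1t F t s -> C1t (fun u v => sqrt (F u v)) t s.
Proof.
intros H0 [F' HF]; exists (fun u v => F' u v * (/ 2 * / sqrt (F u v))).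
pose proof (locally_2d_singleton _ _ _ HF) as (_&Hc&_).
generalize (locally_2d_and _ _ _ _ HF (continuity_2d_pt_pos _ _ _ Hc H0)).
apply locally_2d_imp; intros u v [(?&?&?) ?].
assert (0 < sqrt (F u v)) by now apply sqrt_lt_R0.
assert (continuity_2d_pt (fun u v => sqrt (F u v)) u v).
{ apply continuity_1d_2d_pt_comp; auto; apply continuity_pt_sqrt; lra. }
split; [|split; auto].
- eapply is_derive_eq; [apply (is_derive_sqrt (fun z => F z v)); eauto|field; lra].
- apply continuity_2d_pt_mult; auto; apply continuity_2d_pt_mult.
  + apply continuity_2d_pt_const.
  + apply continuity_2d_pt_inv; auto; lra.
Qed.

Lemma C1t_div (F H : R -> R -> R) (t s : R) :
  H t s <> 0 -> C1t F t s -> C1t H t s -> C1t (fun u v => F u v / H u v) t s.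
Proof. intros; apply C1t_mult; auto; now apply C1t_inv. Qed.

Lemma C1t_pow (F : R -> R -> R) (n : nat) (t s : R) :
  C1t F t s -> C1t (fun u v => F u v ^ n) t s.
Proof.
intros H; induction n as [|n IH]; simpl; [apply C1t_const|now apply C1t_mult].
Qed.

Definition vC1t (G : R -> R -> vec) (t s : R) : Prop :=
  C1t (fun u v => cx (G u v)) t s /\ C1t (fun u v => cy (G u v)) t s /\
  C1t (fun u v => cz (G u v)) t s.

Lemma C1t_dot (G H : R -> R -> vec) (t s : R) :
  vC1t G t s -> vC1t H t s -> C1t (fun u v => dot (G u v) (H u v)) t s.
Proof.
intros (?&?&?) (?&?&?); unfold dot.
apply C1t_plus; [apply C1t_plus|]; now apply C1t_mult.
Qed.

Lemma vC1t_cross (G H : R -> R -> vec) (t s : R) :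
  vC1t G t s -> vC1t H t s -> vC1t (fun u v => cross (G u v) (H u v)) t s.
Proof.
intros (X1&Y1&Z1) (X2&Y2&Z2).
exact (conj (C1t_minus _ _ _ _ (C1t_mult _ _ _ _ Y1 Z2) (C1t_mult _ _ _ _ Z1 Y2))
  (conj (C1t_minus _ _ _ _ (C1t_mult _ _ _ _ Z1 X2) (C1t_mult _ _ _ _ X1 Z2))
    (C1t_minus _ _ _ _ (C1t_mult _ _ _ _ X1 Y2) (C1t_mult _ _ _ _ Y1 X2)))).
Qed.

Lemma C1t_vnorm (G : R -> R -> vec) (t s : R) :
  vnorm (G t s) <> 0 -> vC1t G t s -> C1t (fun u v => vnorm (G u v)) t s.
Proof.
intros H HG; apply C1t_sqrt; [now apply vnorm_neq_0|now apply C1t_dot].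
Qed.

Lemma continuity_2d_pt_continuous_s (F : R -> R -> R) (t s : R) :
  continuity_2d_pt F t s -> continuous (fun v => F t v) s.
Proof.
intros H; apply continuity_pt_filterlim, continuity_pt_locally; intros eps.
exact (locally_2d_1d_const_x _ _ _ (H eps)).
Qed.

Lemma is_derive_RInt_C1t (P : R -> R -> R) (L eps : R) : 0 < eps -> 0 < L ->
  (forall t s, - eps < t < eps -> 0 <= s <= L -> C1t P t s) ->
  is_derive (fun t => RInt (fun s => P t s) 0 L) 0 (RInt (fun s => dT P 0 s) 0 L).
Proof.
intros He HL HP.
assert (Hl : locally 0 (fun t => - eps < t < eps)) by (apply locally_between; lra).
apply (is_derive_RInt_param P).
- revert Hl; apply filter_imp; intros t Ht s.
  rewrite Rmin_left, Rmax_right by lra; intros Hs.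
  destruct (HP t s Ht Hs) as [P' H]; apply locally_2d_singleton in H.
  exists (P' t s); apply H.
- intros s; rewrite Rmin_left, Rmax_right by lra; intros Hs.
  destruct (HP 0 s ltac:(lra) Hs) as [P' H].
  apply (continuity_2d_pt_ext_loc P').
  + revert H; apply locally_2d_imp; intros u v (K&_&_).
    symmetry; now apply is_derive_unique.
  + apply locally_2d_singleton in H; apply H.
- revert Hl; apply filter_imp; intros t Ht.
  apply (ex_RInt_continuous (V := R_CompleteNormedModule)); intros s.
  rewrite Rmin_left, Rmax_right by lra; intros Hs.
  destruct (HP t s Ht Hs) as [P' H]; apply locally_2d_singleton in H.
  now apply continuity_2d_pt_continuous_s.
Qed.

Definition vsmooth_2d (G : R -> R -> vec) (t s : R) : Prop :=
  smooth_at_2d (fun u w => cx (G u w)) t s /\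
  smooth_at_2d (fun u w => cy (G u w)) t s /\
  smooth_at_2d (fun u w => cz (G u w)) t s.

Definition vdT (G : R -> R -> vec) (t s : R) : vec := vderive (fun z => G z s) t.
Definition vdS (G : R -> R -> vec) (t s : R) : vec := vderive (G t) s.

Lemma vsmooth_2d_vdS (G : R -> R -> vec) (t s : R) :
  vsmooth_2d G t s -> vsmooth_2d (vdS G) t s.
Proof.
intros (?&?&?); split; [|split];
  now apply (smooth_at_2d_dS (fun u w => _ (G u w))).
Qed.

Lemma vsmooth_2d_vC1t (G : R -> R -> vec) (t s : R) :
  vsmooth_2d G t s -> vC1t G t s.
Proof. intros (?&?&?); split; [|split]; now apply smooth_at_2d_C1t. Qed.

Lemma vsmooth_2d_is_vderive_t (G : R -> R -> vec) (t s : R) :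
  vsmooth_2d G t s -> is_vderive (fun z => G z s) t (vdT G t s).
Proof.
intros (?&?&?); split; [|split];
  now apply (smooth_at_2d_is_derive_t (fun u w => _ (G u w))).
Qed.

(** Makes the variations of [G'], [G''], [G'''] the successive derivatives of the variation field,
    as integration by parts requires. *)
Lemma vsmooth_2d_Schwarz (G : R -> R -> vec) (t s : R) :
  vsmooth_2d G t s -> is_vderive (fun z => vdT G t z) s (vdT (vdS G) t s).
Proof.
intros (Hx&Hy&Hz); split; [|split].
- pose proof (smooth_at_2d_Schwarz _ _ _ Hx) as E; unfold dT, dS in E.
  change (cx (vdT (vdS G) t s)) with
    (Derive (fun z => Derive (fun u => cx (G z u)) s) t); rewrite E.
  now apply (smooth_at_2d_is_derive_s (dT (fun u w => cx (G u w)))), smooth_at_2d_dT.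
- pose proof (smooth_at_2d_Schwarz _ _ _ Hy) as E; unfold dT, dS in E.
  change (cy (vdT (vdS G) t s)) with
    (Derive (fun z => Derive (fun u => cy (G z u)) s) t); rewrite E.
  now apply (smooth_at_2d_is_derive_s (dT (fun u w => cy (G u w)))), smooth_at_2d_dT.
- pose proof (smooth_at_2d_Schwarz _ _ _ Hz) as E; unfold dT, dS in E.
  change (cz (vdT (vdS G) t s)) with
    (Derive (fun z => Derive (fun u => cz (G z u)) s) t); rewrite E.
  now apply (smooth_at_2d_is_derive_s (dT (fun u w => cz (G u w)))), smooth_at_2d_dT.
Qed.

(** Carries identities proved on open intervals over to their end points. *)
Lemma continuous_eq_closure (f : R -> R) (c a b s : R) :
  a < b -> a <= s <= b -> continuous f s ->
  (forall u, a < u < b -> f u = c) -> f s = c.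
Proof.
intros Hab Hs Hc Hf.
destruct (Req_dec (f s) c) as [E|E]; auto; exfalso.
assert (Hl : locally s (fun u => f u <> c)) by (apply (Hc (fun y => y <> c)), open_neq, E).
destruct Hl as [d Hd]; pose proof (cond_pos d) as Hd0.
destruct (Rlt_le_dec s b) as [Hsb|Hsb].
- pose proof (Rmin_l (b - s) d); pose proof (Rmin_r (b - s) d).
  assert (0 < Rmin (b - s) d) by (apply Rmin_pos; lra).
  apply (Hd (s + Rmin (b - s) d / 2)); [|apply Hf; lra].
  apply Rabs_def1; unfold minus, plus, opp; simpl; lra.
- pose proof (Rmin_l (b - a) d); pose proof (Rmin_r (b - a) d).
  assert (0 < Rmin (b - a) d) by (apply Rmin_pos; lra).
  apply (Hd (s - Rmin (b - a) d / 2)); [|apply Hf; lra].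
  apply Rabs_def1; unfold minus, plus, opp; simpl; lra.
Qed.

(** * First variation *)

Definition sadowsky_density (mu : R) (h : R -> vec) (s : R) : R :=
  (curvature h s ^ 2 * (1 + mtorsion h s ^ 2) ^ 2 - mu) * speed h s.

Lemma sadowsky_density_C1t (mu L : R) (G : R -> R -> vec) (t s : R) :
  0 <= s <= L -> vsmooth_2d G t s -> frenet_curve L (G t) ->
  C1t (fun u v => sadowsky_density mu (G u) v) t s.
Proof.
intros Hs HG Hf.
pose proof (vsmooth_2d_vdS _ _ _ HG) as H1; pose proof (vsmooth_2d_vdS _ _ _ H1) as H2.
pose proof (vsmooth_2d_vdS _ _ _ H2) as H3.
apply vsmooth_2d_vC1t in H1, H2, H3.
pose proof (cross_derivatives_neq_0 L (G t) Hf s Hs) as Hc.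
pose proof (proj1 (proj2 Hf) s Hs) as Hv; pose proof (proj2 (proj2 Hf) s Hs) as Hk.
assert (Cv : C1t (fun u v => speed (G u) v) t s) by now apply (C1t_vnorm (vdS G)).
assert (Cc : C1t (fun u v => vnorm (cross (vdS G u v) (vdS (vdS G) u v))) t s).
{ apply (C1t_vnorm (fun u v => cross (vdS G u v) (vdS (vdS G) u v))); auto.
  now apply vC1t_cross. }
assert (Ck : C1t (fun u v => curvature (G u) v) t s).
{ apply C1t_div; auto; [now apply pow_nonzero|now apply C1t_pow]. }
assert (Ct : C1t (fun u v => torsion (G u) v) t s).
{ apply C1t_div; [now apply pow_nonzero| |now apply C1t_pow].
  apply (C1t_dot (fun u v => cross (vdS G u v) (vdS (vdS G) u v)) (vdS (vdS (vdS G)))); auto.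
  now apply vC1t_cross. }
assert (Cl : C1t (fun u v => mtorsion (G u) v) t s) by now apply C1t_div.
apply C1t_mult; auto; apply C1t_minus; [|apply C1t_const].
apply C1t_mult; apply C1t_pow; auto; apply C1t_plus; [apply C1t_const|now apply C1t_pow].
Qed.

(** Here [q], [c], [d] stand for [|G'|], [|G' x G''|] and [det (G', G'', G''')], through which the
    density is a rational function; the prescribed values at 0 are those of an arclength
    parametrized curve. *)
Lemma is_derive_density (q c d : R -> R) (mu k l q' c' d' : R) :
  k <> 0 -> q 0 = 1 -> c 0 = k -> d 0 = l * k ^ 3 ->
  is_derive q 0 q' -> is_derive c 0 c' -> is_derive d 0 d' ->
  is_derive (fun t => ((c t / q t ^ 3) ^ 2
      * (1 + (d t / c t ^ 2 / (c t / q t ^ 3)) ^ 2) ^ 2 - mu) * q t) 0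
    (2 * (3 * k ^ 2 * (1 + l ^ 2) * (l ^ 2 - 1)
       + / 2 * (k ^ 2 * (1 + l ^ 2) ^ 2 - mu)) * q'
     + 2 * k * (1 + l ^ 2) * (1 - 5 * l ^ 2) * c'
     + 4 * l * (1 + l ^ 2) / k * d').
Proof.
intros Hk Eq Ec Ed Hq Hc Hd.
assert (c 0 <> 0) by now rewrite Ec.
assert (q 0 <> 0) by (rewrite Eq; lra).
assert (q 0 ^ 3 <> 0) by now apply pow_nonzero.
assert (c 0 ^ 2 <> 0) by now apply pow_nonzero.
assert (c 0 / q 0 ^ 3 <> 0) by now apply Rmult_integral_contrapositive; auto using Rinv_neq_0_compat.
eapply is_derive_eq; [der|].
rewrite Eq, Ec, Ed; simpl; field; auto.
Qed.

Section FirstVariation.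

Variables (mu L : R) (g : R -> vec).
Hypothesis hf : frenet_curve L g.
Hypothesis harc : arclength L g.

Local Notation k := (curvature g).
Local Notation l := (mtorsion g).

(* The density is a function of [c1 = G'], [c2 = G''] and [c3 = G'''];
   [grad1], [grad2], [grad3] are its partial gradients along [g]. *)
Definition grad1 : R -> vec := in_frame g
  (fun s => 2 * (3 * k s ^ 2 * (1 + l s ^ 2) * (l s ^ 2 - 1)
      + / 2 * (k s ^ 2 * (1 + l s ^ 2) ^ 2 - mu))
    + 2 * k s ^ 2 * (1 + l s ^ 2) * (1 - 5 * l s ^ 2)
    + 4 * k s ^ 2 * l s ^ 2 * (1 + l s ^ 2))
  (fun _ => 0)
  (fun s => 4 * k s ^ 2 * l s * (1 + l s ^ 2)).

Definition grad2 : R -> vec := in_frame g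
  (fun _ => 0)
  (fun s => 2 * k s * (1 + l s ^ 2) * (1 - 5 * l s ^ 2)
    + 4 * k s * l s ^ 2 * (1 + l s ^ 2))
  (fun s => - (4 * l s * (1 + l s ^ 2) * (Derive k s / k s))).

Definition grad3 : R -> vec := in_frame g
  (fun _ => 0) (fun _ => 0) (fun s => 4 * l s * (1 + l s ^ 2)).

Lemma grad_smooth (s : R) : 0 <= s <= L ->
  vsmooth_at grad1 s /\ vsmooth_at grad2 s /\ vsmooth_at grad3 s.
Proof.
intros Hs; pose proof (curvature_smooth L g hf s Hs) as Hk.
pose proof (mtorsion_smooth L g hf s Hs) as Hl.
pose proof (curvature_neq_0 L g hf s Hs) as Hk0.
split; [|split]; apply (in_frame_smooth L); auto; smt.
Qed.

Lemma frenet_derivatives (s : R) : 0 < s < L ->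
  vderive g s = frameT g s /\
  vderive (vderive g) s = vscal (k s) (frameN g s) /\
  vderive (vderive (vderive g)) s =
    frame_vec g s (- k s ^ 2) (Derive k s) (l s * k s ^ 2).
Proof.
intros Hs; rewrite (frameT_arclength L g harc) by (apply in_closed; auto).
rewrite <- (frameT_vderive L g hf harc s Hs), (frenet_T L g hf harc s Hs).
split; [|split]; auto.
destruct (curvature_data L g hf s Hs) as (_&Hk&_).
pose proof (is_vderive_in_frame L g hf harc (fun _ => 0) k (fun _ => 0) s 0 _ 0 Hs
  (is_derive_Rconst 0 s) Hk (is_derive_Rconst 0 s)) as H.
transitivity (frame_vec g s (0 - k s * k s) (k s * 0 + Derive k s - l s * k s * 0)
  (l s * k s * k s + 0)); [|f_equal; ring].
apply is_vderive_unique; revert H; apply is_vderive_ext_loc.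
generalize (locally_between 0 L s Hs); apply filter_imp; intros u Hu.
rewrite <- (frameT_vderive L g hf harc u Hu), (frenet_T L g hf harc u Hu).
apply vec_ext; unfold in_frame; vcomp; ring.
Qed.

Lemma vderive_ext_loc (f h : R -> vec) (s : R) :
  locally s (fun u => f u = h u) -> vderive f s = vderive h s.
Proof.
intros [d Hd]; apply vec_ext; apply Derive_ext_loc; exists d; intros y Hy;
  now rewrite (Hd y Hy).
Qed.

Lemma is_derive_sadowsky_density (G : R -> R -> vec) (s : R) :
  0 < s < L -> vsmooth_2d G 0 s -> (forall u, 0 < u < L -> G 0 u = g u) ->
  is_derive (fun t => sadowsky_density mu (G t) s) 0
    (dot (grad1 s) (vdT (vdS G) 0 s) + dot (grad2 s) (vdT (vdS (vdS G)) 0 s)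
     + dot (grad3 s) (vdT (vdS (vdS (vdS G))) 0 s)).
Proof.
intros Hs HG E0.
assert (E1 : forall u, 0 < u < L -> vdS G 0 u = vderive g u).
{ intros u Hu; apply vderive_ext_loc.
  generalize (locally_between 0 L u Hu); apply filter_imp; auto. }
assert (E2 : forall u, 0 < u < L -> vdS (vdS G) 0 u = vderive (vderive g) u).
{ intros u Hu; apply vderive_ext_loc.
  generalize (locally_between 0 L u Hu); apply filter_imp; auto. }
assert (E3 : vdS (vdS (vdS G)) 0 s = vderive (vderive (vderive g)) s).
{ apply vderive_ext_loc.
  generalize (locally_between 0 L s Hs); apply filter_imp; auto. }
specialize (E1 s Hs); specialize (E2 s Hs).
destruct (frenet_derivatives s Hs) as (F1&F2&F3).
rewrite F1 in E1; rewrite F2 in E2; rewrite F3 in E3; clear F1 F2 F3 E0.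
pose proof (vsmooth_2d_vdS _ _ _ HG) as H1; pose proof (vsmooth_2d_vdS _ _ _ H1) as H2.
pose proof (vsmooth_2d_vdS _ _ _ H2) as H3.
apply vsmooth_2d_is_vderive_t in H1, H2, H3.
set (V1 := vdT (vdS G) 0 s) in *; set (V2 := vdT (vdS (vdS G)) 0 s) in *.
set (V3 := vdT (vdS (vdS (vdS G))) 0 s) in *; clearbody V1 V2 V3.
pose proof (curvature_pos L g hf harc s Hs) as Hk.
pose proof (dot_TT L g harc s (in_closed L s Hs)) as TT.
pose proof (dot_NN L g hf harc s Hs) as NN.
pose proof (dot_TN L g hf harc s Hs) as TN.
pose proof (is_vderive_cross _ _ _ _ _ H1 H2) as Hc.
pose proof (is_derive_dot _ _ _ _ _ H1 H1) as HQ.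
pose proof (is_derive_dot _ _ _ _ _ Hc Hc) as HC.
pose proof (is_derive_dot _ _ _ _ _ Hc H3) as HD.
cbv beta in HQ, HC, HD; rewrite E1, E2 in HC; rewrite E1 in HQ; rewrite E1, E2, E3 in HD.
assert (TB : cross (frameT g s) (frameN g s) = frameB g s) by reflexivity.
assert (NB : cross (frameN g s) (frameB g s) = frameT g s).
{ unfold frameB; transitivity (vsub (vscal (dot (frameN g s) (frameN g s)) (frameT g s))
    (vscal (dot (frameT g s) (frameN g s)) (frameN g s))).
  - generalize (frameT g s) (frameN g s); intros; apply vec_ext; vcomp; ring.
  - rewrite NN, TN; generalize (frameT g s) (frameN g s); intros; apply vec_ext; vcomp; ring. }
assert (BT : cross (frameB g s) (frameT g s) = frameN g s).
{ unfold frameB; transitivity (vsub (vscal (dot (frameT g s) (frameT g s)) (frameN g s))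
    (vscal (dot (frameT g s) (frameN g s)) (frameT g s))).
  - generalize (frameT g s) (frameN g s); intros; apply vec_ext; vcomp; ring.
  - rewrite TT, TN; generalize (frameT g s) (frameN g s); intros; apply vec_ext; vcomp; ring. }
assert (BB : dot (frameB g s) (frameB g s) = 1).
{ transitivity (dot (frameT g s) (cross (frameN g s) (frameB g s))); [|now rewrite NB].
  unfold frameB; generalize (frameT g s) (frameN g s); intros; vcomp; ring. }
unfold grad1, grad2, grad3, in_frame; unfold frame_vec in *.
set (T := frameT g s) in *; set (N := frameN g s) in *; set (B := frameB g s) in *.
assert (EC : cross T (vscal (k s) N) = vscal (k s) B).
{ rewrite <- TB; apply vec_ext; vcomp; ring. }
rewrite EC in HC, HD.
assert (Q0 : dot (vdS G 0 s) (vdS G 0 s) = 1) by now rewrite E1.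
assert (C0 : dot (cross (vdS G 0 s) (vdS (vdS G) 0 s)) (cross (vdS G 0 s) (vdS (vdS G) 0 s))
  = k s ^ 2).
{ rewrite E1, E2, EC; transitivity (k s ^ 2 * dot B B); [|rewrite BB; ring].
  clearbody B; vcomp; ring. }
assert (D0 : dot (cross (vdS G 0 s) (vdS (vdS G) 0 s)) (vdS (vdS (vdS G)) 0 s)
  = l s * k s ^ 3).
{ rewrite E1, E2, E3, EC; transitivity (l s * k s ^ 3 * dot B B
   + k s * Derive k s * dot B N - k s ^ 3 * dot B T).
  - clearbody B N T; vcomp; ring.
  - replace (dot B N) with 0 by (rewrite <- TB; clearbody T N; vcomp; ring).
    replace (dot B T) with 0 by (rewrite <- TB; clearbody T N; vcomp; ring).
    rewrite BB; ring. }
clearbody T N B.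
(* The norms are differentiated through their squares, which at time 0 are 1 and [k^2], both
   positive. *)
apply (is_derive_sqrt _ _ _) in HQ; [|rewrite Q0; lra].
apply (is_derive_sqrt _ _ _) in HC; [|rewrite C0; nra].
cbv beta in HQ, HC; rewrite Q0, sqrt_1 in HQ.
rewrite C0 in HC; rewrite sqrt_pow2 in HC by lra.
pose proof (fun a b c => is_derive_density (fun t => sqrt (dot (vdS G t s) (vdS G t s)))
  (fun t => sqrt (dot (cross (vdS G t s) (vdS (vdS G) t s)) (cross (vdS G t s) (vdS (vdS G) t s))))
  (fun t => dot (cross (vdS G t s) (vdS (vdS G) t s)) (vdS (vdS (vdS G)) t s))
  mu (k s) (l s) _ _ _ (Rgt_not_eq _ _ Hk) a b c HQ HC HD) as K.
cbv beta in K; rewrite Q0, C0, D0, sqrt_1, sqrt_pow2 in K by lra.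
specialize (K eq_refl eq_refl eq_refl).
eapply is_derive_eq; [exact K|clear K HQ HC HD Q0 C0 D0 H1 H2 H3 E1 E2 E3].
(* The goal is now linear in [V1], [V2], [V3]. Cyclicity of the triple product turns the products
   containing [V1] or [V2] into inner products with frame vectors. *)
replace (dot V1 T + dot T V1) with (2 * dot V1 T) by (vcomp; ring).
replace (dot (vadd (cross V1 (vscal (k s) N)) (cross T V2)) (vscal (k s) B)
   + dot (vscal (k s) B) (vadd (cross V1 (vscal (k s) N)) (cross T V2)))
  with (2 * k s * (k s * dot V1 (cross N B) + dot V2 (cross B T))) by (vcomp; ring).
match goal with |- context [dot (vadd (cross V1 ?a) ?b) ?w] =>
  replace (dot (vadd (cross V1 a) b) w) with
   (k s * (k s ^ 2 * dot V1 (cross T N) + l s * k s ^ 2 * dot V1 (cross N B))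
    + (l s * k s ^ 2 * dot V2 (cross B T) - Derive k s * dot V2 (cross T N)))
   by (vcomp; ring) end.
rewrite NB, BT, TB; vcomp; field; lra.
Qed.

(** The Ostrogradsky momenta of a density in [G'], [G''], [G''']: [momentum0], [momentum1] and
    [grad3] are the coefficients of the variation field and of its first two derivatives in the
    boundary term. *)
Definition momentum1 (s : R) : vec := vsub (grad2 s) (vderive grad3 s).
Definition momentum0 (s : R) : vec := vsub (grad1 s) (vderive momentum1 s).

Lemma momentum_smooth (s : R) : 0 <= s <= L ->
  vsmooth_at momentum0 s /\ vsmooth_at momentum1 s.
Proof.
intros Hs; destruct (grad_smooth s Hs) as (H1&H2&H3).
assert (H : vsmooth_at momentum1 s) by (apply vsmooth_at_vsub; auto using vsmooth_at_vderive).
split; auto; apply vsmooth_at_vsub; auto using vsmooth_at_vderive.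
Qed.

(** The components are [2 s3] along [N] and [- 2 s2] along [B]: the torque coefficients already
    appear here. *)
Lemma momentum1_eq (s : R) : 0 < s < L ->
  momentum1 s = in_frame g (fun _ => 0)
    (fun s => 2 * k s * (1 + l s ^ 2) * (1 - l s ^ 2))
    (fun s => - 2 * (Derive k s / k s * (1 + l s ^ 2) * (2 * l s))
      - 2 * Derive (fun u => (1 + l u ^ 2) * (2 * l u)) s) s.
Proof.
intros Hs; destruct (curvature_data L g hf s Hs) as (Hk0&Hk&Hl&_).
assert (D : is_derive (fun u => 4 * l u * (1 + l u ^ 2)) s
  (2 * Derive (fun u => (1 + l u ^ 2) * (2 * l u)) s)).
{ erewrite (is_derive_unique (fun u => (1 + l u ^ 2) * (2 * l u))) by der.
  eapply is_derive_eq; [der|simpl; ring]. }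
unfold momentum1; rewrite (is_vderive_unique grad3 s _
  (is_vderive_in_frame L g hf harc _ _ _ s _ _ _ Hs
    (is_derive_Rconst 0 s) (is_derive_Rconst 0 s) D)).
unfold grad2, in_frame, frame_vec.
generalize (frameT g s) (frameN g s) (frameB g s); intros T N B.
generalize (Derive (fun u => (1 + l u ^ 2) * (2 * l u)) s); intros m.
apply vec_ext; vcomp; field; auto.
Qed.

(** Up to the factor [- 2], the force vector is the momentum conjugate to translations, so the
    Euler-Lagrange expression [- momentum0'] is [2 b0']. *)
Lemma momentum0_eq (s : R) : 0 < s < L ->
  momentum0 s = vscal (- 2) (force_vector mu g s).
Proof.
intros Hs; destruct (curvature_data L g hf s Hs) as (Hk0&Hk&Hl&_).
pose proof (curvature_smooth L g hf s (in_closed L s Hs)) as Sk.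
pose proof (mtorsion_smooth L g hf s (in_closed L s Hs)) as Sl.
assert (D2 : is_derive (fun s => 2 * k s * (1 + l s ^ 2) * (1 - l s ^ 2)) s
  (2 * Derive k s * (1 - l s ^ 4) - 8 * k s * l s ^ 3 * Derive l s)).
{ eapply is_derive_eq; [der|simpl; ring]. }
assert (D3 : is_derive (fun s => - 2 * (Derive k s / k s * (1 + l s ^ 2) * (2 * l s))
    - 2 * Derive (fun u => (1 + l u ^ 2) * (2 * l u)) s) s
  (2 * force3 g s + 2 * k s ^ 2 * (1 + l s ^ 2) ^ 2 * l s)).
{ assert (Da : is_derive (fun s => Derive k s / k s * (1 + l s ^ 2) * (2 * l s)) s
    (Derive (fun s => Derive k s / k s * (1 + l s ^ 2) * (2 * l s)) s))
    by (apply smooth_at_derive; smt).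
  assert (Db : is_derive (Derive (fun u => (1 + l u ^ 2) * (2 * l u))) s
    (Derive (Derive (fun u => (1 + l u ^ 2) * (2 * l u))) s))
    by (apply smooth_at_derive; smt).
  eapply is_derive_eq.
  - apply is_derive_Rminus; apply is_derive_Rmult;
      [apply is_derive_Rconst|exact Da|apply is_derive_Rconst|exact Db].
  - unfold force3.
    change (Derive_n (fun u => (1 + l u ^ 2) * (2 * l u)) 2 s) with
      (Derive (Derive (fun u => (1 + l u ^ 2) * (2 * l u))) s).
    ring. }
pose proof (is_vderive_in_frame L g hf harc _ _ _ s _ _ _ Hs
    (is_derive_Rconst 0 s) D2 D3) as H.
apply (is_vderive_ext_loc _ momentum1) in H.
- unfold momentum0; rewrite (is_vderive_unique _ _ _ H).
  unfold grad1, force_vector, in_frame, frame_vec, force1, force2; cbv beta.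
  replace (Derive (fun u => (1 + l u ^ 2) * (2 * l u)) s) with
    ((2 + 6 * l s ^ 2) * Derive l s)
    by (symmetry; apply is_derive_unique; eapply is_derive_eq; [der|simpl; ring]).
  generalize (frameT g s) (frameN g s) (frameB g s); intros T N B.
  apply vec_ext; vcomp; field; auto.
- generalize (locally_between 0 L s Hs); apply filter_imp; intros u Hu.
  now rewrite momentum1_eq.
Qed.

End FirstVariation.

(** * Vanishing of the variation field near the end points *)

Lemma is_derive_continuous (f : R -> R) (s d : R) : is_derive f s d -> continuous f s.
Proof. intros H; apply (ex_derive_continuous f); now exists d. Qed.

Lemma continuous_dot (f h : R -> vec) (s : R) (v w : vec) :
  is_vderive f s v -> is_vderive h s w -> continuous (fun u => dot (f u) (h u)) s.
Proof.
intros Hf Hh; exact (is_derive_continuous _ _ _ (is_derive_dot _ _ _ _ _ Hf Hh)).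
Qed.

Definition null_vec : vec := (0, 0, 0).

Lemma vderive_const (c : vec) (s : R) : vderive (fun _ => c) s = null_vec.
Proof. unfold vderive; now rewrite !Derive_const. Qed.

Lemma dot_null_r (u : vec) : dot u null_vec = 0.
Proof. unfold null_vec; vcomp; ring. Qed.

Lemma is_vderive_eq_closure (f : R -> vec) (c v : vec) (a b s : R) :
  a < b -> a <= s <= b -> is_vderive f s v ->
  (forall u, a < u < b -> f u = c) -> f s = c.
Proof.
intros Hab Hs (H1&H2&H3) Hf; apply vec_ext;
  [apply (continuous_eq_closure (fun u => cx (f u)) _ a b)
  |apply (continuous_eq_closure (fun u => cy (f u)) _ a b)
  |apply (continuous_eq_closure (fun u => cz (f u)) _ a b)]; auto;
  try (intros u Hu; now rewrite Hf);
  (eapply is_derive_continuous; eassumption).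
Qed.

Lemma is_vderive_constant_null (f h : R -> vec) (c : vec) (a b s : R) :
  (forall u, a < u < b -> f u = c) -> (forall u, a <= u <= b -> is_vderive f u (h u)) ->
  (exists v, is_vderive h s v) -> a < b -> a <= s <= b -> h s = null_vec.
Proof.
intros Hf Hd [v Hv] Hab Hs.
apply (is_vderive_eq_closure h null_vec v a b s); auto.
intros u Hu; pose proof (Hd u ltac:(lra)) as H.
apply (is_vderive_ext_loc _ (fun _ => c)) in H.
- rewrite <- (is_vderive_unique _ _ _ H); apply vderive_const.
- generalize (locally_between a b u Hu); apply filter_imp; auto.
Qed.

(** Removes the boundary terms. Inside the interval [G] does not depend on [t]; the closed interval
    is reached by continuity, and each further derivative is that of a field already known to
    vanish. *)
Lemma proper_variation_null (L eps a b : R) (g : R -> vec) (G : R -> R -> vec) :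
  0 < eps -> smooth_family L eps G -> 0 <= a -> a < b -> b <= L ->
  (forall t s, - eps < t < eps -> a < s < b -> G t s = g s) ->
  forall s, a <= s <= b -> vdT G 0 s = null_vec /\ vdT (vdS G) 0 s = null_vec /\
    vdT (vdS (vdS G)) 0 s = null_vec.
Proof.
intros He HG Ha Hab Hb Hc.
assert (S0 : forall s, a <= s <= b -> vsmooth_2d G 0 s) by (intros; apply HG; lra).
assert (S1 : forall s, a <= s <= b -> vsmooth_2d (vdS G) 0 s)
  by (intros; now apply vsmooth_2d_vdS, S0).
assert (S2 : forall s, a <= s <= b -> vsmooth_2d (vdS (vdS G)) 0 s)
  by (intros; now apply vsmooth_2d_vdS, S1).
assert (N0 : forall s, a <= s <= b -> vdT G 0 s = null_vec).
{ intros s Hs; apply (is_vderive_eq_closure (fun u => vdT G 0 u) null_vec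
    (vdT (vdS G) 0 s) a b s); auto.
  - now apply vsmooth_2d_Schwarz, S0.
  - intros u Hu; transitivity (vderive (fun _ : R => g u) 0).
    + apply vderive_ext_loc; generalize (locally_between (- eps) eps 0 ltac:(lra)).
      apply filter_imp; intros t Ht; auto.
    + apply vderive_const. }
assert (N1 : forall s, a <= s <= b -> vdT (vdS G) 0 s = null_vec).
{ intros s Hs; apply (is_vderive_constant_null (fun u => vdT G 0 u)
    (fun u => vdT (vdS G) 0 u) null_vec a b); auto.
  - intros u Hu; apply N0; lra.
  - intros u Hu; now apply vsmooth_2d_Schwarz, S0.
  - eexists; now apply vsmooth_2d_Schwarz, S1. }
intros s Hs; split; [|split]; auto.
apply (is_vderive_constant_null (fun u => vdT (vdS G) 0 u)
  (fun u => vdT (vdS (vdS G)) 0 u) null_vec a b); auto.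
- intros u Hu; apply N1; lra.
- intros u Hu; now apply vsmooth_2d_Schwarz, S1.
- eexists; now apply vsmooth_2d_Schwarz, S2.
Qed.

(** * The first variation formula *)

Section FirstVariation.

Variables (mu L : R) (g : R -> vec).
Hypothesis hL : 0 < L.
Hypothesis hf : frenet_curve L g.
Hypothesis harc : arclength L g.

Lemma first_variation (eps : R) (G : R -> R -> vec) :
  proper_variation L g eps G ->
  is_derive (fun t => sadowsky mu L (G t)) 0
    (2 * RInt (fun s => dot (vderive (force_vector mu g) s) (vdT G 0 s)) 0 L).
Proof.
intros (He&HG&HGf&HG0&[eta [Heta HGc]]).
set (V0 := fun s => vdT G 0 s); set (V1 := fun s => vdT (vdS G) 0 s).
set (V2 := fun s => vdT (vdS (vdS G)) 0 s).
set (V3 := fun s => vdT (vdS (vdS (vdS G))) 0 s).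
assert (S0 : forall s, 0 <= s <= L -> vsmooth_2d G 0 s) by (intros; apply HG; lra).
assert (D0 : forall s, 0 <= s <= L -> is_vderive V0 s (V1 s)).
{ intros; now apply vsmooth_2d_Schwarz, S0. }
assert (D1 : forall s, 0 <= s <= L -> is_vderive V1 s (V2 s)).
{ intros; now apply vsmooth_2d_Schwarz, vsmooth_2d_vdS, S0. }
assert (D2 : forall s, 0 <= s <= L -> is_vderive V2 s (V3 s)).
{ intros; now apply vsmooth_2d_Schwarz, vsmooth_2d_vdS, vsmooth_2d_vdS, S0. }
assert (D3 : forall s, 0 <= s <= L -> is_vderive V3 s (vdT (vdS (vdS (vdS (vdS G)))) 0 s)).
{ intros; now apply vsmooth_2d_Schwarz, vsmooth_2d_vdS, vsmooth_2d_vdS, vsmooth_2d_vdS, S0. }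
assert (Z0 : V0 0 = null_vec /\ V1 0 = null_vec /\ V2 0 = null_vec).
(* The minimum is taken because [eta] may exceed [L]. *)
{ pose proof (Rmin_l L eta); pose proof (Rmin_r L eta).
  assert (0 < Rmin L eta) by now apply Rmin_pos.
  apply (proper_variation_null L eps 0 (Rmin L eta) g G); auto; try lra.
  intros t s Ht Hs; apply HGc; auto; lra. }
assert (ZL : V0 L = null_vec /\ V1 L = null_vec /\ V2 L = null_vec).
{ pose proof (Rmin_l L eta); pose proof (Rmin_r L eta).
  assert (0 < Rmin L eta) by now apply Rmin_pos.
  apply (proper_variation_null L eps (L - Rmin L eta) L g G); auto; try lra.
  intros t s Ht Hs; apply HGc; auto; lra. }
set (X0 := momentum0 mu g); set (X1 := momentum1 g); set (X2 := grad3 g).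
assert (E0 : forall s, 0 <= s <= L -> is_vderive X0 s (vderive X0 s) /\
   is_vderive (vderive X0) s (vderive (vderive X0) s)).
{ intros s Hs; destruct (momentum_smooth mu L g hf s Hs) as (H&_).
  split; apply vsmooth_at_derive; auto; now apply vsmooth_at_vderive. }
assert (E1 : forall s, 0 <= s <= L -> is_vderive X1 s (vderive X1 s) /\
   is_vderive (vderive X1) s (vderive (vderive X1) s)).
{ intros s Hs; destruct (momentum_smooth mu L g hf s Hs) as (_&H).
  split; apply vsmooth_at_derive; auto; now apply vsmooth_at_vderive. }
assert (E2 : forall s, 0 <= s <= L -> is_vderive X2 s (vderive X2 s) /\
   is_vderive (vderive X2) s (vderive (vderive X2) s)).
{ intros s Hs; destruct (grad_smooth mu L g hf s Hs) as (_&_&H).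
  split; apply vsmooth_at_derive; auto; now apply vsmooth_at_vderive. }
assert (Hforce : forall s, 0 <= s <= L ->
   continuous (fun u => dot (vderive (force_vector mu g) u) (V0 u)) s).
{ intros s Hs; eapply continuous_dot; [|now apply D0].
  now apply vsmooth_at_derive, vsmooth_at_vderive, (force_vector_smooth mu L g hf). }
(* One primitive performs all integrations by parts at once. Since [X0 + X1' = grad1] and
   [X1 + X2' = grad2], the derivative of the density is [W' - <X0', V0>], and [X0' = - 2 b0']. *)
set (W := fun s => dot (X0 s) (V0 s) + dot (X1 s) (V1 s) + dot (X2 s) (V2 s)).
set (W' := fun s => dot (vderive X0 s) (V0 s) + dot (X0 s) (V1 s)
  + (dot (vderive X1 s) (V1 s) + dot (X1 s) (V2 s))
  + (dot (vderive X2 s) (V2 s) + dot (X2 s) (V3 s))).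
assert (HW : is_RInt W' 0 L (W L - W 0)).
{ apply (is_RInt_derive W W'); intros s; rewrite Rmin_left, Rmax_right by lra; intros Hs.
  - exact (is_derive_Rplus _ _ _ _ _ (is_derive_Rplus _ _ _ _ _
      (is_derive_dot _ _ _ _ _ (proj1 (E0 s Hs)) (D0 s Hs))
      (is_derive_dot _ _ _ _ _ (proj1 (E1 s Hs)) (D1 s Hs)))
      (is_derive_dot _ _ _ _ _ (proj1 (E2 s Hs)) (D2 s Hs))).
  - destruct (E0 s Hs) as [A0 B0], (E1 s Hs) as [A1 B1], (E2 s Hs) as [A2 B2].
    specialize (D0 s Hs); specialize (D1 s Hs); specialize (D2 s Hs); specialize (D3 s Hs).
    exact (is_derive_continuous _ _ _ (is_derive_Rplus _ _ _ _ _ (is_derive_Rplus _ _ _ _ _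
      (is_derive_Rplus _ _ _ _ _ (is_derive_dot _ _ _ _ _ B0 D0) (is_derive_dot _ _ _ _ _ A0 D1))
      (is_derive_Rplus _ _ _ _ _ (is_derive_dot _ _ _ _ _ B1 D1) (is_derive_dot _ _ _ _ _ A1 D2)))
      (is_derive_Rplus _ _ _ _ _ (is_derive_dot _ _ _ _ _ B2 D2) (is_derive_dot _ _ _ _ _ A2 D3)))). }
replace (W L - W 0) with 0 in HW.
2: { unfold W; destruct Z0 as (->&->&->), ZL as (->&->&->); rewrite !dot_null_r; ring. }
assert (HF : ex_RInt (fun s => dot (vderive (force_vector mu g) s) (V0 s)) 0 L).
{ apply (ex_RInt_continuous (V := R_CompleteNormedModule)); intros s.
  rewrite Rmin_left, Rmax_right by lra; auto. }
apply is_derive_eq with (RInt (dT (fun t s => sadowsky_density mu (G t) s) 0) 0 L).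
- apply (is_derive_RInt_C1t (fun t s => sadowsky_density mu (G t) s) L eps); auto.
  intros t s Ht Hs; apply (sadowsky_density_C1t mu L); auto; now apply HG.
- apply is_RInt_unique.
  apply (is_RInt_ext (fun s => plus (W' s)
    (scal 2 (dot (vderive (force_vector mu g) s) (V0 s))))).
  + intros s; rewrite Rmin_left, Rmax_right by lra; intros Hs.
    symmetry; apply is_derive_unique.
    assert (Hs' : 0 <= s <= L) by lra.
    eapply is_derive_eq;
      [apply (is_derive_sadowsky_density mu L g hf harc); auto;
       intros u Hu; apply HG0; lra|].
    change (vdT (vdS G) 0 s) with (V1 s); change (vdT (vdS (vdS G)) 0 s) with (V2 s).
    change (vdT (vdS (vdS (vdS G))) 0 s) with (V3 s).
    replace (vderive (force_vector mu g) s) with (vscal (- / 2) (vderive X0 s)).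
    * unfold W', X0 at 2, X1 at 2, momentum0, momentum1 at 2; fold X1 X2.
      unfold plus, scal; simpl; unfold mult; simpl.
      generalize (grad1 mu g s) (grad2 g s) (vderive X0 s) (vderive X1 s) (vderive X2 s)
        (X2 s) (V0 s) (V1 s) (V2 s) (V3 s); intros; vcomp; field.
    * assert (Q : is_vderive X0 s (vscal (- 2) (vderive (force_vector mu g) s))).
      { apply (is_vderive_ext_loc (fun u => vscal (- 2) (force_vector mu g u))).
        - generalize (locally_between 0 L s Hs); apply filter_imp; intros u Hu.
          symmetry; now apply (momentum0_eq mu L g hf harc).
        - pose proof (is_vderive_vscal _ _ _ _ _ (is_derive_Rconst (- 2) s)
            (vsmooth_at_derive _ _ (force_vector_smooth mu L g hf s Hs'))) as Q.
          match type of Q with is_vderive _ _ ?v =>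
            replace (vscal (- 2) (vderive (force_vector mu g) s)) with v; [exact Q|] end.
          generalize (force_vector mu g s) (vderive (force_vector mu g) s); intros.
          apply vec_ext; vcomp; ring. }
      rewrite (is_vderive_unique _ _ _ Q).
      generalize (vderive (force_vector mu g) s); intros; apply vec_ext; vcomp; field.
  + rewrite <- (Rplus_0_l (2 * _)).
    apply (is_RInt_plus (V := R_NormedModule)); auto.
    apply (is_RInt_scal (V := R_NormedModule)).
    now apply (RInt_correct (V := R_CompleteNormedModule)).
Qed.

Lemma elastic_strip_of_force_constant :
  (forall s, 0 < s < L -> vderive (force_vector mu g) s = null_vec) ->
  elastic_strip mu L g.
Proof.
intros H; split; auto; intros eps G HG.
apply (is_derive_eq _ _ _ _ (first_variation eps G HG)).
rewrite (RInt_ext _ (fun _ => 0)).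
- rewrite RInt_const; unfold scal; simpl; unfold mult; simpl; ring.
- intros s; rewrite Rmin_left, Rmax_right by lra; intros Hs.
  rewrite (H s Hs), dot_sym; apply dot_null_r.
Qed.

End FirstVariation.

(** * A bump function *)

(** The negative powers are included because differentiating [exp (- 1 / x)] produces them: index
    [k] leads to [k + 2] and [k + 1]. *)
Definition flat_exp (k : nat) (x : R) : R :=
  if Rlt_dec 0 x then exp (- / x) * / x ^ k else 0.

Lemma flat_exp_neg (k : nat) (x : R) : x <= 0 -> flat_exp k x = 0.
Proof. intros H; unfold flat_exp; destruct (Rlt_dec 0 x); lra. Qed.

Lemma flat_exp_pos (k : nat) (x : R) : 0 < x -> flat_exp k x = exp (- / x) * / x ^ k.
Proof. intros H; unfold flat_exp; destruct (Rlt_dec 0 x); lra. Qed.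

Lemma flat_exp_bound (k : nat) (x : R) :
  Rabs (flat_exp k x) <= INR (fact (k + 2)) * x ^ 2.
Proof.
pose proof (lt_0_INR _ (lt_O_fact (k + 2))) as Hf.
destruct (Rle_lt_dec x 0) as [H|H].
- rewrite flat_exp_neg, Rabs_R0 by auto; apply Rmult_le_pos; [lra|apply pow2_ge_0].
- rewrite flat_exp_pos by auto.
  assert (Hx : 0 < / x) by now apply Rinv_0_lt_compat.
  assert (Hk : 0 < x ^ k) by now apply pow_lt.
  assert (Hk2 : 0 < x ^ (k + 2)) by now apply pow_lt.
  assert (Hik : 0 < / x ^ k) by now apply Rinv_0_lt_compat.
  rewrite Rabs_pos_eq by (apply Rlt_le, Rmult_lt_0_compat; auto; apply exp_pos).
  (* Of the Taylor polynomial of the exponential only the term of degree [k + 2] is kept; two orders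
     more than [k] leave the factor [x ^ 2], which makes the derivative at 0 vanish. *)
  assert (E : (/ x) ^ (k + 2) / INR (fact (k + 2)) <= exp (/ x)).
  { apply Rle_trans with (2 := exp_ge_taylor (/ x) (k + 2) (Rlt_le _ _ Hx)).
    rewrite Nat.add_succ_r at 3; rewrite tech5, <- Nat.add_succ_r.
    rewrite <- (Rplus_0_l (_ / _)) at 1; apply Rplus_le_compat_r, cond_pos_sum.
    intros m; apply Rmult_le_pos; [apply pow_le; lra|].
    apply Rlt_le, Rinv_0_lt_compat, lt_0_INR, lt_O_fact. }
  rewrite exp_Ropp; rewrite pow_inv in E.
  assert (0 < exp (/ x)) by apply exp_pos.
  apply (Rmult_le_compat_l (INR (fact (k + 2)) * x ^ 2 * / exp (/ x))) in E.
  + replace (INR (fact (k + 2)) * x ^ 2 * / exp (/ x) *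
      (/ x ^ (k + 2) / INR (fact (k + 2)))) with (/ exp (/ x) * / x ^ k) in E
      by (rewrite pow_add; field; repeat split; lra).
    replace (INR (fact (k + 2)) * x ^ 2) with
      (INR (fact (k + 2)) * x ^ 2 * / exp (/ x) * exp (/ x)) by (field; lra).
    exact E.
  + apply Rmult_le_pos; [apply Rmult_le_pos; [lra|apply pow2_ge_0]|].
    apply Rlt_le, Rinv_0_lt_compat; auto.
Qed.

Lemma is_derive_quadratic_bound (f : R -> R) (c : R) :
  (forall x, Rabs (f x) <= c * x ^ 2) -> is_derive f 0 0.
Proof.
intros H; apply is_derive_Reals; intros eps Heps.
assert (H0 : f 0 = 0).
{ specialize (H 0); replace (c * 0 ^ 2) with 0 in H by ring.
  apply Rabs_eq_0; apply Rle_antisym; auto; apply Rabs_pos. }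
assert (Hc : 0 < Rabs c + 1) by (pose proof (Rabs_pos c); lra).
assert (Hd : 0 < eps / (Rabs c + 1)) by now apply Rdiv_lt_0_compat.
exists (mkposreal _ Hd); simpl; intros h Hh Hhd.
rewrite Rplus_0_l, H0, !Rminus_0_r; unfold Rdiv; rewrite Rabs_mult, Rabs_inv.
assert (Hh' : 0 < Rabs h) by now apply Rabs_pos_lt.
apply (Rmult_lt_reg_r (Rabs h)); auto; rewrite Rmult_assoc, Rinv_l, Rmult_1_r by lra.
apply Rle_lt_trans with (1 := H h).
rewrite <- (pow2_abs h); apply (Rmult_lt_compat_r (Rabs c + 1)) in Hhd; auto.
replace (eps / (Rabs c + 1) * (Rabs c + 1)) with eps in Hhd by (field; lra).
pose proof (Rle_abs c); nra.
Qed.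

Lemma is_derive_flat_exp (k : nat) (x : R) :
  is_derive (flat_exp k) x (flat_exp (k + 2) x - INR k * flat_exp (k + 1) x).
Proof.
destruct (Rtotal_order x 0) as [H|[H|H]].
- apply (is_derive_ext_loc (fun _ => 0)).
  + apply (locally_open (fun u => u < 0)); auto using open_lt.
    intros y Hy; cbv beta in Hy; rewrite flat_exp_neg by lra; reflexivity.
  + rewrite !flat_exp_neg by lra; rewrite Rmult_0_r, Rminus_0_r; apply is_derive_Rconst.
- subst x; rewrite !flat_exp_neg by lra; rewrite Rmult_0_r, Rminus_0_r.
  apply (is_derive_quadratic_bound _ _ (flat_exp_bound k)).
- apply (is_derive_ext_loc (fun x => exp (- / x) * / x ^ k)).
  + apply (locally_open (fun u => 0 < u)); auto using open_gt.
    intros y Hy; cbv beta in Hy; now rewrite flat_exp_pos.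
  + rewrite !flat_exp_pos by auto.
    assert (Hk : x ^ k <> 0) by (apply pow_nonzero; lra).
    auto_derive; [repeat split; auto; lra|].
    rewrite !pow_add; destruct k as [|k]; [simpl; field; lra|].
    assert (x ^ k <> 0) by (apply pow_nonzero; lra).
    change (x ^ S k) with (x * x ^ k); change (Init.Nat.pred (S k)) with k.
    field; repeat split; auto; lra.
Qed.

(** A class stable under differentiation, as [ex_derive_n_coind] demands; its only combination
    copies the shape of the derivative in [is_derive_flat_exp]. *)
Inductive flat_exp_span : (R -> R) -> Prop :=
| span_base k : flat_exp_span (flat_exp k)
| span_comb c f h : flat_exp_span f -> flat_exp_span h ->
    flat_exp_span (fun x => f x - c * h x).

Lemma flat_exp_smooth (n : nat) (x : R) : ex_derive_n (flat_exp 0) n x.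
Proof.
apply (ex_derive_n_coind flat_exp_span (fun _ => True)); auto using span_base.
- apply open_true.
- intros f Hf; induction Hf as [k|c f h Hf [f' [Cf Df]] Hh [h' [Ch Dh]]].
  + eexists; split; [apply (span_comb (INR k)); apply span_base|].
    intros u _; apply is_derive_flat_exp.
  + exists (fun x => f' x - c * h' x); split; [now apply span_comb|].
    intros u _; specialize (Df u I); specialize (Dh u I).
    eapply is_derive_eq; [der|ring].
Qed.

Definition bump (a b s : R) : R := flat_exp 0 (s - a) * flat_exp 0 (b - s).

Lemma bump_smooth (a b s : R) : smooth_at (bump a b) s.
Proof.
apply smooth_at_mult; unfold smooth_at; apply filter_forall; intros u n.
- apply (ex_derive_n_comp_trans (flat_exp 0)), flat_exp_smooth.
- apply (ex_derive_n_ext (fun y => flat_exp 0 (- y + b))).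
  + intros y; f_equal; ring.
  + apply (ex_derive_n_comp_opp (fun y => flat_exp 0 (y + b))).
    apply filter_forall; intros y m _.
    apply (ex_derive_n_comp_trans (flat_exp 0)), flat_exp_smooth.
Qed.

Lemma bump_outside (a b s : R) : s <= a \/ b <= s -> bump a b s = 0.
Proof.
intros [H|H]; unfold bump.
- rewrite (flat_exp_neg 0 (s - a)) by lra; ring.
- rewrite (flat_exp_neg 0 (b - s)) by lra; ring.
Qed.

Lemma bump_inside (a b s : R) : a < s < b -> 0 < bump a b s.
Proof.
intros H; unfold bump; rewrite !flat_exp_pos by lra; simpl; rewrite Rinv_1.
apply Rmult_lt_0_compat; apply Rmult_lt_0_compat; auto using exp_pos; lra.
Qed.

(** * Affine variations *)

Lemma locally_2d_snd (P : R -> Prop) (t s : R) :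
  locally s P -> locally_2d (fun _ v => P v) t s.
Proof. intros [d Hd]; exists d; intros u v _ Hv; apply Hd, Hv. Qed.

(** Functions [a v + u b v] form a class stable under both partial derivatives: the pair [(a, b)]
    becomes [(b, 0)] or [(a', b')]. Hence [a] and [b] are generalized in the induction. *)
Lemma ex_diff_n_affine (n : nat) : forall (a b : R -> R) (t s : R),
  smooth_at a s -> smooth_at b s -> ex_diff_n (fun u v => a v + u * b v) n t s.
Proof.
induction n as [|n IH]; intros a b t s Ha Hb;
  assert (Hc : continuity_2d_pt (fun u v => a v + u * b v) t s).
1, 3: apply continuity_2d_pt_plus; [|apply continuity_2d_pt_mult];
  [apply (continuity_1d_2d_pt_comp a (fun _ v => v))
  |apply continuity_2d_pt_id1
  |apply (continuity_1d_2d_pt_comp b (fun _ v => v))];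
  try apply continuity_2d_pt_id2; apply continuity_pt_filterlim;
  now apply smooth_at_continuous.
- split; auto.
- split; [exact Hc|].
  assert (Dt : forall u v, is_derive (fun z => a v + z * b v) u (b v + u * 0)).
  { intros u v; eapply is_derive_eq; [apply is_derive_Rplus;
      [apply is_derive_Rconst|apply is_derive_Rmult; [apply is_derive_id|apply is_derive_Rconst]]|].
    unfold one; simpl; ring. }
  assert (Ds : forall u v, smooth_at a v -> smooth_at b v ->
    is_derive (fun z => a z + u * b z) v (Derive a v + u * Derive b v)).
  { intros u v Hav Hbv; apply smooth_at_derive in Hav, Hbv.
    eapply is_derive_eq; [der|ring]. }
  split; [|split; [|split]].
  + eexists; apply Dt.
  + eexists; now apply Ds.
  + apply (ex_diff_n_ext_loc (fun u v => b v + u * 0)).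
    * apply locally_2d_forall; intros u v; symmetry; apply is_derive_unique, Dt.
    * apply (IH b (fun _ => 0)); auto; apply smooth_at_const.
  + apply (ex_diff_n_ext_loc (fun u v => Derive a v + u * Derive b v)).
    * pose proof (filter_and _ _ (smooth_at_locally _ _ Ha) (smooth_at_locally _ _ Hb)) as H.
      apply (locally_2d_snd _ t) in H; revert H; apply locally_2d_imp.
      intros u v [Hav Hbv]; symmetry; now apply is_derive_unique, Ds.
    * apply IH; now apply smooth_at_Derive.
Qed.

Lemma smooth_at_2d_affine (a b : R -> R) (t s : R) :
  smooth_at a s -> smooth_at b s -> smooth_at_2d (fun u v => a v + u * b v) t s.
Proof.
intros Ha Hb.
pose proof (filter_and _ _ (smooth_at_locally _ _ Ha) (smooth_at_locally _ _ Hb)) as H.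
apply (locally_2d_snd _ t) in H; revert H; apply locally_2d_imp.
intros u v [Hav Hbv] n; now apply ex_diff_n_affine.
Qed.

Definition affine_variation (g V : R -> vec) (t s : R) : vec :=
  vadd (g s) (vscal t (V s)).

Lemma affine_variation_smooth (g V : R -> vec) (t s : R) :
  vsmooth_at g s -> vsmooth_at V s -> vsmooth_2d (affine_variation g V) t s.
Proof.
intros (?&?&?) (?&?&?); split; [|split];
  now apply (smooth_at_2d_affine (fun v => _ (g v)) (fun v => _ (V v))).
Qed.

Lemma C1t_continuity (F : R -> R -> R) (t s : R) : C1t F t s -> continuity_2d_pt F t s.
Proof. intros [F' H]; apply locally_2d_singleton in H; apply H. Qed.

(** By Lagrange's identity a nonzero [h' x h''] forces [h'] to be nonzero too. This replaces two
    nonvanishing conditions by one strict inequality, convenient for perturbation. *)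
Lemma frenet_curve_intro (L : R) (h : R -> vec) :
  smooth_curve L h ->
  (forall s, 0 <= s <= L ->
    0 < dot (cross (vderive h s) (vderive (vderive h) s))
            (cross (vderive h s) (vderive (vderive h) s))) ->
  frenet_curve L h.
Proof.
intros Hs Hc.
assert (H : forall s, 0 <= s <= L -> speed h s <> 0).
{ intros s Hs'; specialize (Hc s Hs'); unfold speed; apply vnorm_neq_0.
  revert Hc; generalize (vderive h s) (vderive (vderive h) s); intros u w Hc.
  assert (E : dot (cross u w) (cross u w) = dot u u * dot w w - dot u w ^ 2)
    by (vcomp; ring).
  pose proof (dot_self_ge_0 u); pose proof (dot_self_ge_0 w).
  pose proof (pow2_ge_0 (dot u w)); nra. }
split; [|split]; auto; intros s Hs'; unfold curvature.
apply Rmult_integral_contrapositive; split; [now apply vnorm_neq_0, Hc|].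
now apply Rinv_neq_0_compat, pow_nonzero, H.
Qed.

(** A compactness argument: [|g' x g''|^2] has a positive minimum on [[0, L]], and uniform
    continuity keeps it positive for all small [t] at once. *)
Lemma frenet_affine_variation (L : R) (g V : R -> vec) :
  0 < L -> frenet_curve L g -> (forall s, 0 <= s <= L -> vsmooth_at V s) ->
  exists eps, 0 < eps /\
    forall t, - eps < t < eps -> frenet_curve L (affine_variation g V t).
Proof.
intros HL hf HV; set (G := affine_variation g V).
assert (HG : forall t s, 0 <= s <= L -> vsmooth_2d G t s).
{ intros t s Hs; apply affine_variation_smooth; auto; now apply (frenet_smooth L). }
set (c := fun t s => cross (vdS G t s) (vdS (vdS G) t s)).
assert (Hc : forall t s, 0 <= s <= L -> continuity_2d_pt (fun u v => dot (c u v) (c u v)) t s).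
{ intros t s Hs; apply C1t_continuity.
  assert (vC1t c t s).
  { apply vC1t_cross; apply vsmooth_2d_vC1t; repeat apply vsmooth_2d_vdS; auto. }
  now apply C1t_dot. }
destruct (continuity_ab_min (fun s => dot (c 0 s) (c 0 s)) 0 L) as [m [Hm Hm']]; [lra| |].
{ intros s Hs; apply continuity_pt_filterlim.
  exact (continuity_2d_pt_continuous_s (fun u v => dot (c u v) (c u v)) 0 s (Hc 0 s Hs)). }
assert (Hm0 : 0 < dot (c 0 m) (c 0 m)).
{ assert (E1 : forall s, vdS G 0 s = vderive g s).
  { intros s; apply vderive_ext_loc, filter_forall; intros u; unfold G, affine_variation.
    generalize (g u) (V u); intros; apply vec_ext; vcomp; ring. }
  assert (E2 : vdS (vdS G) 0 m = vderive (vderive g) m).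
  { apply vderive_ext_loc, filter_forall; intros u; apply E1. }
  unfold c; rewrite E1, E2; apply vnorm_neq_0; now apply (cross_derivatives_neq_0 L). }
assert (Hd2 : 0 < dot (c 0 m) (c 0 m) / 2) by lra.
destruct (uniform_continuity_2d (fun u v => dot (c u v) (c u v)) (-1) 1 0 L
  (fun x y _ Hy => Hc x y Hy) (mkposreal _ Hd2)) as [d Hd]; simpl in Hd.
pose proof (cond_pos d); pose proof (Rmin_l d 1); pose proof (Rmin_r d 1).
(* The bound 1 keeps [t] in [[-1, 1]], the range on which uniform continuity was taken. *)
exists (Rmin d 1); split; [apply Rmin_pos; lra|]; intros t Ht.
apply frenet_curve_intro.
- intros s Hs; apply (vsmooth_at_vadd g (fun u => vscal t (V u))).
  + now apply (frenet_smooth L).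
  + apply (vsmooth_at_vscal (fun _ => t)); auto; apply smooth_at_const.
- intros s Hs; specialize (Hm s Hs); cbv beta in Hm.
  specialize (Hd 0 s t s ltac:(lra) Hs ltac:(lra) Hs).
  rewrite Rminus_0_r, Rminus_diag, Rabs_R0 in Hd.
  specialize (Hd ltac:(apply Rabs_def1; lra) ltac:(lra)).
  apply Rabs_def2 in Hd; change (0 < dot (c t s) (c t s)); lra.
Qed.

Lemma is_vderive_eq (f : R -> vec) (s : R) (v w : vec) :
  is_vderive f s v -> v = w -> is_vderive f s w.
Proof. now intros H <-. Qed.

Lemma dot_self_eq_0 (u : vec) : dot u u = 0 -> u = null_vec.
Proof.
intros H; unfold dot in H.
pose proof (Rle_0_sqr (cx u)); pose proof (Rle_0_sqr (cy u)); pose proof (Rle_0_sqr (cz u)).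
unfold Rsqr in *; apply vec_ext; apply Rsqr_0_uniq; unfold Rsqr; simpl; lra.
Qed.

(** The fundamental lemma of the calculus of variations: where [b0'] is nonzero, the field
    [V = bump b0'] gives the first variation [2 int bump |b0'|^2], which is positive. *)
Lemma force_constant_of_elastic_strip (mu L : R) (g : R -> vec) :
  0 < L -> arclength L g -> elastic_strip mu L g ->
  forall s, 0 < s < L -> vderive (force_vector mu g) s = null_vec.
Proof.
intros HL harc [hf He] s Hs; set (X := vderive (force_vector mu g)).
assert (HX : forall u, 0 <= u <= L -> vsmooth_at X u).
{ intros u Hu; now apply vsmooth_at_vderive, (force_vector_smooth mu L). }
destruct (dot_self_ge_0 (X s)) as [Hpos|E].
2: { apply dot_self_eq_0; auto. }
exfalso.
assert (Hl : locally s (fun u => 0 < dot (X u) (X u) /\ 0 < u < L)).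
{ apply filter_and; [|now apply locally_between].
  pose proof (smooth_at_dot _ _ _ (HX s (in_closed L s Hs)) (HX s (in_closed L s Hs))) as K.
  apply smooth_at_continuous in K; apply (K (fun y => 0 < y)), open_gt, Hpos. }
destruct Hl as [d Hd]; pose proof (cond_pos d) as Hd0.
(* Half the radius, so that the closed interval [[a, b]] lies in the neighbourhood; the support of
   [V] then stays away from 0 and [L], and the variation is proper. *)
set (a := s - d / 2); set (b := s + d / 2).
assert (Hab : forall u, a <= u <= b -> 0 < dot (X u) (X u) /\ 0 < u < L).
{ unfold a, b; intros u Hu; apply Hd, Rabs_def1; unfold minus, plus, opp; simpl; lra. }
destruct (Hab a ltac:(unfold a, b; lra)) as [_ Ha].
destruct (Hab b ltac:(unfold a, b; lra)) as [_ Hb].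
assert (Hltab : a < b) by (unfold a, b; lra); clearbody a b; clear Hd.
set (V := fun u => vscal (bump a b u) (X u)).
assert (HV : forall u, 0 <= u <= L -> vsmooth_at V u).
{ intros u Hu; apply vsmooth_at_vscal; auto; apply bump_smooth. }
destruct (frenet_affine_variation L g V HL hf HV) as [eps [Heps HG]].
assert (Hv : proper_variation L g eps (affine_variation g V)).
{ split; [exact Heps|split; [|split; [exact HG|split]]].
  - intros t u _ Hu; apply affine_variation_smooth; auto; now apply (frenet_smooth L).
  - intros u _; unfold affine_variation; generalize (g u) (V u); intros.
    apply vec_ext; vcomp; ring.
  - pose proof (Rmin_l a (L - b)); pose proof (Rmin_r a (L - b)).
    exists (Rmin a (L - b)); split; [apply Rmin_pos; lra|].
    intros t u _ Hu Hu'; unfold affine_variation, V.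
    rewrite bump_outside by lra; generalize (g u) (X u); intros.
    apply vec_ext; vcomp; ring. }
pose proof (is_derive_unique _ _ _ (He eps _ Hv)) as E.
rewrite (is_derive_unique _ _ _ (first_variation mu L g HL hf harc eps _ Hv)) in E.
set (f := fun u => bump a b u * dot (X u) (X u)).
rewrite (RInt_ext _ f) in E.
2: { intros u _; unfold f.
  replace (vdT (affine_variation g V) 0 u) with (V u).
  - unfold V, X; generalize (vderive (force_vector mu g) u); intros; vcomp; ring.
  - symmetry; apply is_vderive_unique; unfold affine_variation.
    pose proof (is_vderive_vadd _ _ _ _ _
      (conj (is_derive_Rconst (cx (g u)) 0) (conj (is_derive_Rconst (cy (g u)) 0)
        (is_derive_Rconst (cz (g u)) 0)) : is_vderive (fun _ => g u) 0 null_vec)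
      (is_vderive_vscal (fun t => t) (fun _ => V u) 0 1 null_vec (is_derive_id 0)
      (conj (is_derive_Rconst (cx (V u)) 0) (conj (is_derive_Rconst (cy (V u)) 0)
        (is_derive_Rconst (cz (V u)) 0))))) as K.
    cbv beta in K; revert K; generalize (V u); intros w K.
    apply (is_vderive_eq _ _ _ _ K).
    unfold null_vec; apply vec_ext; vcomp; ring. }
assert (Hc : forall u, 0 <= u <= L -> continuous f u).
{ intros u Hu; apply smooth_at_continuous, smooth_at_mult; [apply bump_smooth|].
  apply smooth_at_dot; auto. }
assert (Hex : forall x y, 0 <= x -> x <= y -> y <= L -> ex_RInt f x y).
{ intros x y Hx Hxy Hy; apply (ex_RInt_continuous (V := R_CompleteNormedModule)).
  intros z; rewrite Rmin_left, Rmax_right by auto; intros; apply Hc; lra. }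
rewrite <- (RInt_Chasles f 0 a L), <- (RInt_Chasles f a b L) in E; try (apply Hex; lra).
rewrite (RInt_ext f (fun _ => 0) 0 a), (RInt_ext f (fun _ => 0) b L), !RInt_const in E.
- unfold plus, scal in E; simpl in E; unfold mult in E; simpl in E.
  enough (0 < RInt f a b) by lra.
  apply RInt_gt_0; auto; [|intros u Hu; apply Hc; lra].
  intros u Hu; apply Rmult_lt_0_compat; [now apply bump_inside|exact (proj1 (Hab u ltac:(lra)))].
- intros u; rewrite Rmin_left, Rmax_right by lra; intros Hu; unfold f.
  rewrite bump_outside; lra.
- intros u; rewrite Rmin_left, Rmax_right by lra; intros Hu; unfold f.
  rewrite bump_outside; lra.
Qed.

(** * Analyticity of solutions of polynomial differential systems *)

Definition taylor_coef (f : R -> R) (k : nat) (s : R) : R :=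
  Derive_n f k s / INR (fact k).

(* The truncated norm [sum_(k <= n) |f^(k)(s)| r^k / k!], which is
   submultiplicative in [f]. *)
Definition tnorm (r : R) (n : nat) (f : R -> R) (s : R) : R :=
  sum_f_R0 (fun k => Rabs (taylor_coef f k s) * r ^ k) n.

Lemma taylor_coef_S (f : R -> R) (k : nat) (s : R) :
  INR (S k) * taylor_coef f (S k) s = taylor_coef (Derive f) k s.
Proof.
unfold taylor_coef; rewrite Derive_n_Derive.
change (fact (S k)) with (S k * fact k)%nat; rewrite mult_INR.
field; split; apply not_0_INR; [apply fact_neq_0|lia].
Qed.

Lemma Derive_n_smooth_plus (f h : R -> R) (k : nat) (s : R) :
  smooth_at f s -> smooth_at h s ->
  Derive_n (fun x => f x + h x) k s = Derive_n f k s + Derive_n h k s.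
Proof.
intros Hf Hh; apply Derive_n_plus.
- unfold smooth_at in Hf; revert Hf; apply filter_imp; auto.
- unfold smooth_at in Hh; revert Hh; apply filter_imp; auto.
Qed.

Lemma taylor_coef_plus (f h : R -> R) (k : nat) (s : R) :
  smooth_at f s -> smooth_at h s ->
  taylor_coef (fun x => f x + h x) k s = taylor_coef f k s + taylor_coef h k s.
Proof.
intros Hf Hh; unfold taylor_coef; rewrite Derive_n_smooth_plus by auto.
field; apply not_0_INR, fact_neq_0.
Qed.

Lemma taylor_coef_ext (f h : R -> R) (k : nat) (s : R) :
  locally s (fun u => f u = h u) -> taylor_coef f k s = taylor_coef h k s.
Proof. intros H; unfold taylor_coef; now rewrite (Derive_n_ext_loc f h). Qed.

(** Leibniz's rule on the level of coefficients. The weight [k + 1] of the term of index [i] is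
    split as [i + (k + 1 - i)], one part for each factor being differentiated. *)
Lemma cauchy_sum_S (a b : nat -> R) (k : nat) :
  sum_f_R0 (fun i => INR (S i) * a (S i) * b (k - i)%nat) k
  + sum_f_R0 (fun i => a i * (INR (S (k - i)) * b (S (k - i)))) k
  = INR (S k) * sum_f_R0 (fun i => a i * b (S k - i)%nat) (S k).
Proof.
set (f := fun i => INR i * a i * b (S k - i)%nat).
set (h := fun i => INR (S k - i) * a i * b (S k - i)%nat).
transitivity (sum_f_R0 f (S k) + sum_f_R0 h (S k)).
- f_equal.
  + rewrite (decomp_sum f (S k)) by lia; simpl pred.
    replace (f 0%nat) with 0 by (unfold f; simpl; ring); rewrite Rplus_0_l.
    apply sum_eq; intros i Hi; unfold f; now replace (S k - S i)%nat with (k - i)%nat by lia.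
  + rewrite (tech5 h k); replace (h (S k)) with 0
      by (unfold h; rewrite Nat.sub_diag; simpl; ring); rewrite Rplus_0_r.
    apply sum_eq; intros i Hi; unfold h; replace (S k - i)%nat with (S (k - i)) by lia; ring.
- rewrite <- sum_plus, scal_sum; apply sum_eq; intros i Hi; unfold f, h.
  rewrite minus_INR by auto; ring.
Qed.

Lemma taylor_coef_mult (k : nat) : forall (f h : R -> R) (s : R),
  smooth_at f s -> smooth_at h s ->
  taylor_coef (fun x => f x * h x) k s =
  sum_f_R0 (fun i => taylor_coef f i s * taylor_coef h (k - i) s) k.
Proof.
induction k as [|k IH]; intros f h s Hf Hh.
- unfold taylor_coef; simpl; field.
- apply (Rmult_eq_reg_l (INR (S k))); [|apply not_0_INR; lia].
  rewrite taylor_coef_S.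
  rewrite (taylor_coef_ext _ (fun x => Derive f x * h x + f x * Derive h x)).
  + rewrite taylor_coef_plus by (apply smooth_at_mult; auto using smooth_at_Derive).
    rewrite (IH (Derive f) h), (IH f (Derive h)) by auto using smooth_at_Derive.
    rewrite <- (cauchy_sum_S (fun i => taylor_coef f i s) (fun i => taylor_coef h i s)).
    f_equal; apply sum_eq; intros i Hi; now rewrite <- taylor_coef_S.
  + generalize (filter_and _ _ (smooth_at_locally _ _ Hf) (smooth_at_locally _ _ Hh)).
    apply filter_imp; intros u [Hfu Hhu]; apply is_derive_unique.
    apply smooth_at_derive in Hfu, Hhu; der.
Qed.

Lemma cauchy_sum_le (a b : nat -> R) (n : nat) :
  (forall i, 0 <= a i) -> (forall i, 0 <= b i) ->
  sum_f_R0 (fun k => sum_f_R0 (fun i => a i * b (k - i)%nat) k) n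
  <= sum_f_R0 a n * sum_f_R0 b n.
Proof.
intros Ha Hb; destruct n as [|n]; [simpl; lra|].
rewrite (cauchy_finite a b (S n)) by lia.
rewrite <- (Rplus_0_r (sum_f_R0 _ _)) at 1; apply Rplus_le_compat_l.
apply cond_pos_sum; intros k; apply cond_pos_sum; intros i; now apply Rmult_le_pos.
Qed.

Section TruncatedNorm.

Variables (r s : R).
Hypothesis hr : 0 < r.

Lemma tnorm_term_ge_0 (f : R -> R) (k : nat) : 0 <= Rabs (taylor_coef f k s) * r ^ k.
Proof. apply Rmult_le_pos; [apply Rabs_pos|apply pow_le; lra]. Qed.

Lemma tnorm_ge_0 (n : nat) (f : R -> R) : 0 <= tnorm r n f s.
Proof. apply cond_pos_sum; intros k; apply tnorm_term_ge_0. Qed.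

Lemma tnorm_ext (n : nat) (f h : R -> R) :
  locally s (fun u => f u = h u) -> tnorm r n f s = tnorm r n h s.
Proof.
intros H; apply sum_eq; intros k _; now rewrite (taylor_coef_ext f h).
Qed.

Lemma tnorm_const (n : nat) (c : R) : tnorm r n (fun _ => c) s <= Rabs c.
Proof.
destruct n as [|n]; unfold tnorm.
- simpl; unfold taylor_coef; simpl; rewrite Rmult_1_r, Rdiv_1_r; lra.
- rewrite decomp_sum by lia; simpl pred.
  rewrite (sum_eq _ (fun _ => 0)).
  + rewrite sum_eq_R0 by auto; unfold taylor_coef; simpl; rewrite Rmult_1_r, Rdiv_1_r; lra.
  + intros i _; unfold taylor_coef; rewrite Derive_n_const.
    unfold Rdiv; rewrite Rmult_0_l, Rabs_R0; ring.
Qed.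

Lemma tnorm_plus (n : nat) (f h : R -> R) : smooth_at f s -> smooth_at h s ->
  tnorm r n (fun x => f x + h x) s <= tnorm r n f s + tnorm r n h s.
Proof.
intros Hf Hh; unfold tnorm; rewrite <- sum_plus; apply sum_Rle; intros k _.
rewrite taylor_coef_plus, <- Rmult_plus_distr_r by auto.
apply Rmult_le_compat_r; [apply pow_le; lra|apply Rabs_triang].
Qed.

Lemma tnorm_mult (n : nat) (f h : R -> R) : smooth_at f s -> smooth_at h s ->
  tnorm r n (fun x => f x * h x) s <= tnorm r n f s * tnorm r n h s.
Proof.
intros Hf Hh; apply Rle_trans with (2 := cauchy_sum_le _ _ n
  (tnorm_term_ge_0 f) (tnorm_term_ge_0 h)).
apply sum_Rle; intros k _; rewrite taylor_coef_mult by auto.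
apply Rle_trans with
  (r ^ k * sum_f_R0 (fun i => Rabs (taylor_coef f i s * taylor_coef h (k - i) s)) k).
- rewrite Rmult_comm; apply Rmult_le_compat_l; [apply pow_le; lra|].
  exact (Rsum_abs (fun i => taylor_coef f i s * taylor_coef h (k - i) s) k).
- apply Req_le; rewrite scal_sum; apply sum_eq; intros i Hi; rewrite Rabs_mult.
  replace k with (i + (k - i))%nat at 2 by lia; rewrite pow_add; ring.
Qed.

(** The coefficients of [f'] are those of [f] shifted and multiplied by [k + 1]; this factor is at
    least 1 and is discarded. *)
Lemma tnorm_S (n : nat) (f : R -> R) :
  tnorm r (S n) f s <= Rabs (f s) + r * tnorm r n (Derive f) s.
Proof.
unfold tnorm; rewrite decomp_sum by lia; simpl pred; apply Rplus_le_compat.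
- unfold taylor_coef; simpl; rewrite Rmult_1_r, Rdiv_1_r; lra.
- rewrite scal_sum; apply sum_Rle; intros k _.
  rewrite <- taylor_coef_S, Rabs_mult, (Rabs_pos_eq (INR _)) by apply pos_INR.
  assert (1 <= INR (S k)) by (rewrite S_INR; pose proof (pos_INR k); lra).
  pose proof (Rabs_pos (taylor_coef f (S k) s)).
  assert (0 < r ^ k) by now apply pow_lt.
  assert (0 <= r ^ k * r) by nra.
  replace (r ^ S k) with (r ^ k * r) by (simpl; ring).
  rewrite Rmult_assoc, (Rmult_comm (INR _)), Rmult_assoc.
  apply Rmult_le_compat_l; auto; nra.
Qed.

End TruncatedNorm.

Inductive gen_by (Y : list (R -> R)) : (R -> R) -> Prop :=
| by_var y : In y Y -> gen_by Y y
| by_const c : gen_by Y (fun _ => c)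
| by_plus f h : gen_by Y f -> gen_by Y h -> gen_by Y (fun x => f x + h x)
| by_mult f h : gen_by Y f -> gen_by Y h -> gen_by Y (fun x => f x * h x).

Lemma list_uniform {X : Type} (Y : list X) (Q : X -> R -> Prop) :
  (forall y K K', Q y K -> K <= K' -> Q y K') ->
  (forall y, In y Y -> exists K, Q y K) ->
  exists K, 0 < K /\ forall y, In y Y -> Q y K.
Proof.
intros HQ; induction Y as [|x Y IH]; intros H.
- exists 1; split; [lra|intros y []].
- destruct (H x (or_introl eq_refl)) as [K HK].
  destruct IH as [K' [HK'0 HK']]; [intros y Hy; apply H; now right|].
  exists (Rmax K K'); split; [apply Rlt_le_trans with (1 := HK'0), Rmax_r|].
  intros y [<-|Hy]; [apply HQ with (1 := HK), Rmax_l|apply HQ with (1 := HK' y Hy), Rmax_r].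
Qed.

Section PolynomialSystem.

Variables (a b : R) (Y : list (R -> R)).
Hypothesis hsmooth : forall y s, In y Y -> a < s < b -> smooth_at y s.

Lemma gen_by_smooth (f : R -> R) (s : R) : gen_by Y f -> a < s < b -> smooth_at f s.
Proof.
intros Hf Hs; induction Hf as [y|c|f h _ Hf _ Hh|f h _ Hf _ Hh]; auto.
- apply smooth_at_const.
- now apply smooth_at_plus.
- now apply smooth_at_mult.
Qed.

(** [K] is fixed before [r], [n] and [s]: by subadditivity and submultiplicativity it depends only
    on the polynomial and on [M]. This order of choices allows [r] to be taken small in terms of [K]
    later. *)
Lemma gen_by_bound (f : R -> R) (M : R) : gen_by Y f ->
  exists K, 0 <= K /\ forall r n s, 0 < r -> a < s < b ->
    (forall y, In y Y -> tnorm r n y s <= M) -> tnorm r n f s <= K.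
Proof.
intros Hf; induction Hf as [y Hy|c|f h Gf [K [HK Hf]] Gh [K' [HK' Hh]]
  |f h Gf [K [HK Hf]] Gh [K' [HK' Hh]]].
- exists (Rabs M); split; [apply Rabs_pos|].
  intros r n s _ _ H; apply Rle_trans with (1 := H y Hy), Rle_abs.
- exists (Rabs c); split; [apply Rabs_pos|]; intros; now apply tnorm_const.
- exists (K + K'); split; [lra|]; intros r n s Hr Hs H.
  apply Rle_trans with (1 := tnorm_plus r s Hr n f h (gen_by_smooth f s Gf Hs)
    (gen_by_smooth h s Gh Hs)); apply Rplus_le_compat; auto.
- exists (K * K'); split; [now apply Rmult_le_pos|]; intros r n s Hr Hs H.
  apply Rle_trans with (1 := tnorm_mult r s Hr n f h (gen_by_smooth f s Gf Hs)
    (gen_by_smooth h s Gh Hs)).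
  apply Rmult_le_compat; auto; now apply tnorm_ge_0.
Qed.

Hypothesis hsystem : forall y, In y Y ->
  exists f, gen_by Y f /\ forall s, a < s < b -> is_derive y s (f s).

(* From [tnorm (n+1) y <= |y| + r tnorm n y'] the bound [2 M] is preserved by
   induction on [n] as soon as [r] is small. *)
Lemma polynomial_system_bound (M : R) : 0 < M ->
  (forall y s, In y Y -> a < s < b -> Rabs (y s) <= M) ->
  exists r, 0 < r /\
    forall n y s, In y Y -> a < s < b -> tnorm r n y s <= 2 * M.
Proof.
intros HM HY.
destruct (list_uniform Y (fun y K => forall r n s, 0 < r -> a < s < b ->
    (forall y, In y Y -> tnorm r n y s <= 2 * M) -> tnorm r n (Derive y) s <= K))
  as [K [HK0 HK]].
- intros y K K' H HKK r n s Hr Hs Hy; apply Rle_trans with K; auto.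
- intros y Hy; destruct (hsystem y Hy) as [f [Gf Df]].
  destruct (gen_by_bound f (2 * M) Gf) as [K [_ HK]]; exists K.
  intros r n s Hr Hs H; rewrite (tnorm_ext r s n (Derive y) f); auto.
  generalize (locally_between a b s Hs); apply filter_imp; intros u Hu.
  now apply is_derive_unique, Df.
(* With [r K = M] the inductive step reads [M + r K = 2 M]. *)
- exists (M / K); split; [now apply Rdiv_lt_0_compat|].
  assert (Hr : 0 < M / K) by now apply Rdiv_lt_0_compat.
  induction n as [|n IH]; intros y s Hy Hs.
  + unfold tnorm, taylor_coef; simpl; rewrite Rmult_1_r, Rdiv_1_r.
    specialize (HY y s Hy Hs); lra.
  + apply Rle_trans with (1 := tnorm_S (M / K) s Hr n y).
    specialize (HK y Hy (M / K) n s Hr Hs (fun z Hz => IH z s Hz Hs)).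
    apply (Rmult_le_compat_l (M / K)) in HK; [|lra].
    replace (M / K * K) with M in HK by (field; lra).
    specialize (HY y s Hy Hs); lra.
Qed.

(** A single term is bounded by the truncated norm. Uniformity over the open interval is essential,
    since the flat point will be one of its end points. *)
Lemma polynomial_system_analytic (M : R) (f : R -> R) : 0 < M ->
  (forall y s, In y Y -> a < s < b -> Rabs (y s) <= M) -> gen_by Y f ->
  exists r K, 0 < r /\
    forall n s, a < s < b -> Rabs (taylor_coef f n s) * r ^ n <= K.
Proof.
intros HM HY Gf; destruct (polynomial_system_bound M HM HY) as [r [Hr Hb]].
destruct (gen_by_bound f (2 * M) Gf) as [K [_ HK]].
exists r, K; split; auto; intros n s Hs.
apply Rle_trans with (tnorm r n f s); [|now apply HK; auto].
unfold tnorm; destruct n as [|n]; [simpl; lra|]; rewrite tech5.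
rewrite <- (Rplus_0_l (_ * _)) at 1; apply Rplus_le_compat_r, cond_pos_sum.
intros; now apply tnorm_term_ge_0.
Qed.

End PolynomialSystem.

(** * Flat points of analytic functions *)

Definition flat_at (f : R -> R) (p : R) : Prop := forall n, Derive_n f n p = 0.

(** At a flat point the Taylor polynomial is zero, so the Lagrange remainder gives
    [|f s| <= K ((s - p) / r)^n <= K / 2^n] for [n >= 1]. *)
Lemma flat_right (f : R -> R) (r K p s : R) : 0 < r -> p < s -> s - p < r / 2 ->
  (forall u, p <= u <= s -> smooth_at f u) -> flat_at f p ->
  (forall n u, p < u < s -> Rabs (taylor_coef f n u) * r ^ n <= K) -> f s = 0.
Proof.
intros Hr Hps Hsr Hf Hp HK.
assert (Hn : forall n, Rabs (f s) <= K * (/ 2) ^ n).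
{ intros n; destruct n as [|n].
  - rewrite pow_O, Rmult_1_r.
    (* The bound by [K] is assumed only strictly between [p] and [s]; it reaches [s] by
       continuity. *)
    apply Rnot_lt_le; intros Hlt.
    assert (Hl : locally s (fun u => K < Rabs (f u))).
    { pose proof (smooth_at_continuous f s (Hf s ltac:(lra))) as C.
      apply (continuous_comp f Rabs) in C; [|apply continuous_Rabs].
      apply (C (fun y => K < y)), open_gt, Hlt. }
    destruct Hl as [d Hd]; pose proof (cond_pos d).
    pose proof (Rmin_l d (s - p)); pose proof (Rmin_r d (s - p)).
    assert (0 < Rmin d (s - p)) by (apply Rmin_pos; lra).
    assert (Hu : p < s - Rmin d (s - p) / 2 < s) by lra.
    specialize (HK 0%nat _ Hu); unfold taylor_coef in HK; simpl in HK.
    rewrite Rmult_1_r, Rdiv_1_r in HK; apply Rle_not_lt in HK; apply HK, Hd.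
    apply Rabs_def1; unfold minus, plus, opp; simpl; lra.
  - destruct (Taylor_Lagrange f n p s Hps) as [z [Hz E]].
    + intros t Ht k _; specialize (Hf t Ht); apply locally_singleton in Hf; auto.
    + rewrite sum_eq_R0 in E by (intros; rewrite Hp; ring); rewrite Rplus_0_l in E.
      specialize (HK (S n) z Hz); rewrite E.
      replace ((s - p) ^ S n / INR (fact (S n)) * Derive_n f (S n) z)
        with ((s - p) ^ S n * taylor_coef f (S n) z)
        by (unfold taylor_coef; field; apply not_0_INR, fact_neq_0).
      rewrite Rabs_mult, (Rabs_pos_eq ((s - p) ^ S n)) by (apply pow_le; lra).
      apply Rle_trans with ((r / 2) ^ S n * Rabs (taylor_coef f (S n) z)).
      * apply Rmult_le_compat_r; [apply Rabs_pos|apply pow_incr; lra].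
      * unfold Rdiv; rewrite Rpow_mult_distr.
        assert (0 < (/ 2) ^ S n) by (apply pow_lt; lra); nra. }
destruct (Req_dec (f s) 0) as [|E]; auto; exfalso.
assert (Ha : 0 < Rabs (f s)) by now apply Rabs_pos_lt.
assert (HKp : 0 < K) by (specialize (Hn 0%nat); simpl in Hn; lra).
destruct (pow_lt_1_zero (/ 2) ltac:(rewrite Rabs_pos_eq; lra) (Rabs (f s) / K)
  (Rdiv_lt_0_compat _ _ Ha HKp)) as [N HN].
specialize (HN N (le_n N)); specialize (Hn N).
rewrite Rabs_pos_eq in HN by (apply pow_le; lra).
apply (Rmult_lt_compat_l K) in HN; auto.
replace (K * (Rabs (f s) / K)) with (Rabs (f s)) in HN by (field; lra); lra.
Qed.

Lemma smooth_at_reflect (f : R -> R) (s : R) :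
  smooth_at f (- s) -> smooth_at (fun x => f (- x)) s.
Proof.
intros H; apply smooth_at_locally in H; destruct H as [d Hd].
exists d; intros u Hu n.
assert (Hu' : ball (- s) d (- u)).
{ revert Hu; unfold ball; simpl; unfold AbsRing_ball, abs, minus, plus, opp; simpl.
  intros Hu; replace (- u + - - s) with (- (u + - s)) by ring; now rewrite Rabs_Ropp. }
apply ex_derive_n_comp_opp.
generalize (Hd _ Hu' : locally _ _); apply filter_imp; auto.
Qed.

Lemma Derive_n_reflect (f : R -> R) (n : nat) (s : R) :
  smooth_at f (- s) -> Derive_n (fun x => f (- x)) n s = (-1) ^ n * Derive_n f n (- s).
Proof.
intros H; apply Derive_n_comp_opp.
unfold smooth_at in H; revert H; apply filter_imp; auto.
Qed.

Lemma flat_left (f : R -> R) (r K p s : R) : 0 < r -> s < p -> p - s < r / 2 ->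
  (forall u, s <= u <= p -> smooth_at f u) -> flat_at f p ->
  (forall n u, s < u < p -> Rabs (taylor_coef f n u) * r ^ n <= K) -> f s = 0.
Proof.
intros Hr Hps Hsr Hf Hp HK.
rewrite <- (Ropp_involutive s).
apply (flat_right (fun x => f (- x)) r K (- p) (- s)); auto; try lra.
- intros u Hu; apply smooth_at_reflect, Hf; lra.
- intros n; rewrite Derive_n_reflect; rewrite Ropp_involutive; [|apply Hf; lra].
  rewrite Hp; ring.
- intros n u Hu; unfold taylor_coef; rewrite Derive_n_reflect by (apply Hf; lra).
  unfold Rdiv; rewrite Rmult_assoc, Rabs_mult, pow_1_abs, Rmult_1_l.
  apply HK; lra.
Qed.

Lemma flat_at_locally_0 (f : R -> R) (s : R) :
  locally s (fun u => f u = 0) -> flat_at f s.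
Proof.
intros H n; rewrite (Derive_n_ext_loc f (fun _ => 0)) by auto.
destruct n as [|n]; [reflexivity|apply Derive_n_const].
Qed.

(** Flatness travels from [p] by steps shorter than [r / 2]. The point [p] may be [a] or [b], where
    no Taylor bound is assumed. *)
Lemma flat_propagates (f : R -> R) (a b r K p : R) : 0 < r -> a <= p <= b ->
  (forall u, a <= u <= b -> smooth_at f u) ->
  (forall n u, a < u < b -> Rabs (taylor_coef f n u) * r ^ n <= K) ->
  flat_at f p -> forall s, a < s < b -> f s = 0.
Proof.
intros Hr Hp Hf HK Hflat.
assert (Hstep : forall q, a <= q <= b -> flat_at f q ->
  forall s, a < s < b -> Rabs (s - q) < r / 2 -> flat_at f s).
{ assert (H0 : forall q, a <= q <= b -> flat_at f q ->
    forall s, a < s < b -> Rabs (s - q) < r / 2 -> f s = 0).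
  { intros q Hq Hqf s Hs Hsq; apply Rabs_def2 in Hsq.
    destruct (Rtotal_order s q) as [Hlt|[->|Hlt]].
    - apply (flat_left f r K q s); auto; try lra; intros; [apply Hf|apply HK]; lra.
    - apply (Hqf 0%nat).
    - apply (flat_right f r K q s); auto; try lra; intros; [apply Hf|apply HK]; lra. }
  (* Being within [r / 2] of [q] is an open condition, so [f] vanishes on a neighbourhood of [s],
     hence with all its derivatives. *)
  intros q Hq Hqf s Hs Hsq; apply flat_at_locally_0.
  apply Rabs_def2 in Hsq.
  assert (Hl : locally s (fun u => q - r / 2 < u < q + r / 2)) by (apply locally_between; lra).
  generalize (filter_and _ _ (locally_between a b s Hs) Hl); apply filter_imp.
  intros u [Hu Hu']; apply (H0 q); auto; apply Rabs_def1; lra. }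
assert (Hn : forall N s, a < s < b -> Rabs (s - p) < INR (S N) * (r / 4) -> flat_at f s).
{ induction N as [|N IH]; intros s Hs Hsp.
  - apply (Hstep p); auto; simpl in Hsp; lra.
  (* The intermediate point [q] at fraction [th] of the way from [p] to [s] is closer to [p] than
     [(N + 1/2) r / 4], within reach of the induction hypothesis, and closer to [s] than [3 r / 8],
     within one step. *)
  - set (th := (INR N + / 2) / (INR N + 2)).
    pose proof (pos_INR N) as HN; rewrite !S_INR in *.
    assert (Hth : 0 < th < 1).
    { unfold th; split; [apply Rdiv_lt_0_compat; lra|].
      apply (Rmult_lt_reg_r (INR N + 2)); [lra|]; unfold Rdiv.
      rewrite Rmult_assoc, Rinv_l; lra. }
    set (q := p + th * (s - p)).
    assert (Hq : a < q < b) by (unfold q; nra).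
    apply (Hstep q); auto; [lra| |].
    + apply IH; auto; unfold q; replace (p + th * (s - p) - p) with (th * (s - p)) by ring.
      rewrite Rabs_mult, (Rabs_pos_eq th) by lra.
      apply (Rmult_lt_compat_l th) in Hsp; [|lra].
      replace (th * ((INR N + 1 + 1) * (r / 4))) with ((INR N + / 2) * (r / 4)) in Hsp
        by (unfold th; field; lra).
      nra.
    + unfold q; replace (s - (p + th * (s - p))) with ((1 - th) * (s - p)) by ring.
      rewrite Rabs_mult, (Rabs_pos_eq (1 - th)) by lra.
      apply (Rmult_lt_compat_l (1 - th)) in Hsp; [|lra].
      replace ((1 - th) * ((INR N + 1 + 1) * (r / 4))) with (3 * r / 8) in Hsp
        by (unfold th; field; lra).
      lra. }
intros s Hs; destruct (INR_unbounded (Rabs (s - p) / (r / 4))) as [N HN].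
apply (Hn N s Hs) with (n := 0%nat).
apply Rgt_lt, (Rmult_lt_compat_r (r / 4)) in HN; [|lra].
replace (Rabs (s - p) / (r / 4) * (r / 4)) with (Rabs (s - p)) in HN by (field; lra).
rewrite S_INR; nra.
Qed.

Lemma gen_by_pow (Y : list (R -> R)) (f : R -> R) (n : nat) :
  gen_by Y f -> gen_by Y (fun x => f x ^ n).
Proof.
intros H; induction n as [|n IH]; simpl; [apply by_const|now apply by_mult].
Qed.

Ltac poly :=
  match goal with
  | |- gen_by _ (fun x => ?c) => exact (by_const _ c)
  | |- gen_by _ (fun x => @?f x + @?h x) => apply (by_plus _ f h); poly
  | |- gen_by _ (fun x => @?f x * @?h x) => apply (by_mult _ f h); poly
  | |- gen_by _ (fun x => (@?f x) ^ ?n) => apply (gen_by_pow _ f n); poly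
  | |- gen_by _ _ => apply by_var; simpl; tauto
  end.

Lemma smooth_bounded (y : R -> R) (a b : R) : a < b ->
  (forall u, a <= u <= b -> smooth_at y u) ->
  exists M, forall u, a < u < b -> Rabs (y u) <= M.
Proof.
intros Hab Hy.
assert (Hc : forall u, a <= u <= b -> continuity_pt (fun x => Rabs (y x)) u).
{ intros u Hu; apply continuity_pt_filterlim.
  apply (continuous_comp y Rabs); [now apply smooth_at_continuous, Hy|apply continuous_Rabs]. }
destruct (continuity_ab_maj (fun x => Rabs (y x)) a b (Rlt_le _ _ Hab) Hc) as [m [Hm _]].
exists (Rabs (y m)); intros u Hu; apply Hm; lra.
Qed.

(** * Spherical arcs *)

Section Spherical.

Variables (mu L : R) (g : R -> vec).
Hypothesis hf : frenet_curve L g.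
Hypothesis harc : arclength L g.

Local Notation k := (curvature g).
Local Notation l := (mtorsion g).
Local Notation l1 := (Derive (mtorsion g)).
Local Notation l2 := (Derive (Derive (mtorsion g))).

(** The only coordinate of a spherical arc in its frame not determined by the curvature: the others
    are 0 and [- 1 / k]. *)
Definition binormal_height (s : R) : R := dot (g s) (frameB g s).
Local Notation h := binormal_height.

(* Adjoined to the differential system so that division by the leading coefficient
   [2 + 6 l^2] of the equation keeps it polynomial. *)
Definition aux_inv (s : R) : R := / (1 + 3 * l s ^ 2).

Lemma binormal_height_smooth (s : R) : 0 <= s <= L -> smooth_at h s.
Proof.
intros Hs; apply smooth_at_dot; [now apply (frenet_smooth L)|now apply (frameB_smooth L)].
Qed.

Lemma aux_inv_smooth (s : R) : 0 <= s <= L -> smooth_at aux_inv s.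
Proof.
intros Hs; pose proof (mtorsion_smooth L g hf s Hs) as Hl.
assert (1 + 3 * l s ^ 2 <> 0) by nra.
unfold aux_inv; smt.
Qed.

Variables (a b : R).
Hypothesis hab : 0 < a < b /\ b < L.
Hypothesis hsph : forall s, a < s < b -> dot (g s) (frameT g s) = 0.

Lemma arc_in (s : R) : a < s < b -> 0 < s < L.
Proof. lra. Qed.

(** Obtained by differentiating [<g, T> = 0]. *)
Lemma spherical_normal (s : R) : a < s < b -> k s * dot (g s) (frameN g s) = - 1.
Proof.
intros Hs; pose proof (arc_in s Hs) as Hs'.
pose proof (is_derive_dot _ _ _ _ _ (is_vderive_curve L g hf harc s Hs')
  (vsmooth_at_derive _ _ (frameT_smooth L g hf s (in_closed L s Hs')))) as D.
pose proof (is_derive_constant_between _ a b 0 _ s Hs hsph D) as E.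
rewrite (frenet_T L g hf harc s Hs') in E.
rewrite (dot_TT L g harc s (in_closed L s Hs')) in E.
replace (dot (g s) (vscal (k s) (frameN g s))) with (k s * dot (g s) (frameN g s)) in E
  by (unfold dot, vscal, cx, cy, cz; simpl; ring).
lra.
Qed.

Lemma is_derive_binormal_height (s : R) : a < s < b -> is_derive h s (l s).
Proof.
intros Hs; pose proof (arc_in s Hs) as Hs'.
pose proof (is_derive_dot _ _ _ _ _ (is_vderive_curve L g hf harc s Hs')
  (vsmooth_at_derive _ _ (frameB_smooth L g hf s (in_closed L s Hs')))) as D.
apply (is_derive_eq _ _ _ _ D); rewrite (frenet_B L g hf harc s Hs').
pose proof (spherical_normal s Hs) as E; unfold frameB.
transitivity (- l s * (k s * dot (g s) (frameN g s))); [|rewrite E; ring].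
generalize (g s) (frameT g s) (frameN g s); intros v T N; vcomp; ring.
Qed.

(** Differentiating [k <g, N> = - 1] gives [- k' / k + l k^2 h = 0]. It removes all derivatives of
    [k] from the force vector. *)
Lemma is_derive_curvature_spherical (s : R) : a < s < b ->
  is_derive k s (l s * k s ^ 3 * h s).
Proof.
intros Hs; pose proof (arc_in s Hs) as Hs'.
destruct (curvature_data L g hf s Hs') as (Hk0&Hk&_).
apply (is_derive_eq _ _ _ _ Hk).
pose proof (is_derive_dot _ _ _ _ _ (is_vderive_curve L g hf harc s Hs')
  (vsmooth_at_derive _ _ (frameN_smooth L g hf s (in_closed L s Hs')))) as D.
rewrite (frenet_N L g hf harc s Hs') in D.
pose proof (is_derive_Rmult _ _ _ _ _ Hk D) as D2.
pose proof (is_derive_constant_between _ a b (-1) _ s Hs spherical_normal D2) as E.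
rewrite (dot_TN L g hf harc s Hs') in E.
replace (dot (g s) (vadd (vscal (- k s) (frameT g s)) (vscal (l s * k s) (frameB g s))))
  with (- k s * dot (g s) (frameT g s) + l s * k s * h s) in E
  by (unfold h, dot, vadd, vscal, cx, cy, cz; simpl; ring).
rewrite (hsph s Hs) in E.
pose proof (spherical_normal s Hs) as En.
assert (Ek : dot (g s) (frameN g s) = - / k s).
{ apply (Rmult_eq_reg_l (k s)); auto; rewrite En; field; auto. }
rewrite Ek in E; apply (Rmult_eq_reg_l (- / k s)).
- apply (Rplus_eq_reg_r (k s * (l s * k s * h s))).
  transitivity 0; [lra|field; auto].
- apply Ropp_neq_0_compat, Rinv_neq_0_compat, Hk0.
Qed.

Lemma mtorsion_data (s : R) : a < s < b ->
  k s <> 0 /\ is_derive l s (l1 s) /\ is_derive l1 s (l2 s) /\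
  is_derive l2 s (Derive l2 s).
Proof.
intros Hs; pose proof (arc_in s Hs) as Hs'.
destruct (curvature_data L g hf s Hs') as (Hk0&_&Hl&_&Hl1); split; [|split; [|split]]; auto.
exact (smooth_at_derive _ _ (smooth_at_Derive _ _ (smooth_at_Derive _ _
  (mtorsion_smooth L g hf s (in_closed L s Hs'))))).
Qed.

Lemma force2_spherical (s : R) : a < s < b ->
  force2 g s = k s ^ 3 * h s * l s * (1 + l s ^ 2) ^ 2
    + 2 * k s * (1 + l s ^ 2) * l s * l1 s.
Proof.
intros Hs; unfold force2.
rewrite (is_derive_unique _ _ _ (is_derive_curvature_spherical s Hs)); ring.
Qed.

Lemma force3_spherical (s : R) : a < s < b ->
  force3 g s = - (k s ^ 2 * (1 + l s ^ 2) ^ 2 * l s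
    + (4 * k s ^ 4 * h s ^ 2 * l s ^ 3 * (1 + l s ^ 2)
       + 2 * k s ^ 2 * l s ^ 3 * (1 + l s ^ 2)
       + 2 * k s ^ 2 * h s * (2 * l s + 4 * l s ^ 3) * l1 s)
    + ((2 + 6 * l s ^ 2) * l2 s + 12 * l s * l1 s ^ 2)).
Proof.
intros Hs; unfold force3; do 2 f_equal; [f_equal|].
(* Since [k' / k = l k^2 h], no division by [k] survives and the expression is polynomial. *)
- rewrite (Derive_ext_loc _ (fun u => 2 * k u ^ 2 * h u * l u ^ 2 * (1 + l u ^ 2))).
  + destruct (mtorsion_data s Hs) as (Hk0&Hl&_).
    pose proof (is_derive_curvature_spherical s Hs) as Hk.
    pose proof (is_derive_binormal_height s Hs) as Hh.
    apply is_derive_unique; eapply is_derive_eq; [der|simpl; ring].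
  + generalize (locally_between a b s Hs); apply filter_imp; intros u Hu.
    rewrite (is_derive_unique _ _ _ (is_derive_curvature_spherical u Hu)).
    destruct (mtorsion_data u Hu) as (Hk0&_); field; auto.
- change (Derive_n (fun u => (1 + l u ^ 2) * (2 * l u)) 2 s) with
    (Derive (Derive (fun u => (1 + l u ^ 2) * (2 * l u))) s).
  rewrite (Derive_ext_loc _ (fun u => (2 + 6 * l u ^ 2) * l1 u)).
  + destruct (mtorsion_data s Hs) as (Hk0&Hl&Hl1&_).
    apply is_derive_unique; eapply is_derive_eq; [der|simpl; ring].
  + generalize (locally_between a b s Hs); apply filter_imp; intros u Hu.
    destruct (mtorsion_data u Hu) as (Hk0&Hl&_).
    apply is_derive_unique; eapply is_derive_eq; [der|simpl; ring].
Qed.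

(** Involves no derivative of [l] beyond the second, so it is a polynomial in the unknowns of the
    system. *)
Definition dforce2_poly (s : R) : R :=
  k s * (/ 2 * (k s ^ 2 * (1 + l s ^ 2) ^ 2 + mu))
  + (3 * l s ^ 2 * h s ^ 2 * k s ^ 5 * (1 + l s ^ 2) ^ 2
     + k s ^ 3 * l s ^ 2 * (1 + l s ^ 2) ^ 2
     + k s ^ 3 * h s * l1 s * (1 + l s ^ 2) ^ 2
     + 4 * k s ^ 3 * h s * l s ^ 2 * (1 + l s ^ 2) * l1 s
     + 2 * l s ^ 2 * k s ^ 3 * h s * (1 + l s ^ 2) * l1 s
     + 4 * k s * l s ^ 2 * l1 s ^ 2
     + 2 * k s * (1 + l s ^ 2) * (l1 s ^ 2 + l s * l2 s))
  + l s * k s * (k s ^ 2 * (1 + l s ^ 2) ^ 2 * l s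
    + (4 * k s ^ 4 * h s ^ 2 * l s ^ 3 * (1 + l s ^ 2)
       + 2 * k s ^ 2 * l s ^ 3 * (1 + l s ^ 2)
       + 2 * k s ^ 2 * h s * (2 * l s + 4 * l s ^ 3) * l1 s)
    + ((2 + 6 * l s ^ 2) * l2 s + 12 * l s * l1 s ^ 2)).

Lemma dforce2_spherical (s : R) : a < s < b -> dforce2 mu g s = dforce2_poly s.
Proof.
intros Hs; unfold dforce2, force1.
rewrite (Derive_ext_loc _ (fun u => k u ^ 3 * h u * l u * (1 + l u ^ 2) ^ 2
    + 2 * k u * (1 + l u ^ 2) * l u * l1 u)).
- destruct (mtorsion_data s Hs) as (Hk0&Hl&Hl1&_).
  pose proof (is_derive_curvature_spherical s Hs) as Hk.
  pose proof (is_derive_binormal_height s Hs) as Hh.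
  rewrite (force3_spherical s Hs).
  erewrite is_derive_unique by der.
  unfold dforce2_poly; simpl; field.
- generalize (locally_between a b s Hs); apply filter_imp; intros u Hu.
  now apply force2_spherical.
Qed.

(* The derivative of [- force3] with the term containing the third derivative of
   the modified torsion left out. *)
Definition dforce3_rest (s : R) : R :=
  2 * k s ^ 4 * l s ^ 2 * h s * (1 + l s ^ 2) ^ 2
  + 4 * k s ^ 2 * l s ^ 2 * (1 + l s ^ 2) * l1 s + k s ^ 2 * (1 + l s ^ 2) ^ 2 * l1 s
  + (16 * k s ^ 6 * h s ^ 3 * l s ^ 4 * (1 + l s ^ 2)
     + 8 * k s ^ 4 * h s * l s ^ 4 * (1 + l s ^ 2)
     + 4 * k s ^ 4 * h s ^ 2 * (3 * l s ^ 2 + 5 * l s ^ 4) * l1 s)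
  + (4 * k s ^ 4 * h s * l s ^ 4 * (1 + l s ^ 2)
     + 2 * k s ^ 2 * (3 * l s ^ 2 + 5 * l s ^ 4) * l1 s)
  + (4 * k s ^ 4 * l s * h s ^ 2 * (2 * l s + 4 * l s ^ 3) * l1 s
     + 2 * k s ^ 2 * l s * (2 * l s + 4 * l s ^ 3) * l1 s
     + 2 * k s ^ 2 * h s * (2 + 12 * l s ^ 2) * l1 s ^ 2
     + 2 * k s ^ 2 * h s * (2 * l s + 4 * l s ^ 3) * l2 s)
  + (12 * l s * l1 s * l2 s + 12 * l1 s ^ 3 + 24 * l s * l1 s * l2 s).

Lemma Derive_force3_spherical (s : R) : a < s < b ->
  Derive (force3 g) s = - (dforce3_rest s + (2 + 6 * l s ^ 2) * Derive l2 s).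
Proof.
intros Hs.
rewrite (Derive_ext_loc _ (fun s => - (k s ^ 2 * (1 + l s ^ 2) ^ 2 * l s
    + (4 * k s ^ 4 * h s ^ 2 * l s ^ 3 * (1 + l s ^ 2)
       + 2 * k s ^ 2 * l s ^ 3 * (1 + l s ^ 2)
       + 2 * k s ^ 2 * h s * (2 * l s + 4 * l s ^ 3) * l1 s)
    + ((2 + 6 * l s ^ 2) * l2 s + 12 * l s * l1 s ^ 2)))).
- destruct (mtorsion_data s Hs) as (Hk0&Hl&Hl1&Hl2).
  pose proof (is_derive_curvature_spherical s Hs) as Hk.
  pose proof (is_derive_binormal_height s Hs) as Hh.
  apply is_derive_unique; eapply is_derive_eq; [der|unfold dforce3_rest; simpl; ring].
- generalize (locally_between a b s Hs); apply filter_imp; intros u Hu.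
  now apply force3_spherical.
Qed.

Hypothesis hcross : forall s, a < s < b ->
  cross (g s) (frame_vec g s 0 (dforce2 mu g s) (dforce3 g s)) = null_vec.

(** The tangential component of [g x b0' = 0] is [<g, N> e3 = h e2], and [<g, N> = - 1 / k]. So on a
    spherical arc it is enough to control [e2]. *)
Lemma dforce3_eq (s : R) : a < s < b -> dforce3 g s = - k s * h s * dforce2 mu g s.
Proof.
intros Hs; pose proof (arc_in s Hs) as Hs'; pose proof (hcross s Hs) as E.
rewrite (frame_vec_expand L g hf harc s (g s) Hs'), (cross_frame_vec L g hf harc) in E by auto.
apply (f_equal (fun v => dot v (frame_vec g s 1 0 0))) in E.
rewrite (dot_frame_vec L g hf harc) in E by auto.
rewrite (dot_sym null_vec), dot_null_r in E; fold (h s) in E.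
pose proof (spherical_normal s Hs) as En.
apply (f_equal (Rmult (k s))) in E.
transitivity (- (k s * dot (g s) (frameN g s)) * dforce3 g s); [rewrite En; ring|].
lra.
Qed.

(** The preceding relation solved for [l'''], which occurs only through [force3'], with coefficient
    [- (2 + 6 l^2)]; [aux_inv / 2] is the inverse of [2 + 6 l^2]. *)
Lemma is_derive_l2_spherical (s : R) : a < s < b ->
  is_derive l2 s (/ 2 * aux_inv s * (l s * k s * (k s ^ 3 * h s * l s * (1 + l s ^ 2) ^ 2
    + 2 * k s * (1 + l s ^ 2) * l s * l1 s)
    + (-1) * dforce3_rest s + k s * h s * dforce2_poly s)).
Proof.
intros Hs; destruct (mtorsion_data s Hs) as (Hk0&_&_&Hl2).
apply (is_derive_eq _ _ _ _ Hl2).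
pose proof (dforce3_eq s Hs) as E; unfold dforce3 in E.
rewrite (Derive_force3_spherical s Hs), (force2_spherical s Hs), (dforce2_spherical s Hs) in E.
assert (H : 1 + 3 * l s ^ 2 <> 0) by nra.
unfold aux_inv; apply (Rmult_eq_reg_l (2 + 6 * l s ^ 2)); [|nra].
transitivity (l s * k s * (k s ^ 3 * h s * l s * (1 + l s ^ 2) ^ 2
    + 2 * k s * (1 + l s ^ 2) * l s * l1 s)
    + (-1) * dforce3_rest s + k s * h s * dforce2_poly s); [lra|field; auto].
Qed.

Lemma dforce2_analytic : exists r K, 0 < r /\
  forall n s, a < s < b -> Rabs (taylor_coef (dforce2 mu g) n s) * r ^ n <= K.
Proof.
(* A closed polynomial system: [l'''] supplies the derivative of [l2], and
   [aux_inv' = - 6 l l' aux_inv^2]. *)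
set (Y := (k :: h :: l :: l1 :: l2 :: aux_inv :: nil)%list).
assert (HY : forall y s, In y Y -> 0 <= s <= L -> smooth_at y s).
{ intros y s Hy Hs; pose proof (mtorsion_smooth L g hf s Hs) as Hl.
  simpl in Hy; decompose [or] Hy; subst; try tauto; auto.
  - now apply (curvature_smooth L).
  - now apply binormal_height_smooth.
  - now apply smooth_at_Derive.
  - now apply smooth_at_Derive, smooth_at_Derive.
  - now apply aux_inv_smooth. }
destruct (list_uniform Y (fun y M => forall s, a < s < b -> Rabs (y s) <= M))
  as [M [HM HMY]].
{ intros y M M' H HMM s Hs; apply Rle_trans with M; auto. }
(* The bounds exist because all unknowns are smooth on the closed arc, which lies inside
   [(0, L)]. *)
{ intros y Hy; apply smooth_bounded; [lra|]; intros u Hu; apply HY; auto; lra. }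
destruct (polynomial_system_analytic a b Y) with (M := M) (f := dforce2_poly)
  as [r [K [Hr HK]]].
- intros y s Hy Hs; apply HY; auto; lra.
- intros y Hy; simpl in Hy; decompose [or] Hy; subst; try tauto.
  + exists (fun s => l s * k s ^ 3 * h s); split; [poly|exact is_derive_curvature_spherical].
  + exists l; split; [poly|exact is_derive_binormal_height].
  + exists l1; split; [poly|intros s Hs; apply (mtorsion_data s Hs)].
  + exists l2; split; [poly|intros s Hs; apply (mtorsion_data s Hs)].
  + eexists; split; [|exact is_derive_l2_spherical].
    unfold dforce3_rest, dforce2_poly; poly.
  + exists (fun s => (-6) * l s * l1 s * aux_inv s ^ 2); split; [poly|].
    intros s Hs; destruct (mtorsion_data s Hs) as (_&Hl&_).
    assert (1 + 3 * l s ^ 2 <> 0) by nra.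
    unfold aux_inv; eapply is_derive_eq; [der|simpl; field; nra].
- exact HM.
- intros y s Hy Hs; now apply HMY.
- unfold dforce2_poly; poly.
- exists r, K; split; auto; intros n s Hs.
  rewrite (taylor_coef_ext _ dforce2_poly); auto.
  generalize (locally_between a b s Hs); apply filter_imp; intros u Hu.
  now apply dforce2_spherical.
Qed.

End Spherical.

(** * Maximal intervals on which a function vanishes *)

Lemma zero_interval_right (f : R -> R) (s0 s1 d0 : R) : s0 < s1 -> 0 < d0 ->
  (forall u, s0 <= u <= s1 -> continuous f u) ->
  (forall u, s0 <= u <= s1 -> u < s0 + d0 -> f u = 0) -> f s1 <> 0 ->
  exists b, s0 < b < s1 /\ (forall u, s0 <= u <= b -> f u = 0) /\
    forall d, 0 < d -> exists x, b < x < b + d /\ x <= s1 /\ f x <> 0.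
Proof.
intros Hs Hd0 Hc H0 H1.
(* [b] is the supremum of [E]. If [f] vanished on some interval to the right of [b], a larger
   element of [E] would exist. *)
set (E := fun t => s0 <= t <= s1 /\ forall u, s0 <= u <= t -> f u = 0).
destruct (completeness E) as [b [Hub Hlub]].
- exists s1; intros t [Ht _]; lra.
- exists s0; split; [lra|]; intros u Hu; apply H0; lra.
- pose proof (Rmin_l (d0 / 2) (s1 - s0)); pose proof (Rmin_r (d0 / 2) (s1 - s0)).
  assert (0 < Rmin (d0 / 2) (s1 - s0)) by (apply Rmin_pos; lra).
  assert (Hb0 : s0 + Rmin (d0 / 2) (s1 - s0) <= b).
  { apply Hub; split; [lra|]; intros u Hu; apply H0; lra. }
  assert (Hb1 : b <= s1) by (apply Hlub; intros t [Ht _]; lra).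
  assert (Hz : forall u, s0 < u < b -> f u = 0).
  { intros u Hu; destruct (classic (exists t, E t /\ u < t)) as [[t [[_ Ht] Hut]]|Hn].
    - apply Ht; lra.
    - exfalso; enough (b <= u) by lra; apply Hlub; intros t Ht.
      apply Rnot_lt_le; intros Hut; apply Hn; now exists t. }
  assert (Hz' : forall u, s0 <= u <= b -> f u = 0).
  { intros u Hu; apply (continuous_eq_closure f 0 s0 b u); auto; [lra|apply Hc; lra]. }
  assert (Hb2 : b < s1).
  { destruct Hb1 as [|E1]; auto; exfalso; apply H1; rewrite <- E1; apply Hz'; lra. }
  exists b; split; [lra|]; split; auto; intros d Hd.
  apply NNPP; intros Hn.
  pose proof (Rmin_l (d / 2) (s1 - b)); pose proof (Rmin_r (d / 2) (s1 - b)).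
  assert (0 < Rmin (d / 2) (s1 - b)) by (apply Rmin_pos; lra).
  enough (b + Rmin (d / 2) (s1 - b) <= b) by lra.
  apply Hub; split; [lra|]; intros u Hu.
  destruct (Rle_lt_dec u b) as [Hub'|Hub']; [apply Hz'; lra|].
  apply NNPP; intros Hfu; apply Hn; exists u; repeat split; auto; lra.
Qed.

Lemma zero_interval_left (f : R -> R) (s0 s1 d0 : R) : s1 < s0 -> 0 < d0 ->
  (forall u, s1 <= u <= s0 -> continuous f u) ->
  (forall u, s1 <= u <= s0 -> s0 - d0 < u -> f u = 0) -> f s1 <> 0 ->
  exists b, s1 < b < s0 /\ (forall u, b <= u <= s0 -> f u = 0) /\
    forall d, 0 < d -> exists x, b - d < x < b /\ s1 <= x /\ f x <> 0.
Proof.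
intros Hs Hd0 Hc H0 H1.
destruct (zero_interval_right (fun x => f (- x)) (- s0) (- s1) d0) as [b [Hb [Hz Hd]]];
  auto; try lra.
- intros u Hu; apply (continuous_comp Ropp f); [|apply Hc; lra].
  apply (continuous_opp (fun x : R => x)), continuous_id.
- intros u Hu Hu'; apply H0; lra.
- now rewrite Ropp_involutive.
- exists (- b); split; [lra|split].
  + intros u Hu; rewrite <- (Ropp_involutive u); apply Hz; lra.
  + intros d Hd1; destruct (Hd d Hd1) as [x [Hx [Hx' Hf]]]; exists (- x).
    repeat split; auto; lra.
Qed.

(** Each derivative is continuous at [p] and vanishes at points arbitrarily close to it. *)
Lemma flat_at_limit (f : R -> R) (p : R) : smooth_at f p ->
  (forall d, 0 < d -> exists x, Rabs (x - p) < d /\ flat_at f x) -> flat_at f p.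
Proof.
intros Hf H n; apply NNPP; intros Hn.
pose proof (smooth_at_continuous _ _ (smooth_at_Derive_n f n p Hf)) as C.
destruct (C (fun y => y <> 0) (open_neq 0 _ Hn)) as [d Hd].
destruct (H d (cond_pos d)) as [x [Hx Hfx]].
now apply (Hd x Hx).
Qed.

Lemma vector_constant (L : R) (f : R -> vec) : 0 < L ->
  (forall s, 0 <= s <= L -> vsmooth_at f s) ->
  (forall s, 0 < s < L -> vderive f s = null_vec) ->
  forall s, 0 <= s <= L -> f s = f (L / 2).
Proof.
intros HL Hf Hd s Hs.
apply (is_vderive_eq_closure f (f (L / 2)) (vderive f s) 0 L s); auto.
- now apply vsmooth_at_derive, Hf.
- clear s Hs; intros s Hs.
  assert (E : forall c : vec -> R, (forall u, 0 < u < L -> is_derive (fun z => c (f z)) u 0) ->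
    c (f s) = c (f (L / 2))).
  { intros c Hc.
    destruct (Rtotal_order s (L / 2)) as [H|[->|H]]; auto.
    - apply (eq_is_derive (fun z => c (f z)) s (L / 2)); auto; intros; apply Hc; lra.
    - symmetry; apply (eq_is_derive (fun z => c (f z)) (L / 2) s); auto; intros; apply Hc; lra. }
  assert (D : forall u, 0 < u < L -> is_vderive f u null_vec).
  { intros u Hu; rewrite <- (Hd u Hu); apply vsmooth_at_derive, Hf; lra. }
  apply vec_ext; apply E; intros u Hu; apply (D u Hu).
Qed.

(** * Curves with constant force or constant torque *)

Section Torque.

Variables (mu L : R) (g : R -> vec).
Hypothesis hL : 0 < L.
Hypothesis hf : frenet_curve L g.
Hypothesis harc : arclength L g.

Lemma torque_constant_of_force_constant :
  (forall s, 0 < s < L -> vderive (force_vector mu g) s = null_vec) ->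
  constant_on L (torque_vector mu g).
Proof.
intros H; exists (torque_vector mu g (L / 2)); apply vector_constant; auto.
- intros s Hs; now apply (torque_vector_smooth mu L).
- intros s Hs; rewrite (is_vderive_unique _ _ _ (is_vderive_torque mu L g hf harc s Hs)).
  rewrite <- (is_vderive_unique _ _ _ (is_vderive_force mu L g hf harc s Hs)), (H s Hs).
  generalize (g s); intros v; unfold null_vec; apply vec_ext; vcomp; ring.
Qed.

Hypothesis htorque : constant_on L (torque_vector mu g).

Local Notation e2 := (dforce2 mu g).
Local Notation e3 := (dforce3 g).

Lemma cross_force_null (s : R) : 0 < s < L ->
  cross (g s) (frame_vec g s 0 (e2 s) (e3 s)) = null_vec.
Proof.
intros Hs; destruct htorque as [c Hc].
pose proof (is_vderive_torque mu L g hf harc s Hs) as D.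
apply (is_vderive_ext_loc _ (fun _ => c)) in D.
- apply is_vderive_unique in D; rewrite vderive_const in D.
  revert D; generalize (cross (g s) (frame_vec g s 0 (e2 s) (e3 s))); intros v D.
  transitivity (vscal (-1) (vscal (-1) v)).
  + apply vec_ext; vcomp; ring.
  + rewrite <- D; unfold null_vec; apply vec_ext; vcomp; ring.
- generalize (locally_between 0 L s Hs); apply filter_imp; intros u Hu; apply Hc; lra.
Qed.

(** The normal and binormal components of [g x b0'] are [- <g, T> e3] and [<g, T> e2]. *)
Lemma force_alternative (s : R) : 0 < s < L ->
  dot (g s) (frameT g s) <> 0 -> e2 s = 0 /\ e3 s = 0.
Proof.
intros Hs Hn; pose proof (cross_force_null s Hs) as E.
rewrite (frame_vec_expand L g hf harc s (g s) Hs), (cross_frame_vec L g hf harc) in E by auto.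
pose proof (f_equal (fun v => dot v (frame_vec g s 0 1 0)) E) as E1.
pose proof (f_equal (fun v => dot v (frame_vec g s 0 0 1)) E) as E2.
cbv beta in E1, E2; rewrite (dot_frame_vec L g hf harc), (dot_sym null_vec), dot_null_r in E1, E2 by auto.
split; apply (Rmult_eq_reg_l (dot (g s) (frameT g s))); auto; lra.
Qed.

Lemma dforce_smooth (s : R) : 0 <= s <= L -> smooth_at e2 s /\ smooth_at e3 s.
Proof.
intros Hs; destruct (force_smooth mu L g hf s Hs) as (H1&H2&H3).
pose proof (curvature_smooth L g hf s Hs); pose proof (mtorsion_smooth L g hf s Hs).
split; unfold dforce2, dforce3; smt.
Qed.

Lemma height_smooth (s : R) : 0 <= s <= L -> smooth_at (fun u => dot (g u) (frameT g u)) s.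
Proof.
intros Hs; apply smooth_at_dot; [now apply (frenet_smooth L)|now apply (frameT_smooth L)].
Qed.

Lemma force_nonzero_locally (s : R) : 0 < s < L -> e2 s <> 0 \/ e3 s <> 0 ->
  locally s (fun u => dot (g u) (frameT g u) = 0).
Proof.
intros Hs He; destruct (dforce_smooth s (in_closed L s Hs)) as [H2 H3].
assert (Hl : locally s (fun u => e2 u <> 0 \/ e3 u <> 0)).
{ destruct He as [He|He].
  - apply (filter_imp (fun u => e2 u <> 0)); [tauto|].
    apply (smooth_at_continuous _ _ H2 (fun y => y <> 0)), open_neq, He.
  - apply (filter_imp (fun u => e3 u <> 0)); [tauto|].
    apply (smooth_at_continuous _ _ H3 (fun y => y <> 0)), open_neq, He. }
generalize (filter_and _ _ (locally_between 0 L s Hs) Hl); apply filter_imp.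
intros u [Hu He']; apply NNPP; intros Hn.
destruct (force_alternative u Hu Hn); tauto.
Qed.

Lemma flat_off_sphere (s : R) : 0 < s < L -> dot (g s) (frameT g s) <> 0 -> flat_at e2 s.
Proof.
intros Hs Hn; apply flat_at_locally_0.
pose proof (smooth_at_continuous _ _ (height_smooth s (in_closed L s Hs))) as C.
assert (Hl : locally s (fun u => dot (g u) (frameT g u) <> 0))
  by (apply (C (fun y => y <> 0)), open_neq, Hn).
generalize (filter_and _ _ (locally_between 0 L s Hs) Hl); apply filter_imp.
intros u [Hu Hnu]; now apply force_alternative.
Qed.

(** Stated on the closed arc so that both the flat point and the point of interest may be end
    points. *)
Lemma dforce2_null_on_arc (a b p s : R) : 0 < a < b /\ b < L -> a <= p <= b ->
  (forall u, a < u < b -> dot (g u) (frameT g u) = 0) -> flat_at e2 p ->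
  a <= s <= b -> e2 s = 0.
Proof.
intros Hab Hp Hsph Hflat Hs.
destruct (dforce2_analytic mu L g hf harc a b Hab Hsph) as [r [K [Hr HK]]].
{ intros u Hu; apply cross_force_null; lra. }
apply (continuous_eq_closure e2 0 a b s); auto; [lra| |].
- apply smooth_at_continuous, dforce_smooth; lra.
- apply (flat_propagates e2 a b r K p); auto.
  intros u Hu; apply dforce_smooth; lra.
Qed.

Lemma spherical_of_force_nonconstant (s0 : R) : 0 < s0 < L ->
  e2 s0 <> 0 \/ e3 s0 <> 0 ->
  forall s, 0 < s < L -> dot (g s) (frameT g s) = 0.
Proof.
intros Hs0 He s1 Hs1; apply NNPP; intros Hn.
destruct (force_nonzero_locally s0 Hs0 He) as [d Hd]; pose proof (cond_pos d) as Hd0.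
assert (Hz : forall u, s0 - d < u < s0 + d -> dot (g u) (frameT g u) = 0).
{ intros u Hu; apply Hd, Rabs_def1; unfold minus, plus, opp; simpl; lra. }
assert (Hc : forall u, 0 < u < L -> continuous (fun u => dot (g u) (frameT g u)) u).
{ intros u Hu; apply smooth_at_continuous, height_smooth; lra. }
assert (E2 : e2 s0 = 0).
{ destruct (Rtotal_order s0 s1) as [H|[->|H]].
  (* Only the half of the arc running from [s0] towards [s1] is used. Its far end [b] is a limit of
     points off the sphere, where [e2] is flat. *)
  - destruct (zero_interval_right (fun u => dot (g u) (frameT g u)) s0 s1 d)
      as [b [Hb [Hzb Hlim]]]; auto.
    { intros u Hu; apply Hc; lra. }
    { intros u Hu Hu'; apply Hz; lra. }
    apply (dforce2_null_on_arc s0 b b); try lra; [intros u Hu; apply Hzb; lra|].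
    apply flat_at_limit; [apply dforce_smooth; lra|].
    intros e He'; destruct (Hlim e He') as [x [Hx [Hx1 Hx2]]]; exists x.
    split; [apply Rabs_def1; lra|apply flat_off_sphere; auto; lra].
  - exfalso; apply Hn, Hz; lra.
  - destruct (zero_interval_left (fun u => dot (g u) (frameT g u)) s0 s1 d)
      as [b [Hb [Hzb Hlim]]]; auto.
    { intros u Hu; apply Hc; lra. }
    { intros u Hu Hu'; apply Hz; lra. }
    apply (dforce2_null_on_arc b s0 b); try lra; [intros u Hu; apply Hzb; lra|].
    apply flat_at_limit; [apply dforce_smooth; lra|].
    intros e He'; destruct (Hlim e He') as [x [Hx [Hx1 Hx2]]]; exists x.
    split; [apply Rabs_def1; lra|apply flat_off_sphere; auto; lra]. }
assert (E3 : e3 s0 = 0).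
{ pose proof (Rmin_l d (Rmin s0 (L - s0))); pose proof (Rmin_r d (Rmin s0 (L - s0))).
  pose proof (Rmin_l s0 (L - s0)); pose proof (Rmin_r s0 (L - s0)).
  assert (0 < Rmin d (Rmin s0 (L - s0))) by (repeat apply Rmin_pos; lra).
  (* The relation [e3 = - k h e2] is available on open arcs only, so [s0] is placed in the middle of
     one lying in [(0, L)] and in the neighbourhood given by [Hz]. *)
  set (m := Rmin d (Rmin s0 (L - s0)) / 2).
  rewrite (dforce3_eq mu L g hf harc (s0 - m) (s0 + m)); unfold m; try lra.
  - rewrite E2; ring.
  - intros u Hu; apply Hz; lra.
  - intros u Hu; apply cross_force_null; lra. }
destruct He; contradiction.
Qed.

Lemma vnorm_constant :
  (forall s, 0 < s < L -> dot (g s) (frameT g s) = 0) ->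
  constant_on L (fun s => vnorm (g s)).
Proof.
intros H; exists (vnorm (g (L / 2))); intros s Hs.
(* The scalar [|g|^2] is padded to a vector to reuse [vector_constant]; its derivative is
   [2 <g, T>]. *)
enough (E : (dot (g s) (g s), 0, 0) = (dot (g (L / 2)) (g (L / 2)), 0, 0))
  by (injection E; intros E'; unfold vnorm; now rewrite E').
apply (vector_constant L (fun s => (dot (g s) (g s), 0, 0))); auto.
- intros u Hu; pose proof (frenet_smooth L g hf u Hu) as Hg.
  exact (conj (smooth_at_dot _ _ _ Hg Hg) (conj (smooth_at_const 0 u) (smooth_at_const 0 u))).
- intros u Hu; pose proof (is_vderive_curve L g hf harc u Hu) as D.
  pose proof (is_derive_dot _ _ _ _ _ D D) as D2.
  rewrite (dot_sym (frameT g u)), (H u Hu), Rplus_0_r in D2.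
  exact (is_vderive_unique (fun s => (dot (g s) (g s), 0, 0)) u null_vec
    (conj D2 (conj (is_derive_Rconst 0 u) (is_derive_Rconst 0 u)))).
Qed.

End Torque.

Theorem mainTheorem2 (mu L : R) (g : R -> vec)
    (hL : 0 < L)
    (hfrenet : frenet_curve L g)
    (harc : arclength L g) :
  (elastic_strip mu L g -> constant_on L (torque_vector mu g)) /\
  (constant_on L (torque_vector mu g) -> ~ elastic_strip mu L g ->
     constant_on L (fun s => vnorm (g s))).
Proof.
split.
- intros He; apply torque_constant_of_force_constant; auto.
  now apply force_constant_of_elastic_strip.
- intros Ht Hn; apply vnorm_constant; auto.
  destruct (classic (exists s0, 0 < s0 < L /\
    (dforce2 mu g s0 <> 0 \/ dforce3 g s0 <> 0))) as [[s0 [Hs0 He]]|Hno].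
  + exact (spherical_of_force_nonconstant mu L g hfrenet harc Ht s0 Hs0 He).
  (* If [e2] and [e3] vanish throughout, [b0] is constant and the curve is an elastic strip, against
     the hypothesis. *)
  + exfalso; apply Hn, elastic_strip_of_force_constant; auto; intros s Hs.
    rewrite (is_vderive_unique _ _ _ (is_vderive_force mu L g hfrenet harc s Hs)).
    assert (E2 : dforce2 mu g s = 0).
    { apply NNPP; intros E; apply Hno; exists s; auto. }
    assert (E3 : dforce3 g s = 0).
    { apply NNPP; intros E; apply Hno; exists s; auto. }
    rewrite E2, E3; unfold frame_vec, null_vec.
    generalize (frameT g s) (frameN g s) (frameB g s); intros; apply vec_ext; vcomp; ring.
Qed.
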